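(* Let $\mathcal M$ be a monoidal model category with unit $I$, and let $A$, $B$, and $C$ be monoids in $\mathcal M$. Assume that each category of modules appearing in each statement below is a closed model category with fibrations and weak equivalences created in $\mathcal M$. If $B$ is semicofibrant when considered as an object in $\mathcal M$, then: (a) The natural transformation $$\mathrm{Ext}_A(-_B,-_C)\to\mathrm{Ext}_A(-,-)={}^A[\![-,-]\!]$$ in $\mathrm{Ho}\mathcal M$ (of functors on $\mathrm{Ho}({}_A\mathcal M_B)^{\mathrm{op}}\times\mathrm{Ho}({}_A\mathcal M_C)$) induced by the unit maps $I\to B$ and $I\to C$ is an isomorphism. (b) If the underlying object of $A$ is semicofibrant in $\mathcal M$, then the natural transformation $$\mathrm{Tor}_B(-,-_C)\to\mathrm{Tor}_B({}_A-,-_C)$$ in $\mathrm{Ho}(\mathcal M_C)$ induced by the unit map $I\to A$ is an isomorphism. Similarly, if the underlying object of $C$ is semicofibrant in $\mathcal M$, then the natural transformation $$\mathrm{Tor}_B({}_A-,-)\to\mathrm{Tor}_B({}_A-,-_C)$$ in $\mathrm{Ho}({}_A\mathcal M)$ induced by the unit map $I\to C$ is an isomorphism. (In (b) the functors are defined on $\mathrm{Ho}({}_A\mathcal M_B)\times\mathrm{Ho}({}_B\mathcal M_C)$.)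
   Context: Monoidal model category: a closed model category $\mathcal M$ with a closed symmetric monoidal structure (product $\wedge$, unit $I$, internal function object $[-,-]$) such that: (Enr) if $g\colon K\to L$ is a cofibration and $h\colon X\to Y$ is a fibration, then the induced map $[L,X]\to[K,X]\times_{[K,Y]}[L,Y]$ is a fibration, and it is a weak equivalence if $g$ or $h$ is; (Unit) there exist a cofibrant object $I_c$ and a weak equivalence $\omega\colon I_c\to I$ such that $Z\cong[I,Z]\xrightarrow{\omega^*}[I_c,Z]$ is a weak equivalence for every fibrant $Z$. Modules: ${}_A\mathcal M$, $\mathcal M_B$, ${}_A\mathcal M_B$ are the categories of left $A$-modules, right $B$-modules and $(A,B)$-bimodules; they are identified with bimodule categories by $\mathcal M={}_I\mathcal M_I$, ${}_A\mathcal M={}_A\mathcal M_I$, $\mathcal M_B={}_I\mathcal M_B$. For left $A$-modules $L,M$, ${}^A[L,M]$ is the equalizer of the two maps $[L,M]\rightrightarrows[A\wedge L,M]$ induced by the actions on $L$ and on $M$. For a right $B$-module $M$ and left $B$-module $N$, $M\wedge_BN$ is the coequalizer of the two maps $M\wedge B\wedge N\rightrightarrows M\wedge N$. These give functors ${}^A[-,-]\colon({}_A\mathcal M_B)^{\mathrm{op}}\times{}_A\mathcal M_C\to{}_B\mathcal M_C$ and $\wedge_B\colon{}_A\mathcal M_B\times{}_B\mathcal M_C\to{}_A\mathcal M_C$. A model structure on a module category has fibrations and weak equivalences created in $\mathcal M$ if a map is a fibration (weak equivalence) exactly when its underlying map in $\mathcal M$ is; forgetful functors then induce derived forgetful functors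 on homotopy categories (left implicit in the notation). Semicofibrant: an object $X$ of $\mathcal M$ is semicofibrant in $\mathcal M$ when $[X,-]\colon\mathcal M\to\mathcal M$ preserves fibrations and acyclic fibrations. ($I$ is always semicofibrant.) Derived functors: the left derived functor of a functor $\Phi\colon\mathcal C\to\mathcal D$ between model categories is the final functor $F\colon\mathrm{Ho}\mathcal C\to\mathrm{Ho}\mathcal D$ equipped with a natural transformation $F\gamma\to\gamma\Phi$ ($\gamma$ the localization functors); right derived functors are dual. Products have the coordinatewise model structure and opposites have fibrations and cofibrations interchanged. For $B$ semicofibrant in $\mathcal M$, $\mathrm{Ext}_A(-_B,-_C)\colon\mathrm{Ho}({}_A\mathcal M_B)^{\mathrm{op}}\times\mathrm{Ho}({}_A\mathcal M_C)\to\mathrm{Ho}({}_B\mathcal M_C)$ is the right derived functor of ${}^A[-,-]$ and $\mathrm{Tor}_B({}_A-,-_C)\colon\mathrm{Ho}({}_A\mathcal M_B)\times\mathrm{Ho}({}_B\mathcal M_C)\to\mathrm{Ho}({}_A\mathcal M_C)$ is the left derived functor of $\wedge_B$ (both exist). The notation for any monoid variable equal to $I$ is dropped; e.g. $\mathrm{Ext}_A(-,-)={}^A[\![-,-]\!]$ is the right derived functor of ${}^A[-,-]\colon{}_A\mathcal M^{\mathrm{op}}\times{}_A\mathcal M\to\mathcal M$. Induced transformations: maps of monoids $A'\to A$, $B'\to B$, $C'\to C$ with $B,B'$ semicofibrant in $\mathcal M$ induce, by the universal property of derived functors, unique natural transformations $\mathrm{Ext}_A(-_B,-_C)\to\mathrm{Ext}_{A'}(-_{B'},-_{C'})$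 (in $\mathrm{Ho}({}_{B'}\mathcal M_{C'})$) and $\mathrm{Tor}_{B'}({}_{A'}-,-_{C'})\to\mathrm{Tor}_B({}_A-,-_C)$ (in $\mathrm{Ho}({}_{A'}\mathcal M_{C'})$) compatible, via the universal transformations of the derived functors, with the evident natural maps ${}^A[-,-]\to{}^{A'}[-,-]$ and $\wedge_{B'}\to\wedge_B$. *)

(* Defs.v *)
From Stdlib Require Import ssreflect ssrfun ssrbool.
From Stdlib Require Import ClassicalEpsilon FunctionalExtensionality
  PropExtensionality ProofIrrelevance List FinFun.

Set Implicit Arguments.
Unset Strict Implicit.
Unset Printing Implicit Defensive.

Record Category := {
  ob :> Type;
  hom : ob -> ob -> Type;
  idm : forall X, hom X X;
  comp : forall X Y Z, hom Y Z -> hom X Y -> hom X Z;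
  compA : forall W X Y Z (h : hom Y Z) (g : hom X Y) (f : hom W X),
    comp (comp h g) f = comp h (comp g f);
  comp1m : forall X Y (f : hom X Y), comp (idm Y) f = f;
  compm1 : forall X Y (f : hom X Y), comp f (idm X) = f }.

Arguments hom {_} _ _.
Arguments idm {_} _.
Arguments comp {_ _ _ _} _ _.
Arguments compA {_ _ _ _ _} _ _ _.
Arguments comp1m {_ _ _} _.
Arguments compm1 {_ _ _} _.
Infix "∘" := comp (at level 40, left associativity).

Record Functor (C D : Category) := {
  fobj :> C -> D;
  fmap : forall X Y, hom X Y -> hom (fobj X) (fobj Y);
  fmap1 : forall X, fmap (idm X) = idm (fobj X);
  fmapM : forall X Y Z (g : hom Y Z) (f : hom X Y),
    fmap (g ∘ f) = fmap g ∘ fmap f }.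

Arguments fmap {_ _} _ {_ _} _.

Record Nat (C D : Category) (F G : Functor C D) := {
  ntc :> forall X, hom (F X) (G X);
  ntN : forall X Y (f : hom X Y), ntc Y ∘ fmap F f = fmap G f ∘ ntc X }.

Definition opCat (C : Category) : Category.
Proof.
refine {| ob := C; hom := fun X Y => @hom C Y X; idm := fun X => idm X;
          comp := fun X Y Z g f => f ∘ g |}.
- by move=> *; rewrite compA.
- by move=> *; rewrite compm1.
- by move=> *; rewrite comp1m.
Defined.

Definition prodCat (C D : Category) : Category.
Proof.
refine {| ob := (C * D)%type;
          hom := fun X Y => (hom X.1 Y.1 * hom X.2 Y.2)%type;
          idm := fun X => (idm X.1, idm X.2);
          comp := fun X Y Z g f => (g.1 ∘ f.1, g.2 ∘ f.2) |}.
- by move=> *; rewrite /= !compA.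
- by move=> X Y [f g]; rewrite /= !comp1m.
- by move=> X Y [f g]; rewrite /= !compm1.
Defined.

Definition compF (C D E : Category) (G : Functor D E) (F : Functor C D) :
  Functor C E.
Proof.
refine {| fobj := fun X => G (F X); fmap := fun X Y f => fmap G (fmap F f) |}.
- by move=> X; rewrite !fmap1.
- by move=> *; rewrite !fmapM.
Defined.
Infix "∘F" := compF (at level 40, left associativity).

Definition opF (C D : Category) (F : Functor C D) : Functor (opCat C) (opCat D).
Proof.
refine (@Build_Functor (opCat C) (opCat D) (fun X => F X)
  (fun X Y f => fmap F f) _ _).
- by move=> X; exact: (fmap1 F).
- by move=> X Y Z g f; exact: (fmapM F).
Defined.

Definition prodF (C D C' D' : Category) (F : Functor C D) (G : Functor C' D') :
  Functor (prodCat C C') (prodCat D D').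
Proof.
refine (@Build_Functor (prodCat C C') (prodCat D D') (fun X => (F X.1, G X.2))
  (fun X Y f => (fmap F f.1, fmap G f.2)) _ _).
- by move=> X /=; rewrite !fmap1.
- by move=> X Y Z g f /=; rewrite !fmapM.
Defined.

Definition is_iso (C : Category) (X Y : C) (f : hom X Y) : Prop :=
  exists g : hom Y X, g ∘ f = idm X /\ f ∘ g = idm Y.

Definition is_nat_iso (C D : Category) (F G : Functor C D) (t : Nat F G) : Prop :=
  forall X, is_iso (t X).

Definition finite_category (J : Category) : Prop :=
  Finite J /\ forall i j : J, Finite (hom i j).

Section Limits.
Variable C : Category.

Definition is_limit (J : Category) (D : Functor J C) (L : C)
    (p : forall j, hom L (D j)) : Prop :=
  (forall i j (u : hom i j), fmap D u ∘ p i = p j) /\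
  (forall X (q : forall j, hom X (D j)),
     (forall i j (u : hom i j), fmap D u ∘ q i = q j) ->
     exists! f : hom X L, forall j, p j ∘ f = q j).

Definition is_colimit (J : Category) (D : Functor J C) (L : C)
    (p : forall j, hom (D j) L) : Prop :=
  (forall i j (u : hom i j), p j ∘ fmap D u = p i) /\
  (forall X (q : forall j, hom (D j) X),
     (forall i j (u : hom i j), q j ∘ fmap D u = q i) ->
     exists! f : hom L X, forall j, f ∘ p j = q j).

Definition has_finite_limits : Prop :=
  forall J (D : Functor J C), finite_category J -> exists L p, @is_limit J D L p.

Definition has_finite_colimits : Prop :=
  forall J (D : Functor J C), finite_category J -> exists L p, @is_colimit J D L p.

Definition is_initial (O : C) : Prop := forall X, exists! f : hom O X, True.
Definition is_terminal (T : C) : Prop := forall X, exists! f : hom X T, True.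

Definition is_pullback (X Y Z P : C) (f : hom X Z) (g : hom Y Z)
    (p : hom P X) (q : hom P Y) : Prop :=
  f ∘ p = g ∘ q /\
  forall T (a : hom T X) (b : hom T Y), f ∘ a = g ∘ b ->
    exists! h : hom T P, p ∘ h = a /\ q ∘ h = b.

Definition is_equalizer (X Y E : C) (f g : hom X Y) (i : hom E X) : Prop :=
  f ∘ i = g ∘ i /\
  forall T (k : hom T X), f ∘ k = g ∘ k -> exists! h : hom T E, i ∘ h = k.

Definition is_coequalizer (X Y Q : C) (f g : hom X Y) (p : hom Y Q) : Prop :=
  p ∘ f = p ∘ g /\
  forall T (k : hom Y T), k ∘ f = k ∘ g -> exists! h : hom Q T, h ∘ p = k.

End Limits.

(* The category with two objects and two parallel arrows [false -> true]. *)
Definition pair_hom (i j : bool) : Type :=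
  match i, j with
  | false, true => bool
  | true, false => Empty_set
  | _, _ => unit
  end.

Definition pair_id (i : bool) : pair_hom i i :=
  match i with true => tt | false => tt end.

Definition pair_comp (i j k : bool) : pair_hom j k -> pair_hom i j -> pair_hom i k :=
  match i, j, k with
  | false, false, false => fun _ _ => tt
  | false, false, true => fun g _ => g
  | false, true, false => fun g _ => match g with end
  | false, true, true => fun _ f => f
  | true, false, false => fun _ f => match f with end
  | true, false, true => fun _ f => match f with end
  | true, true, false => fun g _ => g
  | true, true, true => fun _ _ => tt
  end.

Definition pairCat : Category.
Proof.
refine {| ob := bool; hom := pair_hom; idm := pair_id; comp := pair_comp |}.
- by move=> [] [] [] [] /= [] [] [].
- by move=> [] [] /= [].
- by move=> [] [] /= [].
Defined.

Lemma finite_pairCat : finite_category pairCat.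
Proof.
split; first by exists (true :: false :: nil) => -[] /=; auto.
move=> [] []; [exists (tt :: nil) | exists nil | exists (true :: false :: nil)
  | exists (tt :: nil)] => -[] /=; auto.
Qed.

Section Pair.
Variables (C : Category) (X Y : C) (f g : hom X Y).

Definition pair_obj (i : bool) : C := if i then Y else X.

Definition pair_map (i j : bool) : pair_hom i j -> hom (pair_obj i) (pair_obj j) :=
  match i, j with
  | false, false => fun _ => idm X
  | true, true => fun _ => idm Y
  | false, true => fun b => if b then f else g
  | true, false => fun e => match e with end
  end.

Definition pairF : Functor pairCat C.
Proof.
refine (@Build_Functor pairCat C pair_obj pair_map _ _).
- by case.
- by move=> [] [] [] /= [] [] /=; rewrite ?comp1m ?compm1.
Defined.

Lemma has_equalizer : has_finite_limits C ->
  exists E (i : hom E X), is_equalizer f g i.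
Proof.
move=> /(_ _ pairF finite_pairCat)[E [p [pc pU]]].
have e1 : f ∘ p false = p true := pc false true true.
have e2 : g ∘ p false = p true := pc false true false.
exists E, (p false); split; first by rewrite e1 e2.
move=> T k fk.
case: (pU T (fun j => if j as j return hom T (pair_obj j) then f ∘ k else k)).
  by move=> [] [] [] //=; rewrite ?comp1m.
move=> h [hp hu]; exists h; split; first exact: (hp false).
move=> h' hk; apply: hu => -[] //.
by rewrite -e1 compA hk.
Qed.

Lemma has_coequalizer : has_finite_colimits C ->
  exists Q (p : hom Y Q), is_coequalizer f g p.
Proof.
move=> /(_ _ pairF finite_pairCat)[Q [p [pc pU]]].
have e1 : p true ∘ f = p false := pc false true true.
have e2 : p true ∘ g = p false := pc false true false.
exists Q, (p true); split; first by rewrite e1 e2.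
move=> T k fk.
case: (pU T (fun j => if j as j return hom (pair_obj j) T then k else k ∘ f)).
  by move=> [] [] [] //=; rewrite ?compm1.
move=> h [hp hu]; exists h; split; first exact: (hp true).
move=> h' hk; apply: hu => -[] //.
by rewrite -e1 -compA hk.
Qed.

End Pair.

(* Closed model categories in the sense of Quillen: finite limits and
   colimits, and factorizations that are not required to be functorial. *)

Section Model.
Variable C : Category.

Definition hom_class := forall X Y : C, hom X Y -> Prop.

Definition is_retract (X Y X' Y' : C) (f : hom X Y) (g : hom X' Y') : Prop :=
  exists (i : hom X X') (r : hom X' X) (j : hom Y Y') (s : hom Y' Y),
    [/\ r ∘ i = idm X, s ∘ j = idm Y, g ∘ i = j ∘ f & f ∘ r = s ∘ g].

Definition lifts (A B X Y : C) (i : hom A B) (p : hom X Y) : Prop :=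
  forall (u : hom A X) (v : hom B Y), p ∘ u = v ∘ i ->
    exists h : hom B X, h ∘ i = u /\ p ∘ h = v.

Record ModelStructure := {
  cof : hom_class;
  fib : hom_class;
  weq : hom_class;
  model_limits : has_finite_limits C;
  model_colimits : has_finite_colimits C;
  weq_comp : forall X Y Z (g : hom Y Z) (f : hom X Y),
    weq f -> weq g -> weq (g ∘ f);
  weq_cancel_l : forall X Y Z (g : hom Y Z) (f : hom X Y),
    weq g -> weq (g ∘ f) -> weq f;
  weq_cancel_r : forall X Y Z (g : hom Y Z) (f : hom X Y),
    weq f -> weq (g ∘ f) -> weq g;
  cof_retract : forall X Y X' Y' (f : hom X Y) (g : hom X' Y'),
    is_retract f g -> cof g -> cof f;
  fib_retract : forall X Y X' Y' (f : hom X Y) (g : hom X' Y'),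
    is_retract f g -> fib g -> fib f;
  weq_retract : forall X Y X' Y' (f : hom X Y) (g : hom X' Y'),
    is_retract f g -> weq g -> weq f;
  acof_fib_lifts : forall A B X Y (i : hom A B) (p : hom X Y),
    cof i -> weq i -> fib p -> lifts i p;
  cof_afib_lifts : forall A B X Y (i : hom A B) (p : hom X Y),
    cof i -> fib p -> weq p -> lifts i p;
  factor_acof_fib : forall X Y (f : hom X Y),
    exists Z (i : hom X Z) (p : hom Z Y), [/\ f = p ∘ i, cof i, weq i & fib p];
  factor_cof_afib : forall X Y (f : hom X Y),
    exists Z (i : hom X Z) (p : hom Z Y), [/\ f = p ∘ i, cof i, fib p & weq p] }.

Definition cofibrant (m : ModelStructure) (X : C) : Prop :=
  forall O, is_initial O -> forall f : hom O X, cof m f.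

Definition fibrant (m : ModelStructure) (X : C) : Prop :=
  forall T, is_terminal T -> forall f : hom X T, fib m f.

End Model.

(* The homotopy category is the localization at the class [W]: morphisms are
   formal composites of morphisms of [C] and of formal inverses of elements of
   [W], modulo the congruence generated by the relations in [wrel]. *)

Section Localization.
Variables (C : Category) (W : hom_class C).

Inductive word : C -> C -> Type :=
| w_map X Y (f : hom X Y) : word X Y
| w_inv X Y (w : hom X Y) (_ : W w) : word Y X
| w_comp X Y Z (b : word Y Z) (a : word X Y) : word X Z.

Inductive wrel : forall X Y, word X Y -> word X Y -> Prop :=
| wr_refl X Y (a : word X Y) : wrel a a
| wr_sym X Y (a b : word X Y) : wrel a b -> wrel b a
| wr_trans X Y (a b c : word X Y) : wrel a b -> wrel b c -> wrel a c
| wr_comp X Y Z (b b' : word Y Z) (a a' : word X Y) :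
    wrel b b' -> wrel a a' -> wrel (w_comp b a) (w_comp b' a')
| wr_assoc T X Y Z (c : word Y Z) (b : word X Y) (a : word T X) :
    wrel (w_comp (w_comp c b) a) (w_comp c (w_comp b a))
| wr_1m X Y (a : word X Y) : wrel (w_comp (w_map (idm Y)) a) a
| wr_m1 X Y (a : word X Y) : wrel (w_comp a (w_map (idm X))) a
| wr_map X Y Z (g : hom Y Z) (f : hom X Y) :
    wrel (w_comp (w_map g) (w_map f)) (w_map (g ∘ f))
| wr_invl X Y (w : hom X Y) (ww : W w) :
    wrel (w_comp (w_inv ww) (w_map w)) (w_map (idm X))
| wr_invr X Y (w : hom X Y) (ww : W w) :
    wrel (w_comp (w_map w) (w_inv ww)) (w_map (idm Y)).

Record wclass (X Y : C) := {
  wmem :> word X Y -> Prop;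
  wmemP : exists a, wmem = wrel a }.

Definition wcls X Y (a : word X Y) : wclass X Y :=
  {| wmem := wrel a; wmemP := ex_intro _ a eq_refl |}.

Definition wrep X Y (P : wclass X Y) : word X Y :=
  proj1_sig (constructive_indefinite_description _ (wmemP P)).

Lemma wclass_ext X Y (P Q : wclass X Y) : wmem P = wmem Q -> P = Q.
Proof.
by case: P Q => [P p] [Q q] /= e; case: _ / e q => q; rewrite (proof_irrelevance _ p q).
Qed.

Lemma wcls_eq X Y (a b : word X Y) : wcls a = wcls b <-> wrel a b.
Proof.
split=> [e|ab].
  have: wmem (wcls b) b by exact: wr_refl.
  by rewrite -e.
apply: wclass_ext; apply: functional_extensionality => c.
apply: propositional_extensionality; split=> /=; apply: wr_trans => //.
exact: wr_sym.
Qed.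

Lemma wrepK X Y (P : wclass X Y) : wcls (wrep P) = P.
Proof.
rewrite /wrep; case: constructive_indefinite_description => a /= e.
exact: wclass_ext.
Qed.

Lemma wrep_wcls X Y (a : word X Y) : wrel (wrep (wcls a)) a.
Proof. by apply/wcls_eq; rewrite wrepK. Qed.

Definition wclass_comp X Y Z (Q : wclass Y Z) (P : wclass X Y) : wclass X Z :=
  wcls (w_comp (wrep Q) (wrep P)).

Lemma wclass_compE X Y Z (b : word Y Z) (a : word X Y) :
  wclass_comp (wcls b) (wcls a) = wcls (w_comp b a).
Proof. by apply/wcls_eq; apply: wr_comp; exact: wrep_wcls. Qed.

Definition Ho : Category.
Proof.
refine {| ob := C; hom := wclass; idm := fun X => wcls (w_map (idm X));
          comp := wclass_comp |}.
- move=> T X Y Z P Q R; rewrite -(wrepK P) -(wrepK Q) -(wrepK R) !wclass_compE.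
  by apply/wcls_eq; exact: wr_assoc.
- move=> X Y P; rewrite -(wrepK P) wclass_compE.
  by apply/wcls_eq; exact: wr_1m.
- move=> X Y P; rewrite -(wrepK P) wclass_compE.
  by apply/wcls_eq; exact: wr_m1.
Defined.

Definition gam : Functor C Ho.
Proof.
refine (@Build_Functor C Ho (fun X => X) (fun X Y f => wcls (w_map f)) _ _) => //.
move=> X Y Z g f; rewrite /= wclass_compE; apply/wcls_eq.
exact/wr_sym/wr_map.
Defined.

Lemma gam_iso X Y (w : hom X Y) : W w -> is_iso (fmap gam w).
Proof.
move=> ww; exists (wcls (w_inv ww)).
by rewrite /= !wclass_compE; split; apply/wcls_eq; [exact: wr_invl | exact: wr_invr].
Qed.

Section Lift.
Variables (E : Category) (F : Functor C E).
Hypothesis FW : forall X Y (w : hom X Y), W w -> is_iso (fmap F w).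

Definition inv_of X Y (w : hom X Y) (ww : W w) : hom (F Y) (F X) :=
  proj1_sig (constructive_indefinite_description _ (FW ww)).

Fixpoint weval X Y (a : word X Y) : hom (F X) (F Y) :=
  match a with
  | w_map f => fmap F f
  | w_inv ww => inv_of ww
  | w_comp b a => weval b ∘ weval a
  end.

Lemma weval_rel X Y (a b : word X Y) : wrel a b -> weval a = weval b.
Proof.
elim=> {X Y a b} //=.
- by move=> X Y a b c _ -> _ ->.
- by move=> X Y Z b b' a a' _ -> _ ->.
- by move=> *; rewrite compA.
- by move=> *; rewrite fmap1 comp1m.
- by move=> *; rewrite fmap1 compm1.
- by move=> *; rewrite fmapM.
- move=> X Y w ww; rewrite fmap1 /inv_of.
  by case: constructive_indefinite_description => v /= [].
- move=> X Y w ww; rewrite fmap1 /inv_of.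
  by case: constructive_indefinite_description => v /= [].
Qed.

Definition ho_lift : Functor Ho E.
Proof.
refine (@Build_Functor Ho E (fun X => F X) (fun X Y P => weval (wrep P)) _ _).
- by move=> X; rewrite (weval_rel (wrep_wcls _)) /= fmap1.
- by move=> X Y Z Q P; rewrite (weval_rel (wrep_wcls _)).
Defined.

Lemma ho_liftE X Y (f : hom X Y) : fmap ho_lift (fmap gam f) = fmap F f.
Proof. by rewrite /= (weval_rel (wrep_wcls _)). Qed.

End Lift.
End Localization.

Arguments gam {C} W.

(* The functor induced on homotopy categories by one preserving weak
   equivalences; [fmap (ho_map ..) (fmap (gam W) f) = fmap (gam W') (fmap F f)]
   is an instance of [ho_liftE]. *)
Definition ho_map (C D : Category) (W : hom_class C) (W' : hom_class D)
    (F : Functor C D) (FW : forall X Y (w : hom X Y), W _ _ w -> W' _ _ (fmap F w)) :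
  Functor (Ho W) (Ho W') :=
  @ho_lift C W (Ho W') (gam W' ∘F F) (fun X Y w ww => gam_iso (FW X Y w ww)).

(* Derived functors of [P] relative to localization functors [gC] and [gD]. *)
Section Derived.
Variables (C D HC HD : Category) (gC : Functor C HC) (gD : Functor D HD).
Variable P : Functor C D.

Record LeftDerived := {
  ld_fun :> Functor HC HD;
  ld_nat : Nat (ld_fun ∘F gC) (gD ∘F P);
  ld_univ : forall (G : Functor HC HD) (xi : Nat (G ∘F gC) (gD ∘F P)),
    exists! t : Nat G ld_fun, forall X : C, ld_nat X ∘ t (gC X) = xi X }.

Record RightDerived := {
  rd_fun :> Functor HC HD;
  rd_nat : Nat (gD ∘F P) (rd_fun ∘F gC);
  rd_univ : forall (G : Functor HC HD) (xi : Nat (gD ∘F P) (G ∘F gC)),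
    exists! t : Nat rd_fun G, forall X : C, t (gC X) ∘ rd_nat X = xi X }.

End Derived.

(* Closed symmetric monoidal categories, with the coherence axioms of
   Mac Lane.  The internal hom is right adjoint to tensoring on the left:
   maps [Y ⊗ X -> Z] correspond to maps [X -> ihom Y Z]. *)

Record ClosedSymMon := {
  smc_cat :> Category;
  tens : smc_cat -> smc_cat -> smc_cat;
  tmap : forall X X' Y Y', hom X X' -> hom Y Y' -> hom (tens X Y) (tens X' Y');
  tmap1 : forall X Y, tmap (idm X) (idm Y) = idm (tens X Y);
  tmapM : forall X X' X'' Y Y' Y'' (f' : hom X' X'') (f : hom X X')
    (g' : hom Y' Y'') (g : hom Y Y'),
    tmap (f' ∘ f) (g' ∘ g) = tmap f' g' ∘ tmap f g;
  munit : smc_cat;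
  asr : forall X Y Z, hom (tens (tens X Y) Z) (tens X (tens Y Z));
  asl : forall X Y Z, hom (tens X (tens Y Z)) (tens (tens X Y) Z);
  aslK : forall X Y Z, asr X Y Z ∘ asl X Y Z = idm _;
  asrK : forall X Y Z, asl X Y Z ∘ asr X Y Z = idm _;
  asrN : forall X X' Y Y' Z Z' (f : hom X X') (g : hom Y Y') (h : hom Z Z'),
    asr X' Y' Z' ∘ tmap (tmap f g) h = tmap f (tmap g h) ∘ asr X Y Z;
  lun : forall X, hom (tens munit X) X;
  lun_iso : forall X, is_iso (lun X);
  lunN : forall X X' (f : hom X X'), lun X' ∘ tmap (idm _) f = f ∘ lun X;
  run : forall X, hom (tens X munit) X;
  run_iso : forall X, is_iso (run X);
  runN : forall X X' (f : hom X X'), run X' ∘ tmap f (idm _) = f ∘ run X;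
  pentagon : forall W X Y Z,
    tmap (idm W) (asr X Y Z) ∘ (asr W (tens X Y) Z ∘ tmap (asr W X Y) (idm Z))
    = asr W X (tens Y Z) ∘ asr (tens W X) Y Z;
  triangle : forall X Y,
    tmap (idm X) (lun Y) ∘ asr X munit Y = tmap (run X) (idm Y);
  lun_run : lun munit = run munit;
  braid : forall X Y, hom (tens X Y) (tens Y X);
  braidN : forall X X' Y Y' (f : hom X X') (g : hom Y Y'),
    braid X' Y' ∘ tmap f g = tmap g f ∘ braid X Y;
  braidK : forall X Y, braid Y X ∘ braid X Y = idm _;
  braid_unit : forall X, lun X ∘ braid X munit = run X;
  hexagon : forall X Y Z,
    tmap (idm Y) (braid X Z) ∘ (asr Y X Z ∘ tmap (braid X Y) (idm Z))
    = asr Y Z X ∘ (braid X (tens Y Z) ∘ asr X Y Z);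
  ihom : smc_cat -> smc_cat -> smc_cat;
  ev : forall Y Z, hom (tens Y (ihom Y Z)) Z;
  curry : forall X Y Z, hom (tens Y X) Z -> hom X (ihom Y Z);
  curryK : forall X Y Z (f : hom (tens Y X) Z),
    ev Y Z ∘ tmap (idm Y) (curry f) = f;
  curry_ev : forall X Y Z (g : hom X (ihom Y Z)),
    curry (ev Y Z ∘ tmap (idm Y) g) = g }.

Arguments tens {_} _ _.
Arguments tmap {_ _ _ _ _} _ _.
Arguments munit {_}.
Arguments asr {_} _ _ _.
Arguments asl {_} _ _ _.
Arguments lun {_} _.
Arguments run {_} _.
Arguments braid {_} _ _.
Arguments ihom {_} _ _.
Arguments ev {_} _ _.
Arguments curry {_ _ _ _} _.

Infix "⊗" := tens (at level 35, right associativity).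
Infix "⊠" := tmap (at level 35, right associativity).

Section Monoidal.
Variable M : ClosedSymMon.
Implicit Types X Y Z : M.

Lemma pre2 (C : Category) (X Y Z : C) (g : hom Y Z) (f : hom X Y) h :
  g ∘ f = h -> forall W (x : hom W X), g ∘ (f ∘ x) = h ∘ x.
Proof. by move=> <- W x; rewrite compA. Qed.

Lemma pre22 (C : Category) (X Y Y' Z : C) (g : hom Y Z) (f : hom X Y)
    (g' : hom Y' Z) (f' : hom X Y') :
  g ∘ f = g' ∘ f' -> forall W (x : hom W X), g ∘ (f ∘ x) = g' ∘ (f' ∘ x).
Proof. by move=> e W x; rewrite -!compA e. Qed.

Lemma tmapM_pre X X' X'' Y Y' Y'' (f' : hom X' X'') (f : hom X X')
    (g' : hom Y' Y'') (g : hom Y Y') W (x : hom W _) :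
  (f' ⊠ g') ∘ ((f ⊠ g) ∘ x) = (f' ∘ f) ⊠ (g' ∘ g) ∘ x.
Proof. by rewrite tmapM compA. Qed.

Definition tm := (tmapM_pre, fun a b c d e f g h i j =>
  esym (@tmapM M a b c d e f g h i j), @comp1m M, @compm1 M).

Lemma aslN X X' Y Y' Z Z' (f : hom X X') (g : hom Y Y') (h : hom Z Z') :
  asl X' Y' Z' ∘ (f ⊠ (g ⊠ h)) = ((f ⊠ g) ⊠ h) ∘ asl X Y Z.
Proof.
rewrite -[LHS]compm1 -(aslK X Y Z) compA -(compA (f ⊠ _)) -asrN.
by rewrite -!compA asrK comp1m.
Qed.

Lemma asr_epi X Y Z T (f g : hom (X ⊗ Y ⊗ Z) T) :
  f ∘ asr X Y Z = g ∘ asr X Y Z -> f = g.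
Proof. by move=> e; rewrite -[f]compm1 -[g]compm1 -(aslK X Y Z) -!compA e. Qed.

Lemma asr_mono X Y Z T (f g : hom T ((X ⊗ Y) ⊗ Z)) :
  asr X Y Z ∘ f = asr X Y Z ∘ g -> f = g.
Proof. by move=> e; rewrite -[f]comp1m -[g]comp1m -(asrK X Y Z) !compA e. Qed.

Lemma asl_epi X Y Z T (f g : hom ((X ⊗ Y) ⊗ Z) T) :
  f ∘ asl X Y Z = g ∘ asl X Y Z -> f = g.
Proof. by move=> e; rewrite -[f]compm1 -[g]compm1 -(asrK X Y Z) -!compA e. Qed.

Lemma tlun_inj X Y (f g : hom X Y) : idm (@munit M) ⊠ f = idm munit ⊠ g -> f = g.
Proof.
move=> e; case: (lun_iso X) => v [_ lv].
by rewrite -[f]compm1 -[g]compm1 -lv -!compA -!lunN e.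
Qed.

Lemma trun_inj X Y (f g : hom X Y) : f ⊠ idm (@munit M) = g ⊠ idm munit -> f = g.
Proof.
move=> e; case: (run_iso X) => v [_ lv].
by rewrite -[f]compm1 -[g]compm1 -lv -!compA -!runN e.
Qed.

Lemma lun_tens X Y : lun (X ⊗ Y) ∘ asr munit X Y = lun X ⊠ idm Y.
Proof.
apply: tlun_inj; apply: asr_epi.
have aK : (asr munit munit X ⊠ idm Y) ∘ (asl munit munit X ⊠ idm Y) = idm _.
  by rewrite !tm aslK tmap1.
rewrite -[LHS]compm1 -[RHS]compm1 -aK -!compA; congr (_ ∘ _).
rewrite -{1}[idm munit]comp1m tmapM !compA pentagon.
rewrite (pre2 (triangle _ _)) -tmap1 -asrN.
by rewrite (pre22 (esym (asrN _ _ _))) !tm triangle.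
Qed.

Lemma run_tens X Y : (idm X ⊠ run Y) ∘ asr X Y munit = run (X ⊗ Y).
Proof.
apply: trun_inj; apply: asr_mono.
rewrite -{1}[idm munit]comp1m tmapM (pre22 (asrN _ _ _)) -triangle.
rewrite -{1}[idm X]comp1m tmapM compA pentagon.
by rewrite (pre22 (esym (asrN _ _ _))) tmap1 triangle.
Qed.


Lemma triangle_asl X Y : (run X ⊠ idm Y) ∘ asl X munit Y = idm X ⊠ lun Y.
Proof. by rewrite -triangle compA aslK compm1. Qed.

Lemma curry_uniq X Y Z (f g : hom X (ihom Y Z)) :
  ev Y Z ∘ (idm Y ⊠ f) = ev Y Z ∘ (idm Y ⊠ g) -> f = g.
Proof. by move=> e; rewrite -(curry_ev f) e curry_ev. Qed.

Lemma tmapL X X' X'' Y (g : hom X' X'') (f : hom X X') :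
  (g ∘ f) ⊠ idm Y = (g ⊠ idm Y) ∘ (f ⊠ idm Y).
Proof. by rewrite -tmapM comp1m. Qed.

Lemma tmapR X Y Y' Y'' (g : hom Y' Y'') (f : hom Y Y') :
  idm X ⊠ (g ∘ f) = (idm X ⊠ g) ∘ (idm X ⊠ f).
Proof. by rewrite -tmapM comp1m. Qed.

Lemma tmapL_pre X X' X'' Y (g : hom X' X'') (f : hom X X') W (x : hom W (X ⊗ Y)) :
  (g ⊠ idm Y) ∘ ((f ⊠ idm Y) ∘ x) = ((g ∘ f) ⊠ idm Y) ∘ x.
Proof. by rewrite tmapL compA. Qed.

Lemma tmapR_pre X Y Y' Y'' (g : hom Y' Y'') (f : hom Y Y') W (x : hom W (X ⊗ Y)) :
  (idm X ⊠ g) ∘ ((idm X ⊠ f) ∘ x) = (idm X ⊠ (g ∘ f)) ∘ x.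
Proof. by rewrite tmapR compA. Qed.

Lemma tmapC X X' Y Y' (f : hom X X') (g : hom Y Y') :
  (f ⊠ idm Y') ∘ (idm X ⊠ g) = (idm X' ⊠ g) ∘ (f ⊠ idm Y).
Proof. by rewrite -!tmapM !comp1m !compm1. Qed.

Lemma asrN1 X X' Y Z (f : hom X X') :
  asr X' Y Z ∘ ((f ⊠ idm Y) ⊠ idm Z) = (f ⊠ idm (Y ⊗ Z)) ∘ asr X Y Z.
Proof. by rewrite asrN tmap1. Qed.

Lemma asrN2 X Y Y' Z (f : hom Y Y') :
  asr X Y' Z ∘ ((idm X ⊠ f) ⊠ idm Z) = (idm X ⊠ (f ⊠ idm Z)) ∘ asr X Y Z.
Proof. by rewrite asrN. Qed.

Lemma asrN3 X Y Z Z' (f : hom Z Z') :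
  asr X Y Z' ∘ (idm (X ⊗ Y) ⊠ f) = (idm X ⊠ (idm Y ⊠ f)) ∘ asr X Y Z.
Proof. by rewrite -tmap1 asrN. Qed.

Lemma aslN1 X X' Y Z (f : hom X X') :
  asl X' Y Z ∘ (f ⊠ idm (Y ⊗ Z)) = ((f ⊠ idm Y) ⊠ idm Z) ∘ asl X Y Z.
Proof. by rewrite -tmap1 aslN. Qed.

Lemma aslN2 X Y Y' Z (f : hom Y Y') :
  asl X Y' Z ∘ (idm X ⊠ (f ⊠ idm Z)) = ((idm X ⊠ f) ⊠ idm Z) ∘ asl X Y Z.
Proof. by rewrite aslN. Qed.

Lemma aslN3 X Y Z Z' (f : hom Z Z') :
  asl X Y Z' ∘ (idm X ⊠ (idm Y ⊠ f)) = (idm (X ⊗ Y) ⊠ f) ∘ asl X Y Z.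
Proof. by rewrite aslN tmap1. Qed.

Lemma asrKL W X Y Z : (asl W X Y ⊠ idm Z) ∘ (asr W X Y ⊠ idm Z) = idm _.
Proof. by rewrite -tmapL asrK tmap1. Qed.

Lemma aslKL W X Y Z : (asr W X Y ⊠ idm Z) ∘ (asl W X Y ⊠ idm Z) = idm _.
Proof. by rewrite -tmapL aslK tmap1. Qed.

Lemma asrKR W X Y Z : (idm W ⊠ asl X Y Z) ∘ (idm W ⊠ asr X Y Z) = idm _.
Proof. by rewrite -tmapR asrK tmap1. Qed.

Lemma aslKR W X Y Z : (idm W ⊠ asr X Y Z) ∘ (idm W ⊠ asl X Y Z) = idm _.
Proof. by rewrite -tmapR aslK tmap1. Qed.

Lemma pent2 W X Y Z :
  asr W (X ⊗ Y) Z ∘ ((asr W X Y ⊠ idm Z) ∘ asl (W ⊗ X) Y Z)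
  = (idm W ⊠ asl X Y Z) ∘ asr W X (Y ⊗ Z).
Proof.
rewrite -[LHS]comp1m -(asrKR W X Y Z) compA; congr (_ ∘ _).
by rewrite -(compA (asr W _ _)) -compA pentagon compA aslK compm1.
Qed.

Lemma pent3 W X Y Z :
  asl (W ⊗ X) Y Z ∘ (asl W X (Y ⊗ Z) ∘ (idm W ⊠ asr X Y Z))
  = (asl W X Y ⊠ idm Z) ∘ asl W (X ⊗ Y) Z.
Proof.
rewrite -[LHS]comp1m -(asrKL W X Y Z) compA; congr (_ ∘ _).
rewrite -[LHS]comp1m -(asrK W (X ⊗ Y) Z) compA -[RHS]compm1; congr (_ ∘ _).
rewrite -(compA (asr _ _ _ ⊠ _)) -(compA (asr _ _ _)) pent2.
by rewrite compA (pre2 (aslK _ _ _)) comp1m asrKR.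
Qed.

Lemma pent4 W X Y Z :
  asr (W ⊗ X) Y Z ∘ ((asl W X Y ⊠ idm Z) ∘ asl W (X ⊗ Y) Z)
  = asl W X (Y ⊗ Z) ∘ (idm W ⊠ asr X Y Z).
Proof. by rewrite -pent3 (pre2 (aslK _ _ _)) comp1m. Qed.

Lemma pent6 W X Y Z :
  asl W (X ⊗ Y) Z ∘ ((idm W ⊠ asl X Y Z) ∘ asr W X (Y ⊗ Z))
  = (asr W X Y ⊠ idm Z) ∘ asl (W ⊗ X) Y Z.
Proof. by rewrite -pent2 (pre2 (asrK _ _ _)) comp1m. Qed.

Lemma pent7 W X Y Z :
  asl W X (Y ⊗ Z) ∘ ((idm W ⊠ asr X Y Z) ∘ asr W (X ⊗ Y) Z)
  = asr (W ⊗ X) Y Z ∘ (asl W X Y ⊠ idm Z).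
Proof. by rewrite -compA -pent4 !compA asrK compm1. Qed.

Lemma coeq_tensl Z X Y Q (f g : hom X Y) (p : hom Y Q) :
  is_coequalizer f g p -> is_coequalizer (idm Z ⊠ f) (idm Z ⊠ g) (idm Z ⊠ p).
Proof.
move=> [pe pu]; split; first by rewrite -!tmapR pe.
move=> T k ke; case: (pu _ (curry k)).
  by apply: curry_uniq; rewrite !tmapR !(pre2 (curryK _)).
move=> h [hk hu]; exists (ev _ _ ∘ (idm Z ⊠ h)); split.
  by rewrite compA -tmapR hk curryK.
move=> h' h'k; rewrite (hu (curry h')) ?curryK //.
by apply: curry_uniq; rewrite tmapR (pre2 (curryK _)) curryK.
Qed.

Lemma coeq_tensr Z X Y Q (f g : hom X Y) (p : hom Y Q) :
  is_coequalizer f g p -> is_coequalizer (f ⊠ idm Z) (g ⊠ idm Z) (p ⊠ idm Z).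
Proof.
move=> pc; case: (coeq_tensl Z pc) => pe pu.
split; first by rewrite -!tmapL pc.1.
move=> T k ke; case: (pu _ (k ∘ braid _ _)).
  by rewrite !compA !braidN -!compA ke.
move=> h [hk hu]; exists (h ∘ braid _ _); split.
  by rewrite compA braidN -compA hk compA braidK compm1.
move=> h' h'k; rewrite (hu (h' ∘ braid _ _)) ?compA ?braidK ?compm1 //.
by rewrite braidN -compA h'k.
Qed.

Lemma coeq_epi (C : Category) (X Y Q : C) (f g : hom X Y) (p : hom Y Q) :
  is_coequalizer f g p ->
  forall T (h k : hom Q T), h ∘ p = k ∘ p -> h = k.
Proof.
move=> [pe pu] T h k e; case: (pu T (h ∘ p)); first by rewrite !compA pe.
by move=> l [_ lu]; rewrite -(lu h) // -(lu k).
Qed.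

End Monoidal.

(* [K,X] -> [K',X'] induced by [K' -> K] and [X -> X']. *)
Definition imap (M : ClosedSymMon) (K K' X X' : M) (f : hom K' K) (g : hom X X') :
  hom (ihom K X) (ihom K' X') := curry (g ∘ (ev K X ∘ (f ⊠ idm _))).

Record MonoidalModelCategory := {
  mm_smc :> ClosedSymMon;
  mm_model : ModelStructure mm_smc;
  mm_enr : forall (K L X Y : mm_smc) (g : hom K L) (h : hom X Y),
    cof mm_model g -> fib mm_model h ->
    forall P (p : hom P (ihom K X)) (q : hom P (ihom L Y)),
    is_pullback (imap (idm K) h) (imap g (idm Y)) p q ->
    forall u : hom (ihom L X) P,
    p ∘ u = imap g (idm X) -> q ∘ u = imap (idm L) h ->
    fib mm_model u /\ (weq mm_model g \/ weq mm_model h -> weq mm_model u);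
  mm_unit : exists (Ic : mm_smc) (w : hom Ic munit),
    [/\ cofibrant mm_model Ic, weq mm_model w &
      forall Z, fibrant mm_model Z ->
        weq mm_model (imap w (idm Z) ∘ curry (lun Z))] }.

Definition semicofibrant (M : MonoidalModelCategory) (X : M) : Prop :=
  (forall Y Z (f : hom Y Z), fib (mm_model M) f ->
     fib (mm_model M) (imap (idm X) f)) /\
  (forall Y Z (f : hom Y Z), fib (mm_model M) f -> weq (mm_model M) f ->
     fib (mm_model M) (imap (idm X) f) /\ weq (mm_model M) (imap (idm X) f)).

Section Monoids.
Variable M : ClosedSymMon.

Record Monoid := {
  mcar :> M;
  mmul : hom (mcar ⊗ mcar) mcar;
  mone : hom munit mcar;
  mmulA : mmul ∘ (mmul ⊠ idm mcar) = mmul ∘ ((idm mcar ⊠ mmul) ∘ asr _ _ _);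
  mmul1m : mmul ∘ (mone ⊠ idm mcar) = lun mcar;
  mmulm1 : mmul ∘ (idm mcar ⊠ mone) = run mcar }.

Record MonoidMap (A B : Monoid) := {
  mfun :> hom A B;
  mfunM : mfun ∘ mmul A = mmul B ∘ (mfun ⊠ mfun);
  mfun1 : mfun ∘ mone A = mone B }.

Definition unitMonoid : Monoid.
Proof.
refine {| mcar := munit; mmul := lun munit; mone := idm munit |}.
- by rewrite -compA lunN compA -lun_tens.
- by rewrite tmap1 compm1.
- by rewrite tmap1 compm1 lun_run.
Defined.

Definition idMonoid (A : Monoid) : MonoidMap A A.
Proof.
refine {| mfun := idm A |}.
- by rewrite tmap1 comp1m compm1.
- by rewrite comp1m.
Defined.

Definition unitMap (A : Monoid) : MonoidMap unitMonoid A.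
Proof.
refine (@Build_MonoidMap unitMonoid A (mone A) _ _) => /=; last exact: compm1.
have -> : mone A ⊠ mone A = (mone A ⊠ idm A) ∘ (idm munit ⊠ mone A).
  by rewrite -tmapM comp1m compm1.
by rewrite -compA mmul1m lunN.
Defined.

Record Bimod (A B : Monoid) := {
  bcar :> M;
  lact : hom (A ⊗ bcar) bcar;
  ract : hom (bcar ⊗ B) bcar;
  lactA : lact ∘ (mmul A ⊠ idm bcar) = lact ∘ ((idm A ⊠ lact) ∘ asr _ _ _);
  lact1 : lact ∘ (mone A ⊠ idm bcar) = lun bcar;
  ractA : ract ∘ (ract ⊠ idm B) = ract ∘ ((idm bcar ⊠ mmul B) ∘ asr _ _ _);
  ract1 : ract ∘ (idm bcar ⊠ mone B) = run bcar;
  lract : ract ∘ (lact ⊠ idm B) = lact ∘ ((idm A ⊠ ract) ∘ asr _ _ _) }.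

Record BimodMap (A B : Monoid) (X Y : Bimod A B) := {
  bfun :> hom X Y;
  bfunl : bfun ∘ lact X = lact Y ∘ (idm A ⊠ bfun);
  bfunr : bfun ∘ ract X = ract Y ∘ (bfun ⊠ idm B) }.

Lemma bimodmap_ext (A B : Monoid) (X Y : Bimod A B) (f g : BimodMap X Y) :
  bfun f = bfun g -> f = g.
Proof.
case: f g => [f fl fr] [g gl gr] /= e; case: _ / e gl gr => gl gr.
by rewrite (proof_irrelevance _ fl gl) (proof_irrelevance _ fr gr).
Qed.

Definition bimod_id (A B : Monoid) (X : Bimod A B) : BimodMap X X.
Proof.
refine {| bfun := idm X |}; abstract (by rewrite tmap1 comp1m compm1).
Defined.

Definition bimod_comp (A B : Monoid) (X Y Z : Bimod A B)
  (g : BimodMap Y Z) (f : BimodMap X Y) : BimodMap X Z.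
Proof.
refine {| bfun := bfun g ∘ bfun f |}.
- abstract (by rewrite compA bfunl -compA bfunl compA tmapR).
- abstract (by rewrite compA bfunr -compA bfunr compA tmapL).
Defined.

Definition bimodCat (A B : Monoid) : Category.
Proof.
refine {| ob := Bimod A B; hom := @BimodMap A B; idm := @bimod_id A B;
          comp := @bimod_comp A B |}.
- abstract (by move=> *; apply: bimodmap_ext; exact: compA).
- abstract (by move=> *; apply: bimodmap_ext; exact: comp1m).
- abstract (by move=> *; apply: bimodmap_ext; exact: compm1).
Defined.

Section Res.
Variables (A A' B B' : Monoid) (a : MonoidMap A' A) (b : MonoidMap B' B).

Definition res_ob (X : Bimod A B) : Bimod A' B'.
Proof.
refine {| bcar := bcar X; lact := lact X ∘ (a ⊠ idm X);
          ract := ract X ∘ (idm X ⊠ b) |}.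
- abstract (by rewrite !compA -tmapL mfunM tmapL (pre22 (lactA X)) !compA asrN !tm).
- abstract (by rewrite compA -tmapL mfun1 lact1).
- abstract (rewrite !compA;
    apply: (etrans (y := ract X ∘ ((ract X ⊠ idm B) ∘ ((idm X ⊠ b) ⊠ b))));
    [by rewrite !tm | by rewrite (pre22 (ractA X)) !compA asrN !tm -mfunM]).
- abstract (by rewrite compA -tmapR mfun1 ract1).
- abstract (rewrite !compA;
    apply: (etrans (y := ract X ∘ ((lact X ⊠ idm B) ∘ ((a ⊠ idm X) ⊠ b))));
    [by rewrite !tm | by rewrite (pre22 (lract X)) !compA asrN !tm]).
Defined.

Definition res_map (X Y : Bimod A B) (f : BimodMap X Y) :
  BimodMap (res_ob X) (res_ob Y).
Proof.
refine (@Build_BimodMap A' B' (res_ob X) (res_ob Y) (bfun f) _ _).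
- abstract (by rewrite /= -compA bfunl !compA tmapC).
- abstract (by rewrite /= -compA bfunr !compA tmapC).
Defined.

Definition resF : Functor (bimodCat A B) (bimodCat A' B').
Proof.
refine (@Build_Functor (bimodCat A B) (bimodCat A' B') res_ob res_map _ _).
- abstract (by move=> X; exact: bimodmap_ext).
- abstract (by move=> X Y Z g f; exact: bimodmap_ext).
Defined.

End Res.
End Monoids.

(* The function object [^A[L,M]] for [L : Bimod A B] and [N : Bimod A C], as a
   (B,C)-bimodule. *)

Section HomObject.
Variable M : MonoidalModelCategory.

Record Equalizer (X Y : M) (f g : hom X Y) := {
  eq_ob : M;
  eq_map : hom eq_ob X;
  eq_prop : is_equalizer f g eq_map }.

Definition equalizer (X Y : M) (f g : hom X Y) : Equalizer f g.
Proof.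
have h := has_equalizer f g (model_limits (mm_model M)).
case: (constructive_indefinite_description _ h) => E {}h.
case: (constructive_indefinite_description _ h) => i {}h.
exact: (Build_Equalizer h).
Qed.

Section Ob.
Variables (A B C : Monoid M) (L : Bimod A B) (N : Bimod A C).

Definition Alinear (X : M) (f : hom (L ⊗ X) N) : Prop :=
  f ∘ (lact L ⊠ idm X) = lact N ∘ ((idm A ⊠ f) ∘ asr A L X).

(* Laws of the actions of B and C on an object [E] representing A-linear maps. *)
Section Laws.
Variables (E : M) (e : hom (L ⊗ E) N) (l : hom (B ⊗ E) E) (r : hom (E ⊗ C) E).
Hypothesis e_lin : Alinear e.
Hypothesis e_uniq : forall X (f g : hom X E),
  e ∘ (idm _ ⊠ f) = e ∘ (idm _ ⊠ g) -> f = g.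
Hypothesis eL : e ∘ (idm _ ⊠ l) = e ∘ ((ract L ⊠ idm E) ∘ asl L B E).
Hypothesis eR : e ∘ (idm _ ⊠ r) = ract N ∘ ((e ⊠ idm C) ∘ asl L E C).

Lemma rep_lact_lin : Alinear (e ∘ ((ract L ⊠ idm E) ∘ asl L B E)).
Proof.
rewrite /Alinear !compA aslN1 tmapL_pre lract.
rewrite !tmapL !compA (pre22 e_lin) !compA !tmapR !compA.
by rewrite (pre22 (asrN2 _ _ _)) pent2.
Qed.

Lemma rep_ract_lin : Alinear (ract N ∘ ((e ⊠ idm C) ∘ asl L E C)).
Proof.
rewrite /Alinear !compA aslN1 tmapL_pre e_lin.
rewrite !tmapL !compA (pre22 (lract N)) !compA !tmapR !compA.
by rewrite (pre22 (asrN2 _ _ _)) pent2.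
Qed.

Lemma rep_lactA : l ∘ (mmul B ⊠ idm E) = l ∘ ((idm B ⊠ l) ∘ asr _ _ _).
Proof.
apply: e_uniq; rewrite !tmapR !(pre22 eL) !compA.
rewrite aslN2 (pre22 (aslN3 _ _ _)) (pre22 (tmapC _ _)).
rewrite (pre22 eL) !compA (pre22 (aslN1 _ _ _)) pent3.
rewrite [in RHS]tmapL_pre ractA !tmapL !compA (pre2 (aslKL _ _ _ _)).
by rewrite comp1m.
Qed.

Lemma rep_lact1 : l ∘ (mone B ⊠ idm E) = lun E.
Proof.
apply: e_uniq; rewrite tmapR (pre22 eL) !compA aslN2.
by rewrite tmapL_pre ract1 triangle_asl.
Qed.

Lemma rep_ractA : r ∘ (r ⊠ idm C) = r ∘ ((idm E ⊠ mmul C) ∘ asr _ _ _).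
Proof.
apply: e_uniq; rewrite !tmapR !(pre22 eR) !compA.
rewrite aslN2 tmapL_pre eR !tmapL !compA.
rewrite (pre22 (ractA _)) !compA (pre22 (asrN1 _ _ _)).
rewrite pent4 (pre22 (aslN3 _ _ _)).
by rewrite (pre22 (tmapC _ _)).
Qed.

Lemma rep_ract1 : r ∘ (idm E ⊠ mone C) = run E.
Proof.
apply: e_uniq; rewrite tmapR (pre22 eR) !compA aslN3.
rewrite (pre22 (tmapC _ _)) (pre2 (ract1 _)) (pre22 (runN _)).
by rewrite -run_tens !compA aslK compm1.
Qed.

Lemma rep_lract : r ∘ (l ⊠ idm C) = l ∘ ((idm B ⊠ r) ∘ asr _ _ _).
Proof.
apply: e_uniq; rewrite !tmapR (pre22 eL) (pre22 eR) !compA.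
rewrite aslN2 (pre22 (aslN3 _ _ _)) tmapL_pre eL.
rewrite (pre22 (tmapC _ _)) (pre22 eR) !compA.
by rewrite (pre22 (aslN1 _ _ _)) pent3 !tmapL !compA.
Qed.

End Laws.

Definition hom_actl : hom (ihom L N) (ihom (A ⊗ L) N) :=
  imap (lact L) (idm (bcar N)).

Definition hom_actr : hom (ihom L N) (ihom (A ⊗ L) N) :=
  curry (lact N ∘ ((idm A ⊠ ev L N) ∘ asr A L (ihom L N))).

Definition homA_eq : Equalizer hom_actl hom_actr := equalizer _ _.
Definition homA : M := eq_ob homA_eq.

Definition evA : hom (L ⊗ homA) N := ev L N ∘ (idm _ ⊠ eq_map homA_eq).

Lemma Alinear_curry (X : M) (k : hom X (ihom L N)) :
  hom_actl ∘ k = hom_actr ∘ k <-> Alinear (ev _ _ ∘ (idm _ ⊠ k)).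
Proof.
have e1 : ev _ _ ∘ (idm _ ⊠ (hom_actl ∘ k))
    = ev _ _ ∘ (idm _ ⊠ k) ∘ (lact L ⊠ idm X).
  rewrite tmapR (pre2 (curryK _)) comp1m !compA.
  by rewrite tmapC.
have e2 : ev _ _ ∘ (idm _ ⊠ (hom_actr ∘ k))
    = lact N ∘ ((idm A ⊠ (ev _ _ ∘ (idm _ ⊠ k))) ∘ asr A L X).
  by rewrite tmapR (pre2 (curryK _)) tmapR !compA asrN3.
split=> [e|e]; first by rewrite /Alinear -e1 -e2 e.
by apply: curry_uniq; rewrite e1 e2.
Qed.

Lemma evA_lin : Alinear evA.
Proof. by apply/Alinear_curry; exact: (eq_prop homA_eq).1. Qed.

Lemma Alinear_factor (X : M) (f : hom (L ⊗ X) N) : Alinear f ->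
  exists g : hom X homA, evA ∘ (idm _ ⊠ g) = f.
Proof.
rewrite -{1}(curryK f) => /Alinear_curry e.
case: ((eq_prop homA_eq).2 _ _ e) => g [gf _]; exists g.
by rewrite /evA compA -tmapR gf curryK.
Qed.

(* The map [X -> ^A[L,N]] corresponding to an A-linear map [L ⊗ X -> N]. *)
Definition curA (X : M) (f : hom (L ⊗ X) N) (fl : Alinear f) : hom X homA :=
  proj1_sig (constructive_indefinite_description _ (Alinear_factor fl)).

Lemma curAK (X : M) (f : hom (L ⊗ X) N) (fl : Alinear f) :
  evA ∘ (idm _ ⊠ curA fl) = f.
Proof. by rewrite /curA; case: constructive_indefinite_description. Qed.

Lemma curA_uniq (X : M) (f g : hom X homA) :
  evA ∘ (idm _ ⊠ f) = evA ∘ (idm _ ⊠ g) -> f = g.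
Proof.
rewrite /evA !compA -!tmapR => /curry_uniq e.
case: ((eq_prop homA_eq).2 _ (eq_map homA_eq ∘ f)).
  by rewrite -!compA (eq_prop homA_eq).1.
by move=> h [_ hu]; rewrite -(hu f) // -(hu g).
Qed.

Definition homA_lact : hom (B ⊗ homA) homA := curA (rep_lact_lin evA_lin).
Definition homA_ract : hom (homA ⊗ C) homA := curA (rep_ract_lin evA_lin).

Lemma homA_lactE :
  evA ∘ (idm _ ⊠ homA_lact) = evA ∘ ((ract L ⊠ idm homA) ∘ asl L B homA).
Proof. exact: curAK. Qed.

Lemma homA_ractE :
  evA ∘ (idm _ ⊠ homA_ract) = ract N ∘ ((evA ⊠ idm C) ∘ asl L homA C).
Proof. exact: curAK. Qed.

Definition homA_bimod : Bimod B C := {|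
  bcar := homA; lact := homA_lact; ract := homA_ract;
  lactA := rep_lactA curA_uniq homA_lactE;
  lact1 := rep_lact1 curA_uniq homA_lactE;
  ractA := rep_ractA curA_uniq homA_ractE;
  ract1 := rep_ract1 curA_uniq homA_ractE;
  lract := rep_lract curA_uniq homA_lactE homA_ractE |}.

End Ob.

Section Map.
Variables (A B C : Monoid M) (L L' : Bimod A B) (N N' : Bimod A C).
Variables (f : BimodMap L' L) (g : BimodMap N N').

Lemma homA_map_lin : Alinear (g ∘ (evA L N ∘ (f ⊠ idm _))).
Proof.
have := @evA_lin _ _ _ L N; move: (evA L N) => e el.
rewrite /Alinear !compA -tmapL bfunl tmapL (pre22 el) !compA (pre22 (bfunl g)).
rewrite asrN2.
by rewrite !tmapR !compA.
Qed.

Definition homA_fun : hom (homA L N) (homA L' N') := curA homA_map_lin.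

Lemma homA_funE :
  evA L' N' ∘ (idm _ ⊠ homA_fun) = g ∘ (evA L N ∘ (f ⊠ idm _)).
Proof. exact: curAK. Qed.

Lemma homA_map_l :
  homA_fun ∘ homA_lact L N = homA_lact L' N' ∘ (idm B ⊠ homA_fun).
Proof.
apply: curA_uniq; move: homA_funE (homA_lactE L N) (homA_lactE L' N').
move: homA_fun (homA_lact L N) (homA_lact L' N') (evA L N) (evA L' N').
move=> h l l' e e' hE lE lE'.
rewrite !tmapR (pre22 hE) (pre22 lE') !compA tmapC (pre22 lE) !compA.
rewrite aslN3 (pre22 (tmapC _ _)) (pre22 hE) !compA aslN1.
by rewrite !tmapL_pre bfunr.
Qed.

Lemma homA_map_r :
  homA_fun ∘ homA_ract L N = homA_ract L' N' ∘ (homA_fun ⊠ idm C).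
Proof.
apply: curA_uniq; move: homA_funE (homA_ractE L N) (homA_ractE L' N').
move: homA_fun (homA_ract L N) (homA_ract L' N') (evA L N) (evA L' N').
move=> h r r' e e' hE rE rE'.
rewrite !tmapR (pre22 hE) (pre22 rE') !compA tmapC (pre22 rE) !compA.
rewrite aslN2 aslN1 !tmapL_pre hE !tmapL !compA.
by rewrite (pre22 (bfunr g)).
Qed.

Definition homA_map : BimodMap (homA_bimod L N) (homA_bimod L' N') :=
  @Build_BimodMap _ B C (homA_bimod L N) (homA_bimod L' N') homA_fun
    homA_map_l homA_map_r.

End Map.

Definition homF (A B C : Monoid M) :
  Functor (prodCat (opCat (bimodCat A B)) (bimodCat A C)) (bimodCat B C).
Proof.
refine (@Build_Functor (prodCat (opCat (bimodCat A B)) (bimodCat A C))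
  (bimodCat B C) (fun X => homA_bimod X.1 X.2)
  (fun X Y f => homA_map f.1 f.2) _ _).
- abstract (move=> X; apply: bimodmap_ext; apply: curA_uniq;
    by rewrite homA_funE /= !tmap1 comp1m).
- move=> X Y Z g f; apply: bimodmap_ext; apply: curA_uniq.
  rewrite homA_funE /= tmapR (pre22 (homA_funE _ _)).
  move: (homA_funE f.1 f.2); move: (homA_fun f.1 f.2); move: (evA X.1 X.2).
  move: (evA Y.1 Y.2) => e e' h hE.
  by rewrite !compA tmapC (pre22 hE) tmapL !compA.
Defined.

Section HomRes.
Variables (A A' B B' C C' : Monoid M).
Variables (a : MonoidMap A' A) (b : MonoidMap B' B) (c : MonoidMap C' C).

Section Component.
Variables (L : Bimod A B) (N : Bimod A C).
Let L' := res_ob a b L.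
Let N' := res_ob a c N.

Lemma evA_res_lin : @Alinear A' B' C' L' N' _ (evA L N).
Proof.
have := @evA_lin _ _ _ L N; move: (evA L N) => e el.
rewrite /Alinear /= tmapL (pre22 el) !compA asrN1 (pre22 (tmapC _ _)).
by rewrite ?compA.
Qed.

(* The inclusion of ^A[L,N] in ^A'[L,N]. *)
Definition hom_res_fun : hom (homA L N) (homA L' N') := curA evA_res_lin.

Lemma hom_res_funE : evA L' N' ∘ (idm _ ⊠ hom_res_fun) = evA L N.
Proof. exact: curAK. Qed.

Lemma hom_res_l :
  hom_res_fun ∘ lact (res_ob b c (homA_bimod L N)) =
  lact (homA_bimod L' N') ∘ (idm B' ⊠ hom_res_fun).
Proof.
apply: curA_uniq; move: hom_res_funE (homA_lactE L N) (homA_lactE L' N').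
rewrite /=; move: hom_res_fun (homA_lact L N) (homA_lact L' N').
move: (evA L N) (evA L' N') => e e' h l l' hE lE lE'.
rewrite !tmapR (pre2 hE) (pre22 lE') (pre22 lE) !compA.
rewrite aslN2 aslN3 !tmapL_pre (pre22 (tmapC _ _)) (pre2 hE).
by [].
Qed.

Lemma hom_res_r :
  hom_res_fun ∘ ract (res_ob b c (homA_bimod L N)) =
  ract (homA_bimod L' N') ∘ (hom_res_fun ⊠ idm C').
Proof.
apply: curA_uniq; move: hom_res_funE (homA_ractE L N) (homA_ractE L' N').
rewrite /=; move: hom_res_fun (homA_ract L N) (homA_ract L' N').
move: (evA L N) (evA L' N') => e e' h r r' hE rE rE'.
rewrite !tmapR (pre2 hE) (pre22 rE') (pre22 rE) !compA.
rewrite aslN2 aslN3 tmapL_pre hE (pre22 (tmapC _ _)).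
by [].
Qed.

Definition hom_res_map :
  BimodMap (res_ob b c (homA_bimod L N)) (homA_bimod L' N') :=
  @Build_BimodMap _ B' C' (res_ob b c (homA_bimod L N)) (homA_bimod L' N')
    hom_res_fun hom_res_l hom_res_r.

End Component.

(* The natural map ^A[-,-] -> ^A'[-,-] of (B',C')-bimodules. *)
Definition hom_res :
  Nat (resF b c ∘F homF A B C)
      (homF A' B' C' ∘F prodF (opF (resF a b)) (resF a c)).
Proof.
refine (@Build_Nat _ _ (resF b c ∘F homF A B C)
  (homF A' B' C' ∘F prodF (opF (resF a b)) (resF a c))
  (fun X => hom_res_map X.1 X.2) _).
move=> X Y f; apply: bimodmap_ext; apply: curA_uniq => /=.
rewrite !tmapR (pre2 (hom_res_funE _ _)) homA_funE.
move: (homA_funE (res_map a b f.1) (res_map a c f.2)) => /= eR; rewrite (pre22 eR).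
move: (hom_res_funE X.1 X.2); move: (hom_res_fun X.1 X.2).
move: (evA X.1 X.2) (evA _ _) => e e' h hE.
by rewrite !compA tmapC (pre2 hE).
Defined.

End HomRes.
End HomObject.

(* The balanced product [X ∧_B Y] for [X : Bimod A B] and [Y : Bimod B C], as an
   (A,C)-bimodule. *)

Section TensorObject.
Variable M : MonoidalModelCategory.

Record Coequalizer (X Y : M) (f g : hom X Y) := {
  coeq_ob : M;
  coeq_map : hom Y coeq_ob;
  coeq_prop : is_coequalizer f g coeq_map }.

Definition coequalizer (X Y : M) (f g : hom X Y) : Coequalizer f g.
Proof.
have h := has_coequalizer f g (model_colimits (mm_model M)).
case: (constructive_indefinite_description _ h) => Q {}h.
case: (constructive_indefinite_description _ h) => p {}h.
exact: (Build_Coequalizer h).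
Qed.

Lemma coeq_factor (X Y Q T : M) (f g : hom X Y) (p : hom Y Q) (k : hom Y T) :
  is_coequalizer f g p -> k ∘ f = k ∘ g -> exists h : hom Q T, h ∘ p = k.
Proof. by move=> [_ pu] /pu[h [hk _]]; exists h. Qed.

Definition coeq_desc (X Y Q T : M) (f g : hom X Y) (p : hom Y Q) (k : hom Y T)
    (pc : is_coequalizer f g p) (ke : k ∘ f = k ∘ g) : hom Q T :=
  proj1_sig (constructive_indefinite_description _ (coeq_factor pc ke)).

Lemma coeq_descK (X Y Q T : M) (f g : hom X Y) (p : hom Y Q) (k : hom Y T)
    (pc : is_coequalizer f g p) (ke : k ∘ f = k ∘ g) :
  coeq_desc pc ke ∘ p = k.
Proof. by rewrite /coeq_desc; case: constructive_indefinite_description. Qed.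

Section Ob.
Variables (A B C : Monoid M) (X : Bimod A B) (Y : Bimod B C).

Definition ten_actl : hom ((X ⊗ B) ⊗ Y) (X ⊗ Y) := ract X ⊠ idm Y.
Definition ten_actr : hom ((X ⊗ B) ⊗ Y) (X ⊗ Y) :=
  (idm X ⊠ lact Y) ∘ asr X B Y.

(* Laws of the actions of A and C on a coequalizer of the two maps above. *)
Section Laws.
Variables (T : M) (q : hom (X ⊗ Y) T).
Hypothesis q_coeq : is_coequalizer ten_actl ten_actr q.
Variables (l : hom (A ⊗ T) T) (r : hom (T ⊗ C) T).
Hypothesis qL : l ∘ (idm A ⊠ q) = q ∘ ((lact X ⊠ idm Y) ∘ asl A X Y).
Hypothesis qR : r ∘ (q ⊠ idm C) = q ∘ ((idm X ⊠ ract Y) ∘ asr X Y C).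

Lemma q_bal : q ∘ (ract X ⊠ idm Y) = q ∘ ((idm X ⊠ lact Y) ∘ asr X B Y).
Proof. exact: q_coeq.1. Qed.

Lemma q_bal' : q ∘ (idm X ⊠ lact Y) = q ∘ ((ract X ⊠ idm Y) ∘ asl X B Y).
Proof. by rewrite (pre22 q_bal) !compA aslK compm1. Qed.

Lemma q_epi : forall Z (h k : hom T Z), h ∘ q = k ∘ q -> h = k.
Proof. exact: coeq_epi q_coeq. Qed.

Lemma bal_lact :
  q ∘ ((lact X ⊠ idm Y) ∘ asl A X Y) ∘ (idm A ⊠ ten_actl) =
  q ∘ ((lact X ⊠ idm Y) ∘ asl A X Y) ∘ (idm A ⊠ ten_actr).
Proof.
rewrite /ten_actl /ten_actr !compA tmapR aslN2 (pre22 (aslN3 _ _ _)).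
rewrite (pre22 (tmapC _ _)) (pre22 q_bal') !compA (pre22 (aslN1 _ _ _)) pent3.
rewrite !tmapL_pre lract !tmapL !compA (pre2 (aslKL _ _ _ _)).
by rewrite comp1m.
Qed.

Lemma bal_ract :
  q ∘ ((idm X ⊠ ract Y) ∘ asr X Y C) ∘ (ten_actl ⊠ idm C) =
  q ∘ ((idm X ⊠ ract Y) ∘ asr X Y C) ∘ (ten_actr ⊠ idm C).
Proof.
rewrite /ten_actl /ten_actr !compA tmapL asrN1 (pre22 (asrN2 _ _ _)).
rewrite -(pre22 (tmapC _ _)) (pre22 q_bal) !compA (pre22 (asrN3 _ _ _)).
rewrite [in RHS]tmapR_pre lract !tmapR !compA pentagon.
by [].
Qed.

Lemma ten_lactA : l ∘ (mmul A ⊠ idm T) = l ∘ ((idm A ⊠ l) ∘ asr _ _ _).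
Proof.
apply: (coeq_epi (coeq_tensl _ q_coeq)).
rewrite !compA tmapC (pre22 qL) asrN3 tmapR_pre qL !tmapR !compA (pre22 qL) !compA.
rewrite aslN1 tmapL_pre lactA.
rewrite (pre22 (aslN2 _ _ _)) pent6.
by rewrite !tmapL !compA.
Qed.

Lemma ten_lact1 : l ∘ (mone A ⊠ idm T) = lun T.
Proof.
apply: (coeq_epi (coeq_tensl _ q_coeq)).
rewrite !compA tmapC (pre22 qL) !compA aslN1 tmapL_pre lact1 lunN.
by rewrite -lun_tens compA aslK compm1.
Qed.

Lemma ten_ractA : r ∘ (r ⊠ idm C) = r ∘ ((idm T ⊠ mmul C) ∘ asr _ _ _).
Proof.
apply: (coeq_epi (coeq_tensr _ (coeq_tensr _ q_coeq))).
rewrite !compA asrN1 -(pre22 (tmapC _ _)) (pre22 qR) -tmapL qR !tmapL.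
rewrite (pre22 qR) !compA (pre22 (asrN2 _ _ _)) tmapR_pre ractA.
by rewrite !tmapR !compA pentagon (pre22 (asrN3 _ _ _)).
Qed.

Lemma ten_ract1 : r ∘ (idm T ⊠ mone C) = run T.
Proof.
apply: (coeq_epi (coeq_tensr _ q_coeq)).
rewrite !compA -tmapC (pre22 qR) !compA asrN3 tmapR_pre ract1 runN.
by rewrite run_tens.
Qed.

Lemma ten_lract : r ∘ (l ⊠ idm C) = l ∘ ((idm A ⊠ r) ∘ asr _ _ _).
Proof.
apply: (coeq_epi (coeq_tensr _ (coeq_tensl _ q_coeq))).
rewrite !compA -tmapL qL asrN2 tmapR_pre qR !tmapL !tmapR (pre22 qR) !compA.
rewrite (pre22 qL) !compA (pre22 (asrN1 _ _ _)) (pre22 (aslN3 _ _ _)) pent7.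
by rewrite (pre22 (tmapC _ _)).
Qed.

End Laws.

Definition tenB_coeq : Coequalizer ten_actl ten_actr := coequalizer _ _.
Definition tenB : M := coeq_ob tenB_coeq.
Definition qB : hom (X ⊗ Y) tenB := coeq_map tenB_coeq.

Lemma qB_coeq : is_coequalizer ten_actl ten_actr qB.
Proof. exact: coeq_prop. Qed.

Definition tenB_lact : hom (A ⊗ tenB) tenB :=
  coeq_desc (coeq_tensl A qB_coeq) (bal_lact qB_coeq).
Definition tenB_ract : hom (tenB ⊗ C) tenB :=
  coeq_desc (coeq_tensr C qB_coeq) (bal_ract qB_coeq).

Lemma tenB_lactE :
  tenB_lact ∘ (idm A ⊠ qB) = qB ∘ ((lact X ⊠ idm Y) ∘ asl A X Y).
Proof. exact: coeq_descK. Qed.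

Lemma tenB_ractE :
  tenB_ract ∘ (qB ⊠ idm C) = qB ∘ ((idm X ⊠ ract Y) ∘ asr X Y C).
Proof. exact: coeq_descK. Qed.

Definition tenB_bimod : Bimod A C := {|
  bcar := tenB; lact := tenB_lact; ract := tenB_ract;
  lactA := ten_lactA qB_coeq tenB_lactE;
  lact1 := ten_lact1 qB_coeq tenB_lactE;
  ractA := ten_ractA qB_coeq tenB_ractE;
  ract1 := ten_ract1 qB_coeq tenB_ractE;
  lract := ten_lract qB_coeq tenB_lactE tenB_ractE |}.

Lemma qB_epi : forall Z (h k : hom tenB Z), h ∘ qB = k ∘ qB -> h = k.
Proof. exact: coeq_epi qB_coeq. Qed.

End Ob.

Section Map.
Variables (A B C : Monoid M) (X X' : Bimod A B) (Y Y' : Bimod B C).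
Variables (f : BimodMap X X') (g : BimodMap Y Y').

Lemma tenB_map_bal :
  qB X' Y' ∘ (f ⊠ g) ∘ ten_actl X Y = qB X' Y' ∘ (f ⊠ g) ∘ ten_actr X Y.
Proof.
have := q_bal (qB_coeq X' Y'); move: (qB X' Y') => q qb.
rewrite /ten_actl /ten_actr.
have -> : f ⊠ g = (idm X' ⊠ g) ∘ (f ⊠ idm Y) by rewrite -tmapM comp1m compm1.
rewrite !compA -tmapL bfunr tmapL -(pre22 (tmapC _ _)) (pre22 qb) !compA.
rewrite (pre22 (asrN3 _ _ _)) asrN1 !tmapR_pre (pre22 (tmapC _ _)).
by rewrite tmapR_pre bfunl.
Qed.

Definition tenB_fun : hom (tenB X Y) (tenB X' Y') :=
  coeq_desc (qB_coeq X Y) tenB_map_bal.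

Lemma tenB_funE : tenB_fun ∘ qB X Y = qB X' Y' ∘ (f ⊠ g).
Proof. exact: coeq_descK. Qed.

Lemma tenB_map_l :
  tenB_fun ∘ tenB_lact X Y = tenB_lact X' Y' ∘ (idm A ⊠ tenB_fun).
Proof.
apply: (coeq_epi (coeq_tensl _ (qB_coeq X Y))).
move: tenB_funE (tenB_lactE X Y) (tenB_lactE X' Y').
move: tenB_fun (tenB_lact X Y) (tenB_lact X' Y') (qB X Y) (qB X' Y').
move=> h l l' q q' hE lE lE'.
rewrite !compA lE (pre22 hE) -tmapR hE tmapR (pre22 lE') !compA aslN.
by rewrite !tm bfunl ?compm1 ?comp1m.
Qed.

Lemma tenB_map_r :
  tenB_fun ∘ tenB_ract X Y = tenB_ract X' Y' ∘ (tenB_fun ⊠ idm C).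
Proof.
apply: (coeq_epi (coeq_tensr _ (qB_coeq X Y))).
move: tenB_funE (tenB_ractE X Y) (tenB_ractE X' Y').
move: tenB_fun (tenB_ract X Y) (tenB_ract X' Y') (qB X Y) (qB X' Y').
move=> h r r' q q' hE rE rE'.
rewrite !compA rE (pre22 hE) -tmapL hE tmapL (pre22 rE') !compA asrN.
by rewrite !tm bfunr.
Qed.

Definition tenB_map : BimodMap (tenB_bimod X Y) (tenB_bimod X' Y') :=
  @Build_BimodMap _ A C (tenB_bimod X Y) (tenB_bimod X' Y') tenB_fun
    tenB_map_l tenB_map_r.

End Map.

Definition tenF (A B C : Monoid M) :
  Functor (prodCat (bimodCat A B) (bimodCat B C)) (bimodCat A C).
Proof.
refine (@Build_Functor (prodCat (bimodCat A B) (bimodCat B C)) (bimodCat A C)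
  (fun X => tenB_bimod X.1 X.2) (fun X Y f => tenB_map f.1 f.2) _ _).
- abstract (move=> X; apply: bimodmap_ext; apply: qB_epi;
    by rewrite tenB_funE /= tmap1 compm1 comp1m).
- abstract (move=> X Y Z g f; apply: bimodmap_ext; apply: qB_epi;
    by rewrite tenB_funE /= compA tenB_funE -compA tenB_funE compA tmapM).
Defined.

Section TenRes.
Variables (A A' B B' C C' : Monoid M).
Variables (a : MonoidMap A' A) (b : MonoidMap B' B) (c : MonoidMap C' C).

Section Component.
Variables (X : Bimod A B) (Y : Bimod B C).
Let X' := res_ob a b X.
Let Y' := res_ob b c Y.

Lemma qB_res_bal : qB X Y ∘ ten_actl X' Y' = qB X Y ∘ ten_actr X' Y'.
Proof.
have := q_bal (qB_coeq X Y); move: (qB X Y) => q qb.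
rewrite /ten_actl /ten_actr /= tmapL tmapR (pre22 qb) !compA asrN2.
by [].
Qed.

(* The projection of X ∧_B' Y onto X ∧_B Y. *)
Definition ten_res_fun : hom (tenB X' Y') (tenB X Y) :=
  coeq_desc (qB_coeq X' Y') qB_res_bal.

Lemma ten_res_funE : ten_res_fun ∘ qB X' Y' = qB X Y.
Proof. exact: coeq_descK. Qed.

Lemma ten_res_l :
  ten_res_fun ∘ lact (tenB_bimod X' Y') =
  lact (res_ob a c (tenB_bimod X Y)) ∘ (idm A' ⊠ ten_res_fun).
Proof.
apply: (coeq_epi (coeq_tensl _ (qB_coeq X' Y'))).
move: ten_res_funE (tenB_lactE X Y) (tenB_lactE X' Y'); rewrite /=.
move: ten_res_fun (tenB_lact X Y) (tenB_lact X' Y') (qB X Y) (qB X' Y').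
move=> h l l' q q' hE lE lE'.
rewrite !compA lE' (pre2 hE) -tmapR hE tmapC (pre22 lE) !compA aslN1.
by rewrite tmapL !compA.
Qed.

Lemma ten_res_r :
  ten_res_fun ∘ ract (tenB_bimod X' Y') =
  ract (res_ob a c (tenB_bimod X Y)) ∘ (ten_res_fun ⊠ idm C').
Proof.
apply: (coeq_epi (coeq_tensr _ (qB_coeq X' Y'))).
move: ten_res_funE (tenB_ractE X Y) (tenB_ractE X' Y'); rewrite /=.
move: ten_res_fun (tenB_ract X Y) (tenB_ract X' Y') (qB X Y) (qB X' Y').
move=> h r r' q q' hE rE rE'.
rewrite !compA rE' (pre2 hE) -tmapL hE -tmapC (pre22 rE) !compA asrN3.
by rewrite tmapR !compA.
Qed.

Definition ten_res_map :
  BimodMap (tenB_bimod X' Y') (res_ob a c (tenB_bimod X Y)) :=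
  @Build_BimodMap _ A' C' (tenB_bimod X' Y') (res_ob a c (tenB_bimod X Y))
    ten_res_fun ten_res_l ten_res_r.

End Component.

(* The natural map of (A',C')-bimodules from ∧_B' to ∧_B. *)
Definition ten_res :
  Nat (tenF A' B' C' ∘F prodF (resF a b) (resF b c))
      (resF a c ∘F tenF A B C).
Proof.
refine (@Build_Nat _ _ (tenF A' B' C' ∘F prodF (resF a b) (resF b c))
  (resF a c ∘F tenF A B C) (fun X => ten_res_map X.1 X.2) _).
move=> X Y f; apply: bimodmap_ext; apply: qB_epi => /=.
move: (tenB_funE (res_map a b f.1) (res_map b c f.2)) => /= eR.
by rewrite !compA eR (pre2 (ten_res_funE _ _)) ten_res_funE tenB_funE.
Defined.

End TenRes.
End TensorObject.

(* The identifications of the categories of I-modules: the action of the unit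
   monoid on a bimodule is forced, and restriction along identities does
   nothing. *)
Section Identifications.
Variable M : ClosedSymMon.

Lemma unit_lact (B : Monoid M) (X : Bimod (unitMonoid M) B) : lact X = lun X.
Proof. by rewrite -lact1 tmap1 compm1. Qed.

Lemma unit_ract (A : Monoid M) (X : Bimod A (unitMonoid M)) : ract X = run X.
Proof. by rewrite -ract1 tmap1 compm1. Qed.

Lemma bimod_ext (A B : Monoid M) (X : M) (l l' : hom (A ⊗ X) X)
    (r r' : hom (X ⊗ B) X) lA l1 rA r1 lr lA' l1' rA' r1' lr' :
  l = l' -> r = r' ->
  @Build_Bimod M A B X l r lA l1 rA r1 lr =
  @Build_Bimod M A B X l' r' lA' l1' rA' r1' lr'.
Proof. by move=> el er; subst l' r'; f_equal; exact: proof_irrelevance. Qed.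

Lemma res_id (A B : Monoid M) (X : Bimod A B) :
  res_ob (idMonoid A) (idMonoid B) X = X.
Proof. by case: X => X l r *; apply: bimod_ext; rewrite /= tmap1 compm1. Qed.

End Identifications.

Section ExtTor.
Variable M : MonoidalModelCategory.

Definition mod_fib (A B : Monoid M) : hom_class (bimodCat A B) :=
  fun X Y f => fib (mm_model M) (bfun f).

Definition mod_weq (A B : Monoid M) : hom_class (bimodCat A B) :=
  fun X Y f => weq (mm_model M) (bfun f).

(* The (A,B)-bimodules form a closed model category with fibrations and weak
   equivalences created in M. *)
Definition created_model (A B : Monoid M) : Prop :=
  exists m : ModelStructure (bimodCat A B),
    (forall X Y (f : @hom (bimodCat A B) X Y), fib m f <-> mod_fib f) /\
    (forall X Y (f : @hom (bimodCat A B) X Y), weq m f <-> mod_weq f).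

Definition HoMod (A B : Monoid M) : Category := Ho (@mod_weq A B).

Definition gamMod (A B : Monoid M) : Functor (bimodCat A B) (HoMod A B) :=
  gam (@mod_weq A B).

Definition HoRes (A A' B B' : Monoid M) (a : MonoidMap A' A) (b : MonoidMap B' B) :
  Functor (HoMod A B) (HoMod A' B') :=
  @ho_map _ _ (@mod_weq A B) (@mod_weq A' B') (resF a b) (fun X Y w ww => ww).

(* The functors gam x gam below are localizations of the product categories, so
   derived functors are taken relative to them. *)
Definition ExtFunctor (A B C : Monoid M) : Type :=
  RightDerived (prodF (opF (gamMod A B)) (gamMod A C)) (gamMod B C) (homF A B C).

Definition TorFunctor (A B C : Monoid M) : Type :=
  LeftDerived (prodF (gamMod A B) (gamMod B C)) (gamMod A C) (tenF A B C).

Section Induced.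
Variables (A A' B B' C C' : Monoid M).
Variables (a : MonoidMap A' A) (b : MonoidMap B' B) (c : MonoidMap C' C).

(* [HoRes] along identities is the identity by [res_id]; it is kept so that all
   three transformations of interest are instances of the same definition. *)

(* Compatibility of [Ext_A(-_B,-_C) -> Ext_A'(-_B',-_C')] with the natural map
   [^A[-,-] -> ^A'[-,-]]; it characterizes the transformation induced by
   [a], [b] and [c]. *)
Definition ext_compat (E : ExtFunctor A B C) (E' : ExtFunctor A' B' C')
    (t : Nat (HoRes b c ∘F E) (E' ∘F prodF (opF (HoRes a b)) (HoRes a c))) : Prop :=
  forall (L : Bimod A B) (N : Bimod A C),
    t (L, N) ∘ fmap (HoRes b c) (rd_nat E (L, N)) =
    rd_nat E' (res_ob a b L, res_ob a c N) ∘ fmap (gamMod B' C') (hom_res a b c (L, N)).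

(* Likewise for [Tor_B'(A'-,-C') -> Tor_B(A-,-C)] and [∧_B' -> ∧_B]. *)
Definition tor_compat (T' : TorFunctor A' B' C') (T : TorFunctor A B C)
    (t : Nat (T' ∘F prodF (HoRes a b) (HoRes b c)) (HoRes a c ∘F T)) : Prop :=
  forall (X : Bimod A B) (Y : Bimod B C),
    fmap (HoRes a c) (ld_nat T (X, Y)) ∘ t (X, Y) =
    fmap (gamMod A' C') (ten_res a b c (X, Y)) ∘ ld_nat T' (res_ob a b X, res_ob b c Y).

End Induced.
End ExtTor.

Arguments ext_compat {M A A' B B' C C'} a b c E E' t.
Arguments tor_compat {M A A' B B' C C'} a b c T' T t.

(* Main.v *)
From Stdlib Require Import ssreflect ssrfun ssrbool.
From Stdlib Require Import ClassicalEpsilon FunctionalExtensionality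
  PropExtensionality ProofIrrelevance List FinFun.
Require Import Defs.

Set Implicit Arguments.
Unset Strict Implicit.
Unset Printing Implicit Defensive.
Set Bullet Behavior "None".

(** Ext and Tor are computed by replacing the arguments by cofibrant and fibrant
    ones, called good below, where the universal transformation of the derived functor
    is an isomorphism.  So the two sides of each comparison can be computed from the same
    replacements, provided that restriction along the unit maps sends good arguments
    to good arguments; on good arguments the comparison is the image in the homotopy
    category of [^A[L,N] -> ^A[L,N]] or [X ∧_B Y -> X ∧_B Y], which is an isomorphism
    because the monoid over which one balances is the same on both sides.

    Restriction preserves fibrant objects because fibrations are created in [M].  It
    preserves cofibrant objects by the coinduction adjunction
    ([proj_right_proj]): if [A] is semicofibrant, the right adjoint [[A,-]] of the
    functor forgetting the action of [A] preserves acyclic fibrations, so the left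
    adjoint preserves cofibrancy.

    That good arguments compute Ext and Tor needs two facts.  The first is
    homotopical algebra ([derived_exists], [derived_absolute], [derived_iso],
    [ken_brown]): if a functor inverts acyclic fibrations between fibrant objects,
    then its right derived functor exists, the universal transformation is an
    isomorphism on fibrant objects, and it stays universal after composition with any
    functor.  The last point is what gives existence and uniqueness of the
    transformations in the theorem, where the derived functor is followed by a
    forgetful functor.  It is applied to products of module categories and their
    opposites, so one needs that localizations are compatible with both
    ([loc_prod], [loc_op]).  The second fact is the pushout-product property
    of [∧] over monoids ([right_pushout_product], [left_fibrant_extend],
    [llp_tensR]), which is moved by adjunction to the enrichment axiom of [M].

    Arguments for left modules are obtained from those for right modules in the
    mirror image of [M], in which the two factors of the product are exchanged. *)

(** * Isomorphisms and natural transformations *)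

Lemma iso_idm (C : Category) (X : C) : is_iso (idm X).
Proof. by exists (idm X); rewrite comp1m. Qed.

Lemma iso_comp (C : Category) (X Y Z : C) (g : hom Y Z) (f : hom X Y) :
  is_iso g -> is_iso f -> is_iso (g ∘ f).
Proof.
move=> [g' [g'g gg']] [f' [f'f ff']]; exists (f' ∘ g'); split.
  by rewrite compA (pre2 g'g) comp1m.
by rewrite compA (pre2 ff') comp1m.
Qed.

Lemma iso_cancel_r (C : Category) (X Y Z : C) (g : hom Y Z) (f : hom X Y) :
  is_iso f -> is_iso (g ∘ f) -> is_iso g.
Proof.
move=> [f' [f'f ff']] h.
rewrite -[g]compm1 -ff' -compA; apply: iso_comp => //.
by exists f.
Qed.

Lemma iso_cancel_l (C : Category) (X Y Z : C) (g : hom Y Z) (f : hom X Y) :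
  is_iso g -> is_iso (g ∘ f) -> is_iso f.
Proof.
move=> [g' [g'g gg']] h.
rewrite -[f]comp1m -g'g compA; apply: iso_comp => //.
by exists g.
Qed.

Lemma iso_epi (C : Category) (X Y Z : C) (f : hom X Y) (g h : hom Y Z) :
  is_iso f -> g ∘ f = h ∘ f -> g = h.
Proof. by move=> [v [_ fv]] e; rewrite -[g]compm1 -[h]compm1 -fv -!compA e. Qed.

Lemma iso_mono (C : Category) (X Y Z : C) (f : hom Y Z) (g h : hom X Y) :
  is_iso f -> f ∘ g = f ∘ h -> g = h.
Proof. by move=> [v [vf _]] e; rewrite -[g]comp1m -[h]comp1m -vf !compA e. Qed.

Lemma fmap_iso (C D : Category) (F : Functor C D) (X Y : C) (f : hom X Y) :
  is_iso f -> is_iso (fmap F f).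
Proof.
by move=> [g [gf fg]]; exists (fmap F g); rewrite -!fmapM gf fg !fmap1.
Qed.

Lemma iso_op (C : Category) (X Y : C) (f : hom X Y) :
  is_iso f <-> @is_iso (opCat C) Y X f.
Proof. by split=> -[g [e1 e2]]; exists g. Qed.

Lemma iso_pair (C D : Category) (X Y : prodCat C D) (f : hom X Y) :
  is_iso f.1 -> is_iso f.2 -> is_iso f.
Proof.
move=> [g [e1 e2]] [h [e3 e4]]; exists (g, h).
by rewrite /= e1 e2 e3 e4.
Qed.

Lemma nat_ext (C D : Category) (F G : Functor C D) (s t : Nat F G) :
  (forall X, s X = t X) -> s = t.
Proof.
case: s t => [s sN] [t tN] /= e.
have {}e : s = t by apply: functional_extensionality_dep.
by subst t; rewrite (proof_irrelevance _ sN tN).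
Qed.

Definition nat_id (C D : Category) (F : Functor C D) : Nat F F.
Proof.
refine {| ntc := fun X => idm (F X) |}.
abstract (by move=> *; rewrite comp1m compm1).
Defined.

Definition nat_comp (C D : Category) (F G H : Functor C D)
  (s : Nat G H) (t : Nat F G) : Nat F H.
Proof.
refine {| ntc := fun X => s X ∘ t X |}.
abstract (by move=> *; rewrite compA ntN -compA ntN compA).
Defined.

Definition whiskR (C D E : Category) (F G : Functor D E) (t : Nat F G)
  (H : Functor C D) : Nat (F ∘F H) (G ∘F H).
Proof.
refine (@Build_Nat _ _ (F ∘F H) (G ∘F H) (fun X => t (H X)) _).
abstract (by move=> X Y f; rewrite /= ntN).
Defined.

Definition ninv_fun (C D : Category) (F G : Functor C D) (t : Nat F G)
  (ti : is_nat_iso t) (X : C) : hom (G X) (F X) :=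
  proj1_sig (constructive_indefinite_description _ (ti X)).

Lemma ninvK (C D : Category) (F G : Functor C D) (t : Nat F G)
  (ti : is_nat_iso t) X : ninv_fun ti X ∘ t X = idm _ /\ t X ∘ ninv_fun ti X = idm _.
Proof. by rewrite /ninv_fun; case: constructive_indefinite_description. Qed.

Definition ninv (C D : Category) (F G : Functor C D) (t : Nat F G)
  (ti : is_nat_iso t) : Nat G F.
Proof.
refine {| ntc := ninv_fun ti |}.
abstract (move=> X Y f; have [e1 e2] := (ninvK ti X, ninvK ti Y);
  rewrite -[LHS]compm1 -(proj2 e1) compA -(compA (fmap G f)) -ntN;
  by rewrite compA (pre2 (proj1 e2)) comp1m).
Defined.

Lemma ninv_iso (C D : Category) (F G : Functor C D) (t : Nat F G)
  (ti : is_nat_iso t) : is_nat_iso (ninv ti).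
Proof. by move=> X; exists (t X); case: (ninvK ti X). Qed.

Definition funCat (C D : Category) : Category.
Proof.
refine {| ob := Functor C D; hom := @Nat C D; idm := @nat_id C D;
          comp := @nat_comp C D |}.
- abstract (by move=> *; apply: nat_ext => X; exact: compA).
- abstract (by move=> *; apply: nat_ext => X; exact: comp1m).
- abstract (by move=> *; apply: nat_ext => X; exact: compm1).
Defined.

(** * Localizations *)

Definition inverts (C E : Category) (W : hom_class C) (F : Functor C E) : Prop :=
  forall X Y (w : hom X Y), W X Y w -> is_iso (fmap F w).

(** The universal property of a localization up to natural isomorphism, rather than
    equality of functors, so that it makes sense for opposites and products. *)
Record localization (C HC : Category) (g : Functor C HC) (W : hom_class C) : Prop := {
  loc_inv : inverts W g;
  loc_lift : forall E (F : Functor C E), inverts W F ->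
    exists (F' : Functor HC E) (t : Nat (F' ∘F g) F), is_nat_iso t;
  loc_nat : forall E (G G' : Functor HC E) (t : Nat (G ∘F g) (G' ∘F g)),
    exists! t' : Nat G G', forall X, t' (g X) = t X }.

(** Words are composites of maps and formal inverses; a formal inverse enters only
    through the two equations that determine it. *)
Lemma Ho_ind (C : Category) (W : hom_class C)
  (P : forall X Y : Ho W, hom X Y -> Prop) :
  (forall (X Y : C) (f : hom X Y), P X Y (fmap (gam W) f)) ->
  (forall (X Y : C) (w : hom X Y) (ww : W X Y w) (v : @hom (Ho W) Y X),
     v ∘ fmap (gam W) w = idm _ -> fmap (gam W) w ∘ v = idm _ -> P Y X v) ->
  (forall X Y Z (g : @hom (Ho W) Y Z) (f : @hom (Ho W) X Y),
     P Y Z g -> P X Y f -> P X Z (g ∘ f)) ->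
  forall X Y f, P X Y f.
Proof.
move=> Pmap Pinv Pcomp X Y f; rewrite -(@wrepK C W X Y f).
elim: (@wrep C W X Y f) => {X Y f} [X Y f|X Y w ww|X Y Z b Pb a Pa].
- exact: Pmap.
- apply: (Pinv _ _ w ww); rewrite /= wclass_compE; apply/wcls_eq.
  + exact: wr_invl.
  + exact: wr_invr.
- by rewrite -(wclass_compE b a); exact: Pcomp Pb Pa.
Qed.

Lemma loc_gam (C : Category) (W : hom_class C) : localization (gam W) W.
Proof.
split=> [X Y w|E F FW|E G G' t]; first exact: gam_iso.
- have tN X Y (f : hom X Y) :
    idm (F Y) ∘ fmap (ho_lift FW ∘F gam W) f = fmap F f ∘ idm (F X).
    by rewrite comp1m compm1; exact: ho_liftE.
  exists (ho_lift FW), (@Build_Nat _ _ (ho_lift FW ∘F gam W) F (fun X => idm (F X)) tN).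
  by move=> X; exact: iso_idm.
- pose s (X : Ho W) : hom (G X) (G' X) := t X.
  have sN : forall X Y (f : @hom (Ho W) X Y), s Y ∘ fmap G f = fmap G' f ∘ s X.
    have sN0 (X Y : C) (f : hom X Y) :
      s Y ∘ fmap G (fmap (gam W) f) = fmap G' (fmap (gam W) f) ∘ s X := ntN t f.
    move: s sN0 => s sN0.
    apply: Ho_ind => [|X Y w ww v vw wv|X Y Z g f gN fN]; first exact: sN0.
    + rewrite -[LHS]comp1m -[idm _](fmap1 G') -vw fmapM compA -(pre22 (sN0 _ _ w)) -fmapM wv.
      by rewrite fmap1 compm1.
    + by rewrite !fmapM -compA gN compA fN -compA.
  exists (@Build_Nat _ _ G G' s sN); split=> // s' s'E.
  by apply: nat_ext => X; rewrite -(s'E X).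
Qed.

Definition unopF (C D : Category) (F : Functor (opCat C) D) : Functor C (opCat D).
Proof.
refine (@Build_Functor C (opCat D) (fun X => F X) (fun X Y f => @fmap _ _ F Y X f) _ _).
- abstract (by move=> X; exact: (fmap1 F)).
- abstract (by move=> X Y Z g f; exact: (@fmapM _ _ F Z Y X f g)).
Defined.

Definition unopF' (C D : Category) (F : Functor C (opCat D)) : Functor (opCat C) D.
Proof.
refine (@Build_Functor (opCat C) D (fun X => F X) (fun X Y f => @fmap _ _ F Y X f) _ _).
- abstract (by move=> X; exact: (fmap1 F)).
- abstract (by move=> X Y Z g f; exact: (@fmapM _ _ F Z Y X f g)).
Defined.

Definition op_class (C : Category) (W : hom_class C) : hom_class (opCat C) :=
  fun X Y f => W Y X f.

Lemma loc_op (C HC : Category) (g : Functor C HC) (W : hom_class C) :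
  localization g W -> localization (opF g) (op_class W).
Proof.
move=> gL; split=> [X Y w ww|E F FW|E G G' t].
- by apply/(@iso_op HC); exact: (loc_inv gL ww).
- have FW' : inverts W (unopF F).
    by move=> X Y w ww; apply/(@iso_op E); exact: (FW Y X w ww).
  case: (loc_lift gL FW') => F' [t ti]; exists (unopF' F').
  pose s (X : opCat C) : hom ((unopF' F' ∘F opF g) X) (F X) := ninv ti X.
  have sN X Y (f : @hom (opCat C) X Y) :
    s Y ∘ fmap (unopF' F' ∘F opF g) f = fmap F f ∘ s X.
    by exact: (esym (@ntN _ _ _ _ (ninv ti) Y X f)).
  exists (@Build_Nat _ _ (unopF' F' ∘F opF g) F s sN) => X.
  by apply/(@iso_op E); exact: (ninv_iso ti X).
- pose u (X : C) : hom ((unopF G' ∘F g) X) ((unopF G ∘F g) X) := t X.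
  have uN X Y (f : @hom C X Y) :
    u Y ∘ fmap (unopF G' ∘F g) f = fmap (unopF G ∘F g) f ∘ u X.
    by exact: (esym (@ntN _ _ _ _ t Y X f)).
  case: (loc_nat gL (@Build_Nat _ _ (unopF G' ∘F g) (unopF G ∘F g) u uN)).
  move=> s [sE su].
  pose r (X : opCat HC) : hom (G X) (G' X) := s X.
  have rN X Y (f : @hom (opCat HC) X Y) : r Y ∘ fmap G f = fmap G' f ∘ r X.
    exact: (esym (@ntN _ _ _ _ s Y X f)).
  exists (@Build_Nat _ _ G G' r rN); split=> [X|s' s'E]; first exact: sE.
  pose r' (X : HC) : hom ((unopF G') X) ((unopF G) X) := s' X.
  have r'N X Y (f : @hom HC X Y) : r' Y ∘ fmap (unopF G') f = fmap (unopF G) f ∘ r' X.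
    exact: (esym (@ntN _ _ _ _ s' Y X f)).
  have e := su (@Build_Nat _ _ (unopF G') (unopF G) r' r'N) s'E.
  by apply: nat_ext => X; rewrite /= /r e.
Qed.

(** * Localizations of product categories *)

Section LocalizationChoices.
Variables (C HC : Category) (g : Functor C HC) (W : hom_class C).
Hypothesis gL : localization g W.

Lemma loc_eq (E : Category) (G G' : Functor HC E) (s s' : Nat G G') :
  (forall X, s (g X) = s' (g X)) -> s = s'.
Proof.
move=> e; case: (loc_nat gL (whiskR s g)) => u [_ uu].
by rewrite -(uu s) // -(uu s') // => X; rewrite /= e.
Qed.

Definition loc_ext (E : Category) (G G' : Functor HC E)
    (t : Nat (G ∘F g) (G' ∘F g)) : Nat G G' :=
  proj1_sig (constructive_indefinite_description _ (loc_nat gL t)).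

Lemma loc_extE (E : Category) (G G' : Functor HC E)
  (t : Nat (G ∘F g) (G' ∘F g)) X : loc_ext t (g X) = t X.
Proof. by rewrite /loc_ext; case: constructive_indefinite_description => s []. Qed.

Lemma loc_ext_iso (E : Category) (G G' : Functor HC E)
  (t : Nat (G ∘F g) (G' ∘F g)) :
  is_nat_iso t -> @is_iso (funCat HC E) G G' (loc_ext t).
Proof.
move=> ti; exists (loc_ext (ninv ti)).
by split; apply: loc_eq => X /=; rewrite !loc_extE; case: (ninvK ti X).
Qed.

Variables (E : Category) (F : Functor C E).
Hypothesis FW : inverts W F.

Definition loc_fun : Functor HC E :=
  proj1_sig (constructive_indefinite_description _ (loc_lift gL FW)).

Lemma loc_isoP : exists t : Nat (loc_fun ∘F g) F, is_nat_iso t.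
Proof. by rewrite /loc_fun; case: constructive_indefinite_description. Qed.

Definition loc_iso : Nat (loc_fun ∘F g) F :=
  proj1_sig (constructive_indefinite_description _ loc_isoP).

Lemma loc_isoK : is_nat_iso loc_iso.
Proof. by rewrite /loc_iso; case: constructive_indefinite_description. Qed.

End LocalizationChoices.

Section Bifunctors.
Variables (C D E : Category).

(** The ascription fixes the objects of the product category, which unification does
    not recover from a bare pair of maps. *)
Definition pmap (X X' : C) (Y Y' : D) (f : hom X X') (g : hom Y Y') :
  @hom (prodCat C D) (X, Y) (X', Y') := (f, g).

Definition fixL (F : Functor (prodCat C D) E) (X : C) : Functor D E.
Proof.
refine {| fobj := fun Y => F (X, Y);
          fmap := fun Y Y' g => fmap F (pmap (idm X) g) |}.
- abstract (by move=> Y; exact: (fmap1 F)).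
- abstract (by move=> Y Y' Y'' g f; rewrite -fmapM /pmap /= comp1m).
Defined.

Definition fixR (F : Functor (prodCat C D) E) (Y : D) : Functor C E.
Proof.
refine {| fobj := fun X => F (X, Y);
          fmap := fun X X' f => fmap F (pmap f (idm Y)) |}.
- abstract (by move=> X; exact: (fmap1 F)).
- abstract (by move=> X X' X'' g f; rewrite -fmapM /pmap /= comp1m).
Defined.

Lemma fmap_pmap (F : Functor (prodCat C D) E) (X X' : C) (Y Y' : D)
  (f : hom X X') (g : hom Y Y') :
  fmap F (pmap f g) = fmap F (pmap f (idm Y')) ∘ fmap F (pmap (idm X) g).
Proof. by rewrite -fmapM /pmap /= comp1m compm1. Qed.

Lemma fmap_pmap' (F : Functor (prodCat C D) E) (X X' : C) (Y Y' : D)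
  (f : hom X X') (g : hom Y Y') :
  fmap F (pmap f g) = fmap F (pmap (idm X') g) ∘ fmap F (pmap f (idm Y)).
Proof. by rewrite -fmapM /pmap /= comp1m compm1. Qed.

Definition fixL_map (F : Functor (prodCat C D) E) (X X' : C) (f : hom X X') :
  Nat (fixL F X) (fixL F X').
Proof.
refine (@Build_Nat _ _ (fixL F X) (fixL F X') (fun Y => fmap F (pmap f (idm Y))) _).
abstract (by move=> Y Y' g /=; rewrite -fmap_pmap fmap_pmap').
Defined.

Definition fixR_map (F : Functor (prodCat C D) E) (Y Y' : D) (g : hom Y Y') :
  Nat (fixR F Y) (fixR F Y').
Proof.
refine (@Build_Nat _ _ (fixR F Y) (fixR F Y') (fun X => fmap F (pmap (idm X) g)) _).
abstract (by move=> X X' f /=; rewrite -fmap_pmap' fmap_pmap).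
Defined.

Definition uncurryF (K : Functor C (funCat D E)) : Functor (prodCat C D) E.
Proof.
refine (@Build_Functor (prodCat C D) E (fun X => (K X.1 : Functor D E) X.2)
  (fun X Y f => (fmap K f.1 : Nat _ _) Y.2 ∘ fmap (K X.1 : Functor D E) f.2) _ _).
- abstract (by move=> [X Y]; rewrite /= !fmap1 comp1m).
- abstract (by move=> X Y Z g f; rewrite /= !fmapM /= !compA -(pre22 (ntN _ _))).
Defined.

End Bifunctors.

Definition prod_class (C D : Category) (W : hom_class C) (V : hom_class D) :
  hom_class (prodCat C D) := fun X Y f => W _ _ f.1 /\ V _ _ f.2.

Section LocProd.
Variables (C HC D HD : Category) (g : Functor C HC) (h : Functor D HD).
Variables (W : hom_class C) (V : hom_class D).
Hypotheses (gL : localization g W) (hL : localization h V).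
Hypotheses (W1 : forall X, W (idm X)) (V1 : forall X, V (idm X)).

Section Lift.
Variables (E : Category) (F : Functor (prodCat C D) E).
Hypothesis FW : inverts (prod_class W V) F.

Lemma fixL_inv (X : C) : inverts V (fixL F X).
Proof. by move=> Y Y' w ww; apply: FW; split=> //=; exact: W1. Qed.

Definition curF_ob (X : C) : Functor HD E := loc_fun hL (@fixL_inv X).

Definition curF_nat (X : C) : Nat (curF_ob X ∘F h) (fixL F X) := loc_iso hL (@fixL_inv X).

Lemma curF_natI X : is_nat_iso (curF_nat X).
Proof. exact: loc_isoK. Qed.

(** [curF] curries [F] after extending each partial functor [F (X, -)] along [h].  The
    extensions are only isomorphic to [F (X, -)], so maps between them are conjugated by
    these isomorphisms and then extended from [D] to [HD]. *)
Definition curF_map0 (X X' : C) (f : hom X X') :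
    Nat (curF_ob X ∘F h) (curF_ob X' ∘F h) :=
  nat_comp (ninv (curF_natI X')) (nat_comp (fixL_map F f) (curF_nat X)).

Lemma curF_map0E (X X' : C) (f : hom X X') Y :
  curF_nat X' Y ∘ curF_map0 f Y = fmap F (pmap f (idm Y)) ∘ curF_nat X Y.
Proof. by rewrite /= (pre2 (proj2 (ninvK (curF_natI X') Y))) comp1m. Qed.

Definition curF_map (X X' : C) (f : hom X X') : Nat (curF_ob X) (curF_ob X') :=
  loc_ext hL (curF_map0 f).

Lemma curF_mapE (X X' : C) (f : hom X X') Y :
  curF_nat X' Y ∘ curF_map f (h Y) = fmap F (pmap f (idm Y)) ∘ curF_nat X Y.
Proof. by rewrite /curF_map loc_extE curF_map0E. Qed.

Lemma curF_mapP (X X' : C) (f : hom X X') (t : Nat (curF_ob X) (curF_ob X')) :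
  (forall Y, curF_nat X' Y ∘ t (h Y) = fmap F (pmap f (idm Y)) ∘ curF_nat X Y) ->
  curF_map f = t.
Proof.
move=> e; apply: (loc_eq hL) => Y.
by apply: (iso_mono (curF_natI X' Y)); rewrite e; exact: curF_mapE.
Qed.

Definition curF : Functor C (funCat HD E).
Proof.
refine (@Build_Functor C (funCat HD E) curF_ob curF_map _ _).
- abstract (move=> X; apply: curF_mapP => Y /=;
    by rewrite compm1 (fmap1 F) comp1m).
- abstract (move=> X Y Z k f; apply: curF_mapP => T /=;
    rewrite (pre22 (curF_mapE k T)) curF_mapE -compA -fmapM;
    by rewrite /pmap /= comp1m).
Defined.

Lemma curF_inv : inverts W curF.
Proof.
move=> X Y w ww; apply: loc_ext_iso => Z /=.
apply: iso_comp; first exact: (ninv_iso (curF_natI Y) Z).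
apply: iso_comp; last exact: curF_natI.
by apply: FW; split=> //=; exact: V1.
Qed.

(** Currying turns an extension problem in two variables into one in each variable:
    first along [h] for each object of [C], then along [g] with values in a functor
    category. *)
Lemma loc_prod_lift : exists (F' : Functor (prodCat HC HD) E)
  (t : Nat (F' ∘F prodF g h) F), is_nat_iso t.
Proof.
exists (uncurryF (loc_fun gL curF_inv)).
have := loc_isoK gL curF_inv.
move: (loc_iso gL curF_inv) => s si.
pose K := loc_fun gL curF_inv.
have sE (X : C) : exists v : Nat (curF_ob X) (K (g X)),
    (forall Z, v Z ∘ (s X : Nat _ _) Z = idm _) /\
    (forall Z, (s X : Nat _ _) Z ∘ v Z = idm _).
  by case: (si X) => v [vs sv]; exists v; split=> Z; [have := f_equal (fun t : Nat _ _ => t Z) vs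
    | have := f_equal (fun t : Nat _ _ => t Z) sv].
pose t (X : prodCat C D) : hom ((uncurryF K ∘F prodF g h) X) (F X) :=
  match X with (X, Y) => curF_nat X Y ∘ (s X : Nat _ _) (h Y) end.
have tN X Y (f : hom X Y) :
    t Y ∘ fmap (uncurryF K ∘F prodF g h) f = fmap F f ∘ t X.
  case: X Y f => [X X'] [Y Y'] [f f'] /=.
  have sN : (s Y : Nat _ _) (h Y') ∘ (fmap K (fmap g f) : Nat _ _) (h Y') =
      curF_map f (h Y') ∘ (s X : Nat _ _) (h Y').
    exact: (f_equal (fun t : Nat _ _ => t (h Y')) (ntN s f)).
  rewrite !compA (pre22 sN) (pre22 (curF_mapE f Y')).
  rewrite (ntN (s X : Nat _ _)) (pre22 (ntN (curF_nat X) f')).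
  by rewrite -!compA -fmap_pmap.
exists (@Build_Nat _ _ (uncurryF K ∘F prodF g h) F t tN) => -[X Y] /=.
apply: iso_comp; first exact: curF_natI.
by case: (sE X) => v [vs sv]; exists (v (h Y)).
Qed.

End Lift.

Section Extend.
Variables (E : Category) (G G' : Functor (prodCat HC HD) E).
Variable t : Nat (G ∘F prodF g h) (G' ∘F prodF g h).

(** Natural transformations are extended in the same order, along [h] first; [ext1N]
    says that the result is still natural in the first variable. *)
Definition ext1_0 (X : C) : Nat (fixL G (g X) ∘F h) (fixL G' (g X) ∘F h).
Proof.
refine (@Build_Nat _ _ (fixL G (g X) ∘F h) (fixL G' (g X) ∘F h) (fun Y => t (X, Y)) _).
abstract (by move=> Y Y' f /=; move: (ntN t (pmap (idm X) f)); rewrite /= fmap1).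
Defined.

Definition ext1 (X : C) : Nat (fixL G (g X)) (fixL G' (g X)) := loc_ext hL (ext1_0 X).

Lemma ext1E X Y : ext1 X (h Y) = t (X, Y).
Proof. exact: loc_extE. Qed.

Lemma ext1N (X X' : C) (f : hom X X') (Y : HD) :
  ext1 X' Y ∘ fmap G (pmap (fmap g f) (idm Y)) =
  fmap G' (pmap (fmap g f) (idm Y)) ∘ ext1 X Y.
Proof.
have : nat_comp (ext1 X') (fixL_map G (fmap g f)) =
       nat_comp (fixL_map G' (fmap g f)) (ext1 X).
  apply: (loc_eq hL) => Z /=; rewrite !ext1E.
  by move: (ntN t (pmap f (idm Z))); rewrite /= fmap1.
by move/(f_equal (fun s : Nat _ _ => s Y)).
Qed.

Definition ext2_0 (Y : HD) : Nat (fixR G Y ∘F g) (fixR G' Y ∘F g) :=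
  @Build_Nat _ _ (fixR G Y ∘F g) (fixR G' Y ∘F g) (fun X => ext1 X Y)
    (fun X X' f => ext1N f Y).

Definition ext2 (Y : HD) : Nat (fixR G Y) (fixR G' Y) := loc_ext gL (ext2_0 Y).

Lemma ext2E X Y : ext2 Y (g X) = ext1 X Y.
Proof. exact: loc_extE. Qed.

Lemma ext2N (X : HC) (Y Y' : HD) (f : hom Y Y') :
  ext2 Y' X ∘ fmap G (pmap (idm X) f) = fmap G' (pmap (idm X) f) ∘ ext2 Y X.
Proof.
have : nat_comp (ext2 Y') (fixR_map G f) = nat_comp (fixR_map G' f) (ext2 Y).
  apply: (loc_eq gL) => Z /=; rewrite !ext2E.
  exact: (ntN (ext1 Z) f).
by move/(f_equal (fun s : Nat _ _ => s X)).
Qed.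

Lemma loc_prod_nat : exists! t' : Nat G G', forall X, t' (prodF g h X) = t X.
Proof.
pose s (X : prodCat HC HD) : hom (G X) (G' X) :=
  match X with (X, Y) => ext2 Y X end.
have sN X Y (f : hom X Y) : s Y ∘ fmap G f = fmap G' f ∘ s X.
  case: X Y f => [X X'] [Y Y'] [f f'].
  change (ext2 Y' Y ∘ fmap G (pmap f f') = fmap G' (pmap f f') ∘ ext2 X' X).
  rewrite (fmap_pmap G f f') (fmap_pmap G' f f') !compA -ext2N.
  exact: (pre22 (ntN (ext2 Y') f)).
exists (@Build_Nat _ _ G G' s sN); split=> [[X Y]|u uE]; first by rewrite /= ext2E ext1E.
apply: nat_ext => -[X Y] /=.
have uN1 X' Y1 Y2 (f : hom Y1 Y2) :
    u (X', Y2) ∘ fmap (fixL G X') f = fmap (fixL G' X') f ∘ u (X', Y1)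
    by exact: (ntN u (pmap (idm X') f)).
have uN2 Y' X1 X2 (f : hom X1 X2) :
    u (X2, Y') ∘ fmap (fixR G Y') f = fmap (fixR G' Y') f ∘ u (X1, Y')
    by exact: (ntN u (pmap f (idm Y'))).
pose u1 X' := @Build_Nat _ _ (fixL G X') (fixL G' X') (fun Y => u (X', Y)) (uN1 X').
pose u2 Y' := @Build_Nat _ _ (fixR G Y') (fixR G' Y') (fun X => u (X, Y')) (uN2 Y').
suff -> : ext2 Y = u2 Y by [].
apply: (loc_eq gL) => Z; rewrite ext2E.
suff -> : ext1 Z = u1 (g Z) by [].
apply: (loc_eq hL) => T; rewrite ext1E /= -(uE (Z, T)).
by [].
Qed.

End Extend.

Lemma loc_prod : localization (prodF g h) (prod_class W V).
Proof.
split=> [X Y w [ww wv]|E F FW|E G G' t].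
- by apply: iso_pair; [exact: (loc_inv gL ww) | exact: (loc_inv hL wv)].
- exact: loc_prod_lift.
- exact: loc_prod_nat.
Qed.

End LocProd.

(** * Existence and absoluteness of derived functors *)

(** What is used of a model category to derive functors on the right: [good] objects
    are the fibrant ones and [app] are the acyclic cofibrations.  The last field is a
    right homotopy through a path object [P] of [Y].  They are isolated because they pass at
    once to products and are checked there coordinatewise. *)
Record right_derivable (C : Category) (W : hom_class C) (good : C -> Prop)
    (app : hom_class C) : Prop := {
  dv_id : forall X, W _ _ (idm X);
  dv_comp : forall X Y Z (g : hom Y Z) (f : hom X Y),
    W _ _ f -> W _ _ g -> W _ _ (g ∘ f);
  dv_cancel : forall X Y Z (g : hom Y Z) (f : hom X Y),
    W _ _ f -> W _ _ (g ∘ f) -> W _ _ g;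
  dv_weq : forall X Y (r : hom X Y), app _ _ r -> W _ _ r;
  dv_rep : forall X, exists R (r : hom X R), good R /\ app _ _ r;
  dv_lift : forall X R (r : hom X R), app _ _ r -> forall Y, good Y ->
    forall f : hom X Y, exists h, h ∘ r = f;
  dv_htpy : forall X R (r : hom X R), app _ _ r -> forall Y, good Y ->
    forall f f' : hom R Y, f ∘ r = f' ∘ r ->
    exists P (s : hom Y P) (p p' : hom P Y) (h : hom R P),
    [/\ good P, W _ _ s, p ∘ s = idm Y & p' ∘ s = idm Y] /\
    [/\ p ∘ h = f & p' ∘ h = f'] }.

Definition inverts_on (C E : Category) (W : hom_class C) (good : C -> Prop)
    (F : Functor C E) : Prop :=
  forall X Y (w : hom X Y), good X -> good Y -> W _ _ w -> is_iso (fmap F w).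

Section Derive.
Variables (C HC : Category) (g : Functor C HC) (W : hom_class C).
Variables (good : C -> Prop) (app : hom_class C).
Hypotheses (gL : localization g W) (dv : right_derivable W good app).

Section Existence.
Variables (E : Category) (F : Functor C E).
Hypothesis FW : inverts_on W good F.

(** Homotopic maps become equal because the two projections [p] and [p'] of the path
    object are left inverse to the same inverted map [s]. *)
Lemma htpy_eq X R (r : hom X R) (Y : C) (f f' : hom R Y) :
  app r -> good Y -> f ∘ r = f' ∘ r -> fmap F f = fmap F f'.
Proof.
move=> ra gY e.
case: (dv_htpy dv ra gY e) => P [s [p [p' [h [[gP ws ps p's] [<- <-]]]]]].
rewrite !fmapM; congr (_ ∘ _); apply: (iso_epi (FW gY gP ws)).
by rewrite -!fmapM ps p's.
Qed.

Definition repl (X : C) : C :=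
  proj1_sig (constructive_indefinite_description _ (dv_rep dv X)).

Lemma replP X : exists r : hom X (repl X), good (repl X) /\ app r.
Proof. by rewrite /repl; case: constructive_indefinite_description. Qed.

Definition repl_map X : hom X (repl X) :=
  proj1_sig (constructive_indefinite_description _ (replP X)).

Lemma repl_mapP X : good (repl X) /\ app (repl_map X).
Proof. by rewrite /repl_map; case: constructive_indefinite_description. Qed.

Lemma repl_funP X Y (f : hom X Y) :
  exists h : hom (repl X) (repl Y), h ∘ repl_map X = repl_map Y ∘ f.
Proof. exact: (dv_lift dv (proj2 (repl_mapP X)) (proj1 (repl_mapP Y))). Qed.

(** The choice of [repl_fun] is functorial only after applying [F], by [htpy_eq]. *)
Definition repl_fun X Y (f : hom X Y) : hom (repl X) (repl Y) :=
  proj1_sig (constructive_indefinite_description _ (repl_funP f)).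

Lemma repl_funE X Y (f : hom X Y) : repl_fun f ∘ repl_map X = repl_map Y ∘ f.
Proof. by rewrite /repl_fun; case: constructive_indefinite_description. Qed.

Definition replF : Functor C E.
Proof.
refine {| fobj := fun X => F (repl X); fmap := fun X Y f => fmap F (repl_fun f) |}.
- abstract (move=> X; rewrite -fmap1;
    apply: htpy_eq (proj2 (repl_mapP X)) (proj1 (repl_mapP X)) _;
    by rewrite repl_funE comp1m compm1).
- abstract (move=> X Y Z k f; rewrite -fmapM;
    apply: htpy_eq (proj2 (repl_mapP X)) (proj1 (repl_mapP Z)) _;
    by rewrite compA !repl_funE (pre22 (repl_funE k))).
Defined.

Lemma replF_inv : inverts W replF.
Proof.
move=> X Y w ww; apply: FW; try exact: (proj1 (repl_mapP _)).
have [wX wY] := (dv_weq dv (proj2 (repl_mapP X)), dv_weq dv (proj2 (repl_mapP Y))).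
by apply: (dv_cancel dv wX); rewrite repl_funE; exact: (dv_comp dv).
Qed.

(** The derived functor sends [X] to the value of [F] at a good replacement of [X]. *)
Lemma derived_exists : exists (G : Functor HC E) (eta : Nat F (G ∘F g)),
  forall X, good X -> is_iso (eta X).
Proof.
exists (loc_fun gL replF_inv).
have ti := loc_isoK gL replF_inv; move: (loc_iso gL replF_inv) ti => t ti.
have sN X Y (f : hom X Y) :
    fmap F (repl_map Y) ∘ fmap F f = fmap replF f ∘ fmap F (repl_map X).
  by rewrite /= -!fmapM repl_funE.
exists (nat_comp (ninv ti) (@Build_Nat _ _ F replF (fun X => fmap F (repl_map X)) sN)).
move=> X gX /=; apply: iso_comp; first exact: (ninv_iso ti X).
apply: FW => //; first exact: (proj1 (repl_mapP X)).
exact: (dv_weq dv (proj2 (repl_mapP X))).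
Qed.

End Existence.

Section Absolute.
Variables (E E' : Category) (F : Functor C E) (G : Functor HC E).
Variables (eta : Nat F (G ∘F g)) (Phi : Functor E E') (H : Functor HC E').
Variable xi : Nat (Phi ∘F F) (H ∘F g).
Hypothesis eta_iso : forall X, good X -> is_iso (eta X).

(** A transformation out of [Phi ∘F G] is forced on good objects, where [eta] is
    invertible, and then everywhere since each object is isomorphic to a good one in
    [HC]. *)
Lemma abs_extP (X : C) : exists a : hom (Phi (G (g X))) (H (g X)),
  exists R (r : hom X R) (b : hom (Phi (G (g R))) (H (g R))),
  [/\ good R, app r, b ∘ fmap Phi (eta R) = xi R &
    fmap H (fmap g r) ∘ a = b ∘ fmap Phi (fmap G (fmap g r))].
Proof.
case: (dv_rep dv X) => R [r [gR ra]].
case: (fmap_iso Phi (eta_iso gR)) => v [ve _].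
case: (fmap_iso H (loc_inv gL (dv_weq dv ra))) => w [_ rw].
exists (w ∘ (xi R ∘ v ∘ fmap Phi (fmap G (fmap g r)))), R, r, (xi R ∘ v).
split=> //; last by rewrite -compA rw comp1m.
by rewrite compA ve compm1.
Qed.

Definition abs_fun (X : C) : hom ((Phi ∘F G ∘F g) X) ((H ∘F g) X) :=
  proj1_sig (constructive_indefinite_description _ (abs_extP X)).

Lemma abs_funP (X : C) : exists R (r : hom X R) (b : hom (Phi (G (g R))) (H (g R))),
  [/\ good R, app r, b ∘ fmap Phi (eta R) = xi R &
    fmap H (fmap g r) ∘ abs_fun X = b ∘ fmap Phi (fmap G (fmap g r))].
Proof. by rewrite /abs_fun; case: constructive_indefinite_description. Qed.

Lemma abs_funN X Y (f : hom X Y) :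
  abs_fun Y ∘ fmap (Phi ∘F G ∘F g) f = fmap (H ∘F g) f ∘ abs_fun X.
Proof.
case: (abs_funP X) (abs_funP Y) => R [r [b [gR ra be aE]]] [S [s [c [gS sa ce cE]]]].
apply: (iso_mono (fmap_iso H (loc_inv gL (dv_weq dv sa)))).
case: (dv_lift dv ra gS (s ∘ f)) => h hE /=.
rewrite (pre2 cE) compA -!fmapM -hE !fmapM.
rewrite -[in RHS]compA -[in RHS]fmapM -[in RHS]fmapM -hE !fmapM [in RHS]compA aE -!compA; congr (_ ∘ _).
apply: (iso_epi (fmap_iso Phi (eta_iso gR))).
have := ntN xi h; have := ntN eta h; rewrite /= => eN xN.
by rewrite [in RHS]compA be -xN -ce !compA -!fmapM eN.
Qed.

(** An extension of [F] that agrees with [F] on good objects is an absolute Kan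
    extension: it keeps its universal property after composition with any [Phi]. *)
Lemma derived_absolute : exists! t : Nat (Phi ∘F G) H,
  forall X, t (g X) ∘ fmap Phi (eta X) = xi X.
Proof.
case: (loc_nat gL (@Build_Nat _ _ (Phi ∘F G ∘F g) (H ∘F g) abs_fun abs_funN)).
move=> t [tE _]; have {}tE X : t (g X) ∘ fmap Phi (eta X) = xi X.
  rewrite tE /=; case: (abs_funP X) => R [r [b [gR ra be aE]]].
  apply: (iso_mono (fmap_iso H (loc_inv gL (dv_weq dv ra)))).
  have := ntN xi r; have := ntN eta r; rewrite /= => eN xN.
  by rewrite (pre2 aE) -xN -be !compA -!fmapM eN.
exists t; split=> // s sE; apply: (loc_eq gL) => X.
case: (dv_rep dv X) => R [r [gR ra]].
apply: (iso_mono (fmap_iso H (loc_inv gL (dv_weq dv ra)))).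
have tN := ntN t (fmap g r); have sN := ntN s (fmap g r).
rewrite -tN -sN; congr (_ ∘ _).
by apply: (iso_epi (fmap_iso Phi (eta_iso gR))); rewrite sE; exact: tE.
Qed.

End Absolute.

Lemma iso_on_good (E : Category) (G G' : Functor HC E) (t : Nat G G') :
  (forall X, good X -> is_iso (t (g X))) -> forall X, is_iso (t (g X)).
Proof.
move=> ti X; case: (dv_rep dv X) => R [r [gR ra]].
have ri := loc_inv gL (dv_weq dv ra).
apply: (iso_cancel_l (fmap_iso G' ri)); rewrite -(ntN t).
by apply: iso_comp; [exact: ti | exact: fmap_iso].
Qed.

Definition idF (D : Category) : Functor D D.
Proof. by refine (@Build_Functor D D (fun X => X) (fun X Y f => f) _ _). Defined.

(** The universal property determines the derived functor up to isomorphism, so an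
    arbitrary one inherits the behaviour of the functor of [derived_exists]. *)
Lemma derived_iso (D HD : Category) (gD : Functor D HD) (P : Functor C D)
    (E : RightDerived g gD P) : inverts_on W good (gD ∘F P) ->
  forall X, good X -> is_iso (rd_nat E X).
Proof.
move=> FW X gX; case: (derived_exists FW) => G [eta ei].
case: (rd_univ E eta) => t [tE _].
have xN X' Y (f : hom X' Y) : rd_nat E Y ∘ fmap (idF HD ∘F (gD ∘F P)) f =
  fmap (E ∘F g) f ∘ rd_nat E X' := ntN (rd_nat E) f.
case: (derived_absolute
  (@Build_Nat _ _ (idF HD ∘F (gD ∘F P)) (E ∘F g) (fun X => rd_nat E X) xN) ei) => s [sE _].
have {}sE Y : s (g Y) ∘ eta Y = rd_nat E Y := sE Y.
have s'N Y Z (f : hom Y Z) : s Z ∘ fmap G f = fmap E f ∘ s Y := ntN s f.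
pose s' := @Build_Nat _ _ G E (fun Y => s Y) s'N.
(* Endomorphisms of a derived functor are detected on the universal transformation. *)
have st : forall Y, s Y ∘ t Y = idm _.
  case: (rd_univ E (rd_nat E)) => u [_ uu] Y.
  have e1 : u = nat_comp s' t.
    by apply: uu => Z /=; rewrite compA tE; exact: sE.
  have e2 : u = nat_id E by apply: uu => Z /=; rewrite comp1m.
  by rewrite -[s Y ∘ t Y]/(nat_comp s' t Y) -e1 e2.
have ts : t (g X) ∘ s (g X) = idm _.
  apply: (iso_epi (ei _ gX)); rewrite compA comp1m.
  by move: (sE X) (tE X) => -> ->.
by rewrite -(sE X); apply: iso_comp (ei _ gX); exists (t (g X)); split=> //; exact: st.
Qed.

End Derive.

(** * Products and left derived functors *)

Definition pair_pred (C D : Category) (P : C -> Prop) (Q : D -> Prop) :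
  prodCat C D -> Prop := fun X => P X.1 /\ Q X.2.

Lemma prod_derivable (C D : Category) (W : hom_class C) (V : hom_class D)
  goodC goodD (appC : hom_class C) (appD : hom_class D) :
  right_derivable W goodC appC -> right_derivable V goodD appD ->
  right_derivable (prod_class W V) (pair_pred goodC goodD) (prod_class appC appD).
Proof.
move=> dC dD; split.
- by move=> X; split; [exact: (dv_id dC) | exact: (dv_id dD)].
- move=> X Y Z g f [w1 w2] [w3 w4].
  by split; [exact: (dv_comp dC w1 w3) | exact: (dv_comp dD w2 w4)].
- move=> X Y Z g f [w1 w2] [w3 w4].
  by split; [exact: (dv_cancel dC w1 w3) | exact: (dv_cancel dD w2 w4)].
- by move=> X Y r [r1 r2]; split; [exact: (dv_weq dC) | exact: (dv_weq dD)].
- move=> [X Y]; case: (dv_rep dC X) (dv_rep dD Y) => R [r [gR ra]] [S [s [gS sa]]].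
  by exists (R, S), (r, s).
- move=> X R r [r1 r2] Y [gY1 gY2] f.
  case: (dv_lift dC r1 gY1 f.1) (dv_lift dD r2 gY2 f.2) => h hE [k kE].
  by exists (h, k); rewrite /= hE kE; case: (f).
- move=> X R r [r1 r2] Y [gY1 gY2] [f1 f2] [f1' f2'] [e1 e2].
  case: (dv_htpy dC r1 gY1 e1) (dv_htpy dD r2 gY2 e2).
  move=> P [s [p [p' [h [[gP sw ps ps'] [ph ph']]]]]].
  move=> [Q [t [q [q' [k [[gQ tw qt qt'] [qk qk']]]]]]].
  exists (P, Q), (s, t), (p, q), (p', q'), (h, k).
  by rewrite /= ps ps' qt qt' ph ph' qk qk'.
Qed.

Lemma op_prod_derivable (C D : Category) (W : hom_class C) (V : hom_class D)
  (goodC : opCat C -> Prop) (goodD : opCat D -> Prop)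
  (appC : hom_class (opCat C)) (appD : hom_class (opCat D)) :
  right_derivable (op_class W) goodC appC ->
  right_derivable (op_class V) goodD appD ->
  @right_derivable (opCat (prodCat C D)) (op_class (prod_class W V))
    (pair_pred goodC goodD) (prod_class appC appD).
Proof.
by move=> dC dD; case: (prod_derivable dC dD) => *; split.
Qed.

Definition deopF (C D : Category) (F : Functor (opCat C) (opCat D)) : Functor C D.
Proof.
refine (@Build_Functor C D (fun X => F X) (fun X Y f => @fmap _ _ F Y X f) _ _).
- abstract (by move=> X; exact: (fmap1 F)).
- abstract (by move=> X Y Z g f; exact: (@fmapM _ _ F Z Y X f g)).
Defined.

Section LeftDerived.
Variables (C HC : Category) (g : Functor C HC) (W : hom_class C).
Variables (good : opCat C -> Prop) (app : hom_class (opCat C)).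
Hypotheses (gL : localization g W) (dv : right_derivable (op_class W) good app).

Lemma left_iso_on_good (E : Category) (G G' : Functor HC E) (t : Nat G G') :
  (forall X : C, good X -> is_iso (t (g X))) -> forall X, is_iso (t (g X)).
Proof.
move=> ti X; case: (dv_rep dv X) => R [r [gR ra]].
have ri : is_iso (fmap g (r : @hom C R X)) := loc_inv gL (dv_weq dv ra).
apply: (iso_cancel_r (fmap_iso G ri)); rewrite (ntN t).
by apply: iso_comp; [exact: fmap_iso | exact: ti].
Qed.

Variables (D HD : Category) (gD : Functor D HD) (P : Functor C D).
Variable T : LeftDerived g gD P.

Definition op_derived : RightDerived (opF g) (opF gD) (opF P).
Proof.
refine (@Build_RightDerived _ _ _ _ (opF g) (opF gD) (opF P) (opF T)
  (@Build_Nat _ _ (opF gD ∘F opF P) (opF T ∘F opF g) (fun X => ld_nat T X)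
     (fun X Y f => esym (@ntN _ _ _ _ (ld_nat T) Y X f))) _).
move=> G xi.
pose xi0 (X : C) : hom ((deopF G ∘F g) X) ((gD ∘F P) X) := xi X.
have xi0N X Y (f : @hom C X Y) :
    xi0 Y ∘ fmap (deopF G ∘F g) f = fmap (gD ∘F P) f ∘ xi0 X.
  exact: (esym (@ntN _ _ _ _ xi Y X f)).
have unop (t : @Nat (opCat HC) (opCat HD) (opF T) G) : { u : Nat (deopF G) T |
    forall X, u X = t X }.
  pose t0 (X : HC) : hom ((deopF G) X) (T X) := t X.
  have t0N X Y (f : @hom HC X Y) : t0 Y ∘ fmap (deopF G) f = fmap T f ∘ t0 X.
    exact: (esym (@ntN _ _ _ _ t Y X f)).
  by exists (@Build_Nat HC HD (deopF G) T t0 t0N).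
case: (ld_univ T (@Build_Nat _ _ (deopF G ∘F g) (gD ∘F P) xi0 xi0N)).
move=> t [tE tu].
pose s (X : opCat HC) : hom ((opF T) X) (G X) := t X.
have sN X Y (f : @hom (opCat HC) X Y) : s Y ∘ fmap (opF T) f = fmap G f ∘ s X.
  exact: (esym (@ntN _ _ _ _ t Y X f)).
exists (@Build_Nat _ _ (opF T) G s sN); split=> [X|s' s'E]; first exact: (tE X).
case: (unop s') => u uE.
apply: nat_ext => X; rewrite /= /s (tu u) ?uE // => Y.
by rewrite uE; exact: (s'E Y).
Defined.

Hypothesis TW : @inverts_on C _ W good (gD ∘F P).

Lemma left_derived_iso (X : C) : good X -> is_iso (ld_nat T X).
Proof.
move=> gX; apply/(@iso_op HD).
apply: (derived_iso (loc_op gL) dv op_derived _ gX) => Y Z w gY gZ ww.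
by apply/(@iso_op HD); exact: TW.
Qed.

Variables (E : Category) (Phi : Functor HD E) (H : Functor HC E).
Variable xi : Nat (H ∘F g) (Phi ∘F (gD ∘F P)).

Lemma left_derived_absolute : exists! t : Nat H (Phi ∘F T),
  forall X, fmap Phi (ld_nat T X) ∘ t (g X) = xi X.
Proof.
have etaN X Y (f : @hom (opCat C) X Y) :
    @comp (opCat HD) _ _ _ (ld_nat T Y) (fmap (opF (gD ∘F P)) f) =
    @comp (opCat HD) _ _ _ (fmap (opF T ∘F opF g) f) (ld_nat T X).
  exact: (esym (@ntN _ _ _ _ (ld_nat T) Y X f)).
pose eta := @Build_Nat (opCat C) (opCat HD) (opF (gD ∘F P)) (opF T ∘F opF g)
  (fun X => ld_nat T X) etaN.
have xN X Y (f : @hom (opCat C) X Y) :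
    @comp (opCat E) _ _ _ (xi Y) (fmap (opF Phi ∘F opF (gD ∘F P)) f) =
    @comp (opCat E) _ _ _ (fmap (opF H ∘F opF g) f) (xi X).
  exact: (esym (@ntN _ _ _ _ xi Y X f)).
have ei (X : opCat C) : good X -> is_iso (eta X).
  by move=> gX; apply/(@iso_op HD); exact: left_derived_iso.
case: (derived_absolute (loc_op gL) dv (Phi := opF Phi) (H := opF H)
  (@Build_Nat (opCat C) (opCat E) (opF Phi ∘F opF (gD ∘F P)) (opF H ∘F opF g)
    (fun X => xi X) xN) ei) => t [tE tu].
have tN X Y (f : @hom HC X Y) :
    @comp E _ _ _ (t Y) (fmap H f) = @comp E _ _ _ (fmap (Phi ∘F T) f) (t X).
  exact: (esym (@ntN _ _ _ _ t Y X f)).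
exists (@Build_Nat _ _ H (Phi ∘F T) (fun X => t X) tN); split=> [X|s sE].
  exact: (tE X).
have sN X Y (f : @hom (opCat HC) X Y) :
    @comp (opCat E) _ _ _ (s Y) (fmap (opF Phi ∘F opF T) f) =
    @comp (opCat E) _ _ _ (fmap (opF H) f) (s X).
  exact: (esym (@ntN _ _ _ _ s Y X f)).
have e := tu (@Build_Nat _ _ (opF Phi ∘F opF T) (opF H) (fun X => s X) sN) sE.
by apply: nat_ext => X; rewrite /= e.
Qed.

End LeftDerived.

(** * Model categories *)

(** Binary products and terminal objects are limits over discrete categories. *)
Definition discCat (I : Type) : Category.
Proof.
refine {| ob := I; hom := fun i j => i = j; idm := @eq_refl I;
          comp := fun i j k g f => eq_trans f g |};
abstract (intros; apply proof_irrelevance).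
Defined.

Lemma finite_discCat (I : Type) : Finite I -> finite_category (discCat I).
Proof.
move=> fI; split=> // i j; case: (classic (i = j)) => [e|ne]; last by exists nil.
by exists (e :: nil) => e'; left; exact: (proof_irrelevance (i = j)).
Qed.

Definition discF (I : Type) (C : Category) (D : I -> C) : Functor (discCat I) C.
Proof.
refine (@Build_Functor (discCat I) C D
  (fun i j e => match e with eq_refl => idm (D i) end) _ _).
- abstract by [].
- abstract (by move=> i j k g f; case: _ / g; case: _ / f; rewrite comp1m).
Defined.

Definition is_product (C : Category) (X Y P : C) (p : hom P X) (q : hom P Y) : Prop :=
  (forall T (a : hom T X) (b : hom T Y), exists h, p ∘ h = a /\ q ∘ h = b) /\
  (forall T (h h' : hom T P), p ∘ h = p ∘ h' -> q ∘ h = q ∘ h' -> h = h').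

Lemma has_product (C : Category) (X Y : C) : has_finite_limits C ->
  exists P (p : hom P X) (q : hom P Y), is_product p q.
Proof.
have fb : Finite bool by exists (true :: false :: nil) => -[] /=; auto.
case/(_ _ (discF (fun b : bool => if b then X else Y)) (finite_discCat fb)).
move=> P [p [pc pU]]; exists P, (p true), (p false); split=> [T a b|T h h' e e'].
  case: (pU T (fun j => if j as j return hom T (if j then X else Y) then a else b)).
    by move=> i j u; case: _ / u => /=; exact: comp1m.
  by move=> h [hE _]; exists h; split; [exact: (hE true) | exact: (hE false)].
case: (pU T (fun j => p j ∘ h)) => [i j u|k [_ ku]]; first by rewrite -compA pc.
by rewrite -(ku h) // -(ku h') // => -[].
Qed.

Lemma has_terminal (C : Category) : has_finite_limits C -> exists T : C, is_terminal T.
Proof.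
have f0 : Finite Empty_set by exists nil; case.
case/(_ _ (discF (fun e : Empty_set => match e with end)) (finite_discCat f0)).
move=> T [p [_ pU]]; exists T => X.
by case: (pU X (fun e => match e with end)) => [[]|h [_ hu]]; exists h; split=> // k _; apply: hu; case.
Qed.

Lemma has_pullback (C : Category) (X Y Z : C) (f : hom X Z) (g : hom Y Z) :
  has_finite_limits C -> exists P (p : hom P X) (q : hom P Y), is_pullback f g p q.
Proof.
move=> hC; case: (has_product X Y hC) => P [p [q [pP pU]]].
case: (has_equalizer (f ∘ p) (g ∘ q) hC) => E [i [ie iU]].
exists E, (p ∘ i), (q ∘ i); split=> [|T a b ab]; first by rewrite -!compA.
case: (pP _ a b) => k [ka kb]; case: (iU _ k); first by rewrite !compA ka kb.
move=> h [hk hu]; exists h; split=> [|h' [h'a h'b]]; first by rewrite !compA hk.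
by apply: hu; apply: pU; rewrite -compA ?ka ?kb.
Qed.

Lemma pullback_mono (C : Category) (X Y Z P : C) (f : hom X Z) (g : hom Y Z)
  (p : hom P X) (q : hom P Y) : is_pullback f g p q ->
  forall T (h h' : hom T P), p ∘ h = p ∘ h' -> q ∘ h = q ∘ h' -> h = h'.
Proof.
move=> [e U] T h h' e1 e2; case: (U T (p ∘ h) (q ∘ h)); first by rewrite -!compA e.
by move=> k [_ ku]; rewrite -(ku h) // (ku h').
Qed.

Lemma op_limits (C : Category) : has_finite_colimits C -> has_finite_limits (opCat C).
Proof.
move=> hC J D [fJ fh].
have [|L [p [pc pU]]] := hC _ (unopF' D); first by split=> // i j; exact: fh.
exists L, p; split=> [i j u|X q qc]; first exact: (pc j i u).
by apply: pU => i j u; exact: (qc j i u).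
Qed.

Lemma op_colimits (C : Category) : has_finite_limits C -> has_finite_colimits (opCat C).
Proof.
move=> hC J D [fJ fh].
have [|L [p [pc pU]]] := hC _ (unopF' D); first by split=> // i j; exact: fh.
exists L, p; split=> [i j u|X q qc]; first exact: (pc j i u).
by apply: pU => i j u; exact: (qc j i u).
Qed.

Lemma op_retract (C : Category) (X Y X' Y' : opCat C) (f : hom X Y) (g : hom X' Y') :
  is_retract f g -> @is_retract C Y X Y' X' f g.
Proof. by move=> [i [r [j [s [e1 e2 e3 e4]]]]]; exists s, j, r, i. Qed.

Lemma op_lifts (C : Category) (A B X Y : C) (i : hom A B) (p : hom X Y) :
  lifts i p <-> @lifts (opCat C) Y X B A p i.
Proof.
by split=> h u v e; case: (h v u (esym e)) => k [k1 k2]; exists k.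
Qed.

Definition opModel (C : Category) (m : ModelStructure C) : ModelStructure (opCat C).
Proof.
refine (@Build_ModelStructure (opCat C) (op_class (@fib _ m)) (op_class (@cof _ m))
  (op_class (@weq _ m)) (op_limits (model_colimits m)) (op_colimits (model_limits m))
  _ _ _ _ _ _ _ _ _ _).
- abstract (by move=> X Y Z g f wf wg; exact: (@weq_comp _ m _ _ _ f g)).
- abstract (by move=> X Y Z g f wg wgf; exact: (@weq_cancel_r _ m _ _ _ f g)).
- abstract (by move=> X Y Z g f wf wgf; exact: (@weq_cancel_l _ m _ _ _ f g)).
- abstract (by move=> X Y X' Y' f g /op_retract r; exact: fib_retract).
- abstract (by move=> X Y X' Y' f g /op_retract r; exact: cof_retract).
- abstract (by move=> X Y X' Y' f g /op_retract r; exact: weq_retract).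
- abstract (by move=> A B X Y i p fi wi cp; apply/op_lifts; exact: (@cof_afib_lifts _ m)).
- abstract (by move=> A B X Y i p fi cp wp; apply/op_lifts; exact: (@acof_fib_lifts _ m)).
- abstract (by move=> X Y f; case: (@factor_cof_afib _ m _ _ f) => Z [i [p [e c f' w]]];
    exists Z, p, i).
- abstract (by move=> X Y f; case: (@factor_acof_fib _ m _ _ f) => Z [i [p [e c w f']]];
    exists Z, p, i).
Defined.

Section ModelLemmas.
Variables (C : Category) (m : ModelStructure C).

(** The retract argument: a map lifting against the second factor of its own
    factorization is a retract of the first. *)
Lemma llp_acof (A B : C) (i : hom A B) :
  (forall X Y (p : hom X Y), fib m p -> lifts i p) -> cof m i /\ weq m i.
Proof.
move=> li; case: (factor_acof_fib m i) => Z [j [p [e cj wj fp]]].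
case: (li _ _ p fp j (idm B)) => [|h [hi ph]]; first by rewrite comp1m.
have r : is_retract i j.
  by exists (idm A), (idm A), h, p; split; rewrite ?comp1m ?compm1.
by split; [exact: cof_retract r cj | exact: weq_retract r wj].
Qed.

Lemma rlp_fib (X Y : C) (p : hom X Y) :
  (forall A B (i : hom A B), cof m i -> weq m i -> lifts i p) -> fib m p.
Proof.
move=> lp; case: (factor_acof_fib m p) => Z [j [q [e cj wj fq]]].
case: (lp _ _ j cj wj (idm X) q) => [|h [hj ph]]; first by rewrite compm1.
apply: fib_retract fq.
by exists j, h, (idm Y), (idm Y); split; rewrite ?comp1m ?compm1.
Qed.

Lemma rlp_afib (X Y : C) (p : hom X Y) :
  (forall A B (i : hom A B), cof m i -> lifts i p) -> fib m p /\ weq m p.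
Proof.
move=> lp; case: (factor_cof_afib m p) => Z [j [q [e cj fq wq]]].
case: (lp _ _ j cj (idm X) q) => [|h [hj ph]]; first by rewrite compm1.
have r : is_retract p q.
  by exists j, h, (idm Y), (idm Y); split; rewrite ?comp1m ?compm1.
by split; [exact: fib_retract r fq | exact: weq_retract r wq].
Qed.

Lemma iso_weq (X Y : C) (f : hom X Y) : is_iso f -> weq m f.
Proof.
move=> [g [gf fg]]; apply: (proj2 (llp_acof _)) => A B p _ u v e.
exists (u ∘ g); split; first by rewrite compA gf compm1.
by rewrite -compA e compA fg compm1.
Qed.

(** Fibrancy stated by extension along acyclic cofibrations, without a terminal
    object. *)
Definition inj_obj (X : C) : Prop := forall A B (i : hom A B),
  cof m i -> weq m i -> forall u : hom A X, exists h : hom B X, h ∘ i = u.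

Lemma inj_fibrant (T X : C) (f : hom X T) : is_terminal T -> inj_obj X <-> fib m f.
Proof.
move=> tT; have tU Z (a b : hom Z T) : a = b.
  by case: (tT Z) => h [_ hu]; rewrite -(hu a) // (hu b).
split=> [iX|ff A B i ci wi u].
  apply: rlp_fib => A B i ci wi u v _; case: (iX _ _ i ci wi u) => h hi.
  by exists h; split.
case: (tT B) => v _; case: (acof_fib_lifts ci wi ff (u := u) (v := v)); first exact: tU.
by move=> h [hi _]; exists h.
Qed.

Definition acof (X Y : C) (r : hom X Y) : Prop := cof m r /\ weq m r.

Lemma inj_fib (X Y : C) (p : hom X Y) : fib m p -> inj_obj Y -> inj_obj X.
Proof.
move=> fp iY A B i ci wi u; case: (iY _ _ i ci wi (p ∘ u)) => v vi.
by case: (acof_fib_lifts ci wi fp (esym vi)) => h [hi _]; exists h.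
Qed.

Lemma inj_product (X Y P : C) (p : hom P X) (q : hom P Y) :
  is_product p q -> inj_obj X -> inj_obj Y -> inj_obj P.
Proof.
move=> [pP pU] iX iY A B i ci wi u.
case: (iX _ _ i ci wi (p ∘ u)) (iY _ _ i ci wi (q ∘ u)) => a ai [b bi].
case: (pP _ a b) => h [ha hb]; exists h.
by apply: pU; rewrite -compA ?ha ?hb.
Qed.

Lemma fib_proj (X Y P Z : C) (p : hom P X) (q : hom P Y) (e : hom Z P) :
  is_product p q -> inj_obj Y -> fib m e -> fib m (p ∘ e).
Proof.
move=> [pP pU] iY fe; apply: rlp_fib => A B i ci wi u v uv.
case: (iY _ _ i ci wi (q ∘ e ∘ u)) => b bi.
case: (pP _ v b) => w [wv wb].
case: (acof_fib_lifts ci wi fe (u := u) (v := w)).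
  by apply: pU; rewrite -compA ?uv -?compA ?wv ?wb // -bi.
by move=> h [hi eh]; exists h; rewrite compA eh.
Qed.

(** The homotopy comes from lifting the acyclic cofibration [r] against the fibration
    [P -> Y × Y] of a path object. *)
Lemma model_derivable : right_derivable (@weq _ m) inj_obj acof.
Proof.
split.
- by move=> X; exact/iso_weq/iso_idm.
- by move=> X Y Z g f; exact: weq_comp.
- by move=> X Y Z g f; exact: weq_cancel_r.
- by move=> X Y r [].
- move=> X; case: (has_terminal (model_limits m)) => T tT.
  case: (tT X) => t _; case: (factor_acof_fib m t) => R [r [p [_ cr wr fp]]].
  by exists R, r; split=> //; apply/(inj_fibrant p tT).
- by move=> X R r [cr wr] Y iY f; exact: iY.
- move=> X R r [cr wr] Y iY f f' e.
  case: (has_product Y Y (model_limits m)) => Q [p [p' pP]].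
  case: (proj1 pP _ (idm Y) (idm Y)) => d [dp dp'].
  case: (factor_acof_fib m d) => P [s [k [dE cs ws fk]]].
  case: (proj1 pP _ f f') => l [lf lf'].
  case: (acof_fib_lifts cr wr fk (u := s ∘ (f ∘ r)) (v := l)).
    by rewrite -compA -dE; apply: (proj2 pP); rewrite -!compA ?dp ?dp' ?comp1m ?lf ?lf'.
  move=> h [_ kh]; exists P, s, (p ∘ k), (p' ∘ k), h.
  split; split; rewrite ?compA -?dE ?kh //.
  exact: (inj_fib fk (inj_product pP iY iY)).
Qed.

(** Ken Brown's lemma: factoring [(id, w) : X -> X × Y] as [s] followed by a
    fibration gives acyclic fibrations onto [X] and [Y], the first a retraction of [s] and
    the second composing with [s] to [w]. *)
Lemma ken_brown (E : Category) (F : Functor C E) :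
  (forall X Y (p : hom X Y), inj_obj X -> inj_obj Y -> fib m p -> weq m p ->
     is_iso (fmap F p)) ->
  inverts_on (@weq _ m) inj_obj F.
Proof.
move=> Fp X Y w iX iY ww.
case: (has_product X Y (model_limits m)) => P [p [q pP]].
case: (proj1 pP _ (idm X) w) => l [lp lq].
case: (factor_acof_fib m l) => Z [s [e [lE cs ws fe]]].
have iZ : inj_obj Z := inj_fib fe (inj_product pP iX iY).
have pP' : is_product q p.
  case: pP => p1 p2; split=> [T a b|T h h' h1 h2]; last exact: p2.
  by case: (p1 T b a) => h [h1 h2]; exists h.
have ps : p ∘ e ∘ s = idm X by rewrite compA -lE.
have qs : q ∘ e ∘ s = w by rewrite compA -lE.
have w1 : weq m (p ∘ e).
  by apply: (weq_cancel_r ws); rewrite ps; exact/iso_weq/iso_idm.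
have w2 : weq m (q ∘ e) by apply: (weq_cancel_r ws); rewrite qs.
have F1 := Fp _ _ _ iZ iX (fib_proj pP iY fe) w1.
have F2 := Fp _ _ _ iZ iY (fib_proj pP' iX fe) w2.
rewrite -qs fmapM; apply: iso_comp => //.
by apply: (iso_cancel_l F1); rewrite -fmapM ps fmap1; exact: iso_idm.
Qed.

End ModelLemmas.

(** * The mirror image of a monoidal category *)

Section Mirror.
Variable M : ClosedSymMon.

Lemma run_braid (X : M) : run X ∘ braid munit X = lun X.
Proof. by rewrite -braid_unit compA braidK compm1. Qed.

Lemma pent_asl (W X Y Z : M) :
  (asl W X Y ⊠ idm Z) ∘ (asl W (X ⊗ Y) Z ∘ (idm W ⊠ asl X Y Z))
  = asl (W ⊗ X) Y Z ∘ asl W X (Y ⊗ Z).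
Proof. by rewrite -compA -pent3 !compA aslKR compm1. Qed.

(** The hexagon with all arrows reversed. *)
Lemma hex_asl (X Y Z : M) :
  (braid Z X ⊠ idm Y) ∘ (asl Z X Y ∘ (idm Z ⊠ braid Y X))
  = asl X Z Y ∘ (braid (Z ⊗ Y) X ∘ asl Z Y X).
Proof.
have hx := hexagon X Z Y.
have i1 : is_iso (asr Z Y X ∘ (braid X (Z ⊗ Y) ∘ asr X Z Y)).
  do 2?apply: iso_comp; [exists (asl Z Y X) | exists (braid (Z ⊗ Y) X) | exists (asl X Z Y)];
  by rewrite ?aslK ?asrK ?braidK.
apply: (iso_epi i1); rewrite -{1}hx !compA.
have b1 : (idm Z ⊠ braid Y X) ∘ (idm Z ⊠ braid X Y) = idm _ by rewrite -tmapR braidK tmap1.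
have b2 : (braid Z X ⊠ idm Y) ∘ (braid X Z ⊠ idm Y) = idm _ by rewrite -tmapL braidK tmap1.
rewrite (pre2 b1) comp1m (pre2 (asrK _ _ _)) comp1m b2.
by rewrite (pre2 (asrK _ _ _)) comp1m (pre2 (braidK _ _)) comp1m asrK.
Qed.

(** The product with its factors exchanged; the two associators exchange roles, and the
    internal hom becomes adjoint on the other side through the braiding. *)
Definition revC : ClosedSymMon.
Proof.
refine (@Build_ClosedSymMon M
  (fun X Y => Y ⊗ X) (fun X X' Y Y' f g => g ⊠ f) _ _ munit
  (fun X Y Z => asl Z Y X) (fun X Y Z => asr Z Y X) _ _ _
  (@run M) (@run_iso M) _ (@lun M) (@lun_iso M) _ _ _ _
  (fun X Y => braid Y X) _ _ _ _
  ihom (fun Y Z => ev Y Z ∘ braid _ _) (fun X Y Z f => curry (f ∘ braid _ _)) _ _).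
- abstract (by move=> *; exact: tmap1).
- abstract (by move=> *; exact: tmapM).
- abstract (by move=> *; exact: asrK).
- abstract (by move=> *; exact: aslK).
- abstract (by move=> *; exact: aslN).
- abstract (by move=> *; exact: runN).
- abstract (by move=> *; exact: lunN).
- abstract (by move=> *; exact: pent_asl).
- abstract (by move=> *; exact: triangle_asl).
- abstract (by rewrite lun_run).
- abstract (by move=> *; exact: braidN).
- abstract (by move=> *; exact: braidK).
- abstract (by move=> *; exact: run_braid).
- abstract (by move=> *; exact: hex_asl).
- abstract (by move=> X Y Z f; rewrite compA braidN (pre2 (curryK _)) compA braidK compm1).
- abstract (by move=> X Y Z k; rewrite !compA (pre22 (braidN _ _)) braidK compm1 curry_ev).
Defined.

Lemma revC_imap (K K' X X' : M) (f : hom K' K) (g : hom X X') :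
  @imap revC K K' X X' f g = imap f g.
Proof. by rewrite /imap /= !compA (pre22 (braidN _ _)) braidK compm1. Qed.

End Mirror.

Section MirrorModel.
Variable M : MonoidalModelCategory.

Definition revM : MonoidalModelCategory.
Proof.
refine (@Build_MonoidalModelCategory (revC M) (mm_model M) _ _).
- abstract (move=> K L X Y g h cg fh P p q; rewrite !revC_imap => pb u;
    apply (@mm_enr M K L X Y g h cg fh P p q pb u)).
- abstract (case: (mm_unit M) => Ic [w [cw ww hw]]; exists Ic, w; split=> // Z fZ;
    rewrite revC_imap /= run_braid; exact: hw).
Defined.

Lemma revM_semicofibrant (X : M) : semicofibrant X -> @semicofibrant revM X.
Proof.
by move=> [h1 h2]; split=> Y Z f; rewrite (@revC_imap M); [exact: h1 | exact: h2].
Qed.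

(** The multiplication is unchanged as a map: exchanging the factors of the product
    turns the monoid into its opposite without using the braiding, and right modules
    into left modules. *)
Definition revMon (A : Monoid M) : Monoid revM.
Proof.
refine (@Build_Monoid revM (mcar A) (mmul A) (mone A) _ _ _).
- abstract (by rewrite /= -compA mmulA !compA aslK compm1).
- abstract (exact: mmulm1).
- abstract (exact: mmul1m).
Defined.

Section Bimodules.
Variables A B : Monoid M.

Definition revB (X : Bimod A B) : Bimod (revMon B) (revMon A).
Proof.
refine (@Build_Bimod revM (revMon B) (revMon A) (bcar X) (ract X) (lact X) _ _ _ _ _).
- abstract (by rewrite /= -compA ractA !compA aslK compm1).
- abstract (exact: ract1).
- abstract (by rewrite /= -compA lactA !compA aslK compm1).
- abstract (exact: lact1).
- abstract (by rewrite /= -compA lract !compA aslK compm1).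
Defined.

(** Defined directly, and not as a second mirror image, since [revM (revM M)] and [M]
    have different evaluation maps. *)
Definition unrevB (X : Bimod (revMon B) (revMon A)) : Bimod A B.
Proof.
pose x : M := bcar X; pose l : hom (A ⊗ x) x := ract X; pose r : hom (x ⊗ B) x := lact X.
refine (@Build_Bimod M A B x l r _ _ _ _ _).
- abstract (have e : l ∘ (idm A ⊠ l) = l ∘ ((mmul A ⊠ idm x) ∘ asl A A x) := ractA X;
    by rewrite -compA e !compA asrK compm1).
- abstract (exact: ract1 X).
- abstract (have e : r ∘ (idm x ⊠ mmul B) = r ∘ ((r ⊠ idm B) ∘ asl x B B) := lactA X;
    by rewrite -[in RHS]compA e !compA asrK compm1).
- abstract (exact: lact1 X).
- abstract (have e : l ∘ (idm A ⊠ r) = r ∘ ((l ⊠ idm B) ∘ asl A x B) := lract X;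
    by rewrite -[in RHS]compA e !compA asrK compm1).
Defined.

Definition revB_map (X Y : Bimod A B) (f : BimodMap X Y) : BimodMap (revB X) (revB Y) :=
  @Build_BimodMap revM _ _ (revB X) (revB Y) (bfun f) (bfunr f) (bfunl f).

Definition unrevB_map (X Y : Bimod (revMon B) (revMon A)) (f : BimodMap X Y) :
    BimodMap (unrevB X) (unrevB Y) :=
  @Build_BimodMap M _ _ (unrevB X) (unrevB Y) (bfun f) (bfunr f) (bfunl f).

End Bimodules.
End MirrorModel.

(** * Cotensors and coinduced modules *)

Section Linear.
Variable M : ClosedSymMon.

Definition llinear (A B B' : Monoid M) (X : Bimod A B) (Y : Bimod A B') (f : hom X Y) :=
  f ∘ lact X = lact Y ∘ (idm A ⊠ f).

Definition rlinear (A A' B : Monoid M) (X : Bimod A B) (Y : Bimod A' B) (f : hom X Y) :=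
  f ∘ ract X = ract Y ∘ (f ⊠ idm B).

Lemma unit_llinear (A B : Monoid M) (X : Bimod (unitMonoid M) A)
  (Y : Bimod (unitMonoid M) B) (f : hom X Y) : llinear f.
Proof. by rewrite /llinear !unit_lact lunN. Qed.

Definition regB (A : Monoid M) : Bimod A A :=
  @Build_Bimod M A A (mcar A) (mmul A) (mmul A) (mmulA A) (mmul1m A) (mmulA A)
    (mmulm1 A) (mmulA A).

(** The forced actions of the unit monoid. *)
Definition trivB (U : M) : Bimod (unitMonoid M) (unitMonoid M).
Proof.
refine (@Build_Bimod M (unitMonoid M) (unitMonoid M) U (lun U) (run U) _ _ _ _ _).
- abstract (by rewrite /= -lun_tens -!compA lunN).
- abstract (by rewrite tmap1 compm1).
- abstract (by rewrite /= triangle).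
- abstract (by rewrite tmap1 compm1).
- abstract (by rewrite /= runN run_tens).
Defined.

End Linear.

(** The internal hom [[L,N]] as a (B,C)-bimodule, for the right action of [B] on [L] and
    of [C] on [N].  With [L] trivial it is the cotensor of a right module by an object of
    [M]; with [L = B] it is the module coinduced from [N].  Its laws are those of the
    function object over the unit monoid, for the modules [L0] and [N0]. *)
Section Cotensor.
Variables (M : MonoidalModelCategory) (D D' B C : Monoid M).
Variables (L : Bimod D' B) (N : Bimod D C).

Let L0 := res_ob (unitMap D') (idMonoid B) L.
Let N0 := res_ob (unitMap D) (idMonoid C) N.

Definition cot_lact : hom (B ⊗ ihom L N) (ihom L N) :=
  curry (ev L N ∘ ((ract L0 ⊠ idm _) ∘ asl L B _)).

Definition cot_ract : hom (ihom L N ⊗ C) (ihom L N) :=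
  curry (ract N0 ∘ ((ev L N ⊠ idm C) ∘ asl L _ C)).

Definition cot : Bimod B C :=
  let u X := @curry_uniq M X L N in
  let eL := curryK _ in let eR := curryK _ in
  @Build_Bimod M B C (ihom L N) cot_lact cot_ract
    (rep_lactA (L := L0) (N := N0) u eL) (rep_lact1 (L := L0) (N := N0) u eL)
    (rep_ractA (L := L0) (N := N0) u eR) (rep_ract1 (L := L0) (N := N0) u eR)
    (rep_lract (L := L0) (N := N0) u eL eR).

Lemma cot_lactE : ev L N ∘ (idm L ⊠ lact cot) = ev L N ∘ ((ract L ⊠ idm _) ∘ asl L B _).
Proof. by rewrite curryK /= tmap1 compm1. Qed.

Lemma cot_ractE : ev L N ∘ (idm L ⊠ ract cot) = ract N ∘ ((ev L N ⊠ idm C) ∘ asl L _ C).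
Proof. by rewrite curryK /= tmap1 compm1. Qed.

End Cotensor.

Section CotensorMap.
Variables (M : MonoidalModelCategory) (D D' E E' B C : Monoid M).
Variables (L : Bimod D B) (L' : Bimod D' B) (N : Bimod E C) (N' : Bimod E' C).
Variables (f : hom L' L) (g : hom N N').
Hypotheses (fl : rlinear f) (gl : rlinear g).

Lemma imapE (K K' X X' : M) (h : hom K' K) (k : hom X X') :
  ev K' X' ∘ (idm K' ⊠ imap h k) = k ∘ (ev K X ∘ (h ⊠ idm _)).
Proof. exact: curryK. Qed.

Lemma cot_map_l :
  imap f g ∘ lact (cot L N) = lact (cot L' N') ∘ (idm B ⊠ imap f g).
Proof.
apply: curry_uniq; rewrite !tmapR (pre2 (imapE _ _)) (pre22 (cot_lactE L' N')) !compA.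
rewrite tmapC (pre22 (cot_lactE L N)) !compA aslN3 (pre22 (tmapC _ _)) (pre2 (imapE _ _)).
by rewrite !compA aslN1 !tmapL_pre fl.
Qed.

Lemma cot_map_r :
  imap f g ∘ ract (cot L N) = ract (cot L' N') ∘ (imap f g ⊠ idm C).
Proof.
apply: curry_uniq; rewrite !tmapR (pre2 (imapE _ _)) (pre22 (cot_ractE L' N')) !compA.
rewrite tmapC (pre22 (cot_ractE L N)) !compA aslN2 aslN1 !tmapL_pre imapE !tmapL !compA.
by rewrite (pre22 gl).
Qed.

Definition cot_map : BimodMap (cot L N) (cot L' N') :=
  @Build_BimodMap M B C (cot L N) (cot L' N') (imap f g) cot_map_l cot_map_r.

End CotensorMap.

(** Pullbacks of bimodules are created in [M]: the projections are jointly monic, so the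
    laws of the induced actions can be checked after projecting. *)
Lemma pullback_bimod (M : MonoidalModelCategory) (A B : Monoid M) (X Y Z : Bimod A B)
  (f : BimodMap X Z) (g : BimodMap Y Z) :
  exists (P : Bimod A B) (p : BimodMap P X) (q : BimodMap P Y),
    is_pullback (bfun f) (bfun g) (bfun p) (bfun q).
Proof.
case: (has_pullback (bfun f) (bfun g) (model_limits (mm_model M))) => P [p [q pb]].
have [pq pU] := pb; have pm := pullback_mono pb.
case: (pU _ (lact X ∘ (idm A ⊠ p)) (lact Y ∘ (idm A ⊠ q))).
  by rewrite -!compA !bfunl !compA -!tmapR pq.
move=> l [[lp lq] _].
case: (pU _ (ract X ∘ (p ⊠ idm B)) (ract Y ∘ (q ⊠ idm B))).
  by rewrite -!compA !bfunr !compA -!tmapL pq.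
move=> r [[rp rq] _].
have lA : l ∘ (mmul A ⊠ idm P) = l ∘ ((idm A ⊠ l) ∘ asr _ _ _).
  by apply: pm; rewrite ?(pre2 lp) ?(pre2 lq) !compA -tmapC (pre22 (lactA _)) !compA
    asrN3 !tmapR_pre ?lp ?lq.
have l1 : l ∘ (mone A ⊠ idm P) = lun P.
  by apply: pm; rewrite ?(pre2 lp) ?(pre2 lq) !compA -tmapC (pre2 (lact1 _)) lunN.
have rA : r ∘ (r ⊠ idm B) = r ∘ ((idm P ⊠ mmul B) ∘ asr _ _ _).
  by apply: pm; rewrite ?(pre2 rp) ?(pre2 rq) !compA (pre22 (tmapC _ _))
    -tmapL ?rp ?rq tmapL (pre22 (ractA _)) !compA asrN1.
have r1 : r ∘ (idm P ⊠ mone B) = run P.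
  by apply: pm; rewrite ?(pre2 rp) ?(pre2 rq) !compA tmapC (pre2 (ract1 _)) runN.
have lr : r ∘ (l ⊠ idm B) = l ∘ ((idm A ⊠ r) ∘ asr _ _ _).
  by apply: pm; rewrite ?(pre2 rp) ?(pre2 rq) ?(pre2 lp) ?(pre2 lq) !compA
    -?tmapL ?tmapR_pre ?lp ?lq ?rp ?rq ?tmapL ?tmapR !compA (pre22 (lract _)) !compA asrN2.
pose PB := @Build_Bimod M A B P l r lA l1 rA r1 lr.
by exists PB, (@Build_BimodMap M A B PB X p lp rp), (@Build_BimodMap M A B PB Y q lq rq).
Qed.

(** * Lifting properties of modules *)

Section Lifting.
Variable M : MonoidalModelCategory.
Let m := mm_model M.

(** Cofibrancy and acyclic cofibrations are expressed by lifting against maps whose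
    underlying map is a fibration, so that these notions make sense for every pair of
    monoids, in particular after restriction of the actions. *)
Definition mod_proj (A B : Monoid M) (X : Bimod A B) : Prop :=
  forall (Y Z : Bimod A B) (p : BimodMap Y Z), fib m (bfun p) -> weq m (bfun p) ->
  forall v : BimodMap X Z, exists h : BimodMap X Y, bfun p ∘ bfun h = bfun v.

Definition mod_llp (A B : Monoid M) (X X' : Bimod A B) (f : BimodMap X X') : Prop :=
  forall (Y Z : Bimod A B) (p : BimodMap Y Z), fib m (bfun p) ->
  forall (u : BimodMap X Y) (v : BimodMap X' Z), bfun p ∘ bfun u = bfun v ∘ bfun f ->
  exists h : BimodMap X' Y, bfun h ∘ bfun f = bfun u /\ bfun p ∘ bfun h = bfun v.

(** The same after the left action has been forgotten. *)
Definition right_proj (A B : Monoid M) (X : Bimod A B) : Prop :=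
  forall D (Y Z : Bimod D B) (p : BimodMap Y Z), fib m (bfun p) -> weq m (bfun p) ->
  forall v : hom X Z, rlinear v -> exists h : hom X Y, rlinear h /\ bfun p ∘ h = v.

Definition right_llp (A B : Monoid M) (X X' : Bimod A B) (f : BimodMap X X') : Prop :=
  forall D (Y Z : Bimod D B) (p : BimodMap Y Z), fib m (bfun p) ->
  forall (u : hom X Y) (v : hom X' Z), rlinear u -> rlinear v -> bfun p ∘ u = v ∘ bfun f ->
  exists h : hom X' Y, [/\ rlinear h, h ∘ bfun f = u & bfun p ∘ h = v].

Definition unlun (X : M) : hom X (munit ⊗ X) :=
  proj1_sig (constructive_indefinite_description _ (lun_iso X)).

Lemma unlunK (X : M) : lun X ∘ unlun X = idm X.
Proof. by rewrite /unlun; case: constructive_indefinite_description => v []. Qed.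

Lemma lunK (X : M) : unlun X ∘ lun X = idm (munit ⊗ X).
Proof. by rewrite /unlun; case: constructive_indefinite_description => v []. Qed.

Lemma unlunN (X Y : M) (f : hom X Y) : unlun Y ∘ f = (idm munit ⊠ f) ∘ unlun X.
Proof.
apply: (iso_mono (lun_iso Y)).
by rewrite (pre2 (unlunK _)) comp1m (pre22 (lunN _)) unlunK compm1.
Qed.

Lemma unlun_tens (X Y : M) : asl munit X Y ∘ unlun (X ⊗ Y) = unlun X ⊠ idm Y.
Proof.
apply: (iso_mono (f := lun X ⊠ idm Y)).
  exists (unlun X ⊠ idm Y); rewrite -!tmapL lunK unlunK !tmap1.
  by [].
by rewrite -tmapL unlunK tmap1 -lun_tens compA (pre2 (aslK _ _ _)) comp1m unlunK.
Qed.

Section Coinduction.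
Variables (A B : Monoid M) (X : Bimod A B).

Section In.
Variables (D : Monoid M) (Z : Bimod D B) (v : hom X Z).
Hypothesis vr : rlinear v.

(** The adjoint [X -> [A,Z]] of [v : X -> Z] sends [x] to [a |-> v (a x)]. *)
Lemma coind_in_l : curry (v ∘ lact X) ∘ lact X =
  lact (cot (regB A) Z) ∘ (idm A ⊠ curry (v ∘ lact X)).
Proof.
apply: curry_uniq; rewrite !tmapR (pre2 (curryK _)) (pre22 (cot_lactE (regB A) Z)).
rewrite !compA aslN3 /= (pre22 (tmapC _ _)) (pre2 (curryK _)) !compA (pre22 (lactA X)) !compA.
by rewrite aslK compm1.
Qed.

Lemma coind_in_r : curry (v ∘ lact X) ∘ ract X =
  ract (cot (regB A) Z) ∘ (curry (v ∘ lact X) ⊠ idm B).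
Proof.
apply: curry_uniq; rewrite !tmapR (pre2 (curryK _)) (pre22 (cot_ractE (regB A) Z)).
rewrite !compA aslN2 tmapL_pre curryK tmapL !compA -(pre22 vr) (pre22 (lract X)) !compA.
by rewrite aslK compm1.
Qed.

Definition coind_in : BimodMap X (cot (regB A) Z) :=
  @Build_BimodMap M A B X (cot (regB A) Z) _ coind_in_l coind_in_r.

End In.

(** Composition with the counit [[A,Y] -> Y], evaluation at the unit of [A]. *)
Definition coind_out (D : Monoid M) (Y : Bimod D B) (h : hom X (ihom A Y)) : hom X Y :=
  ev A Y ∘ ((mone A ⊠ h) ∘ unlun X).

Lemma coind_outE (D : Monoid M) (Y : Bimod D B) (h : hom X (ihom A Y)) :
  coind_out h = ev A Y ∘ (idm A ⊠ h) ∘ ((mone A ⊠ idm X) ∘ unlun X).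
Proof. by rewrite /coind_out !compA tmapM_pre comp1m compm1. Qed.

Lemma coind_out_r (D : Monoid M) (Y : Bimod D B) (h : BimodMap X (cot (regB A) Y)) :
  rlinear (coind_out (bfun h)).
Proof.
rewrite /rlinear coind_outE.
have kr : ev A Y ∘ (idm A ⊠ bfun h) ∘ (idm A ⊠ ract X) =
    ract Y ∘ ((ev A Y ∘ (idm A ⊠ bfun h)) ⊠ idm B) ∘ asl A X B.
  rewrite compA -tmapR (bfunr h) tmapR (pre22 (cot_ractE (regB A) Y)) !compA aslN2.
  by rewrite tmapL_pre.
move: (ev A Y ∘ (idm A ⊠ bfun h)) kr => k kr.
rewrite !compA unlunN (pre22 (tmapC _ _)) (pre2 kr) !compA.
by rewrite (pre22 (aslN1 _ _ _)) unlun_tens tmapL_pre -!tmapL !compA.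
Qed.

Lemma coind_out_post (D : Monoid M) (Y Z : Bimod D B) (p : BimodMap Y Z)
  (h : hom X (ihom A Y)) (v : hom X Z) :
  imap (idm A) (bfun p) ∘ h = curry (v ∘ lact X) -> bfun p ∘ coind_out h = v.
Proof.
move=> e.
have {}e : bfun p ∘ (ev A Y ∘ (idm A ⊠ h)) = v ∘ lact X.
  rewrite -(curryK (v ∘ lact X)) -e tmapR (pre2 (imapE _ _)).
  by rewrite tmap1 !compA compm1 || rewrite tmap1 compm1 compA.
rewrite coind_outE (pre2 e) !compA (pre2 (lact1 X)) unlunK.
by rewrite compm1.
Qed.

End Coinduction.

Lemma coind_out_pre (A B D : Monoid M) (X X' : Bimod A B) (f : BimodMap X X')
  (Y : Bimod D B) (h : hom X' (ihom A Y)) (u : hom X Y) :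
  h ∘ bfun f = curry (u ∘ lact X) -> coind_out h ∘ bfun f = u.
Proof.
move=> e; rewrite coind_outE !compA unlunN (pre22 (tmapC _ _)) tmapR_pre e.
by rewrite (pre2 (curryK _)) !compA (pre2 (lact1 X)) unlunK compm1.
Qed.

Lemma coind_comm (A B D : Monoid M) (X X' : Bimod A B) (f : BimodMap X X')
  (Y Z : Bimod D B) (p : BimodMap Y Z) (u : hom X Y) (v : hom X' Z) :
  bfun p ∘ u = v ∘ bfun f ->
  imap (idm A) (bfun p) ∘ curry (u ∘ lact X) = curry (v ∘ lact X') ∘ bfun f.
Proof.
move=> e; apply: curry_uniq; rewrite !tmapR (pre2 (imapE _ _)) (pre2 (curryK _)).
by rewrite tmap1 compm1 compA curryK -compA e !compA bfunl.
Qed.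

Lemma idm_rlinear (A B : Monoid M) (X : Bimod A B) : rlinear (X := X) (Y := X) (idm (bcar X)).
Proof. by rewrite /rlinear tmap1 comp1m compm1. Qed.

(** Forgetting the action of [A] is left adjoint to coinduction [[A,-]], which
    preserves acyclic fibrations when [A] is semicofibrant. *)
Lemma proj_right_proj (A B : Monoid M) (X : Bimod A B) :
  semicofibrant (mcar A) -> mod_proj X -> right_proj X.
Proof.
move=> [_ sA] pX D Y Z p fp wp v vr.
case: (sA _ _ _ fp wp) => fp' wp'.
case: (pX _ _ (cot_map (idm_rlinear (regB A)) (bfunr p)) fp' wp' (coind_in vr)) => h hE.
exists (coind_out (bfun h)); split; first exact: coind_out_r.
exact: coind_out_post hE.
Qed.

Lemma llp_right_llp (A B : Monoid M) (X X' : Bimod A B) (f : BimodMap X X') :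
  semicofibrant (mcar A) -> mod_llp f -> right_llp f.
Proof.
move=> [sA _] pX D Y Z p fp u v ur vr e.
have fp' := sA _ _ _ fp.
case: (pX _ _ (cot_map (idm_rlinear (regB A)) (bfunr p)) fp' (coind_in ur) (coind_in vr)).
  exact: coind_comm.
move=> h [hf ph]; exists (coind_out (bfun h)).
by split; [exact: coind_out_r | exact: coind_out_pre hf | exact: coind_out_post ph].
Qed.

(** Linearity in [Y] of a map with a parameter in [U]; by [curry_rlinear] such maps are
    the module maps from [Y] to the cotensor [[U,Z]]. *)
Definition Rlinear (B C D : Monoid M) (Y : Bimod B C) (Z : Bimod D C) (U : M)
    (f : hom (U ⊗ Y) Z) : Prop :=
  f ∘ ((idm U ⊠ ract Y) ∘ asr U Y C) = ract Z ∘ (f ⊠ idm C).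

Lemma curry_rlinear (B C D : Monoid M) (Y : Bimod B C) (Z : Bimod D C) (U : M)
  (f : hom (U ⊗ Y) Z) :
  Rlinear f <-> rlinear (X := Y) (Y := cot (trivB U) Z) (curry f).
Proof.
have e1 : ev U Z ∘ (idm U ⊠ (curry f ∘ ract Y)) = f ∘ (idm U ⊠ ract Y).
  by rewrite tmapR (pre2 (curryK _)).
have e2 : ev U Z ∘ (idm U ⊠ (ract (cot (trivB U) Z) ∘ (curry f ⊠ idm C))) =
    ract Z ∘ ((f ⊠ idm C) ∘ asl U Y C).
  by rewrite tmapR (pre22 (cot_ractE (trivB U) Z)) !compA aslN2 tmapL_pre curryK.
split=> [fr|fr]; first by apply: curry_uniq; rewrite e1 e2 -[in RHS]compA -fr !compA aslK compm1.
by rewrite /Rlinear -compA -e1 fr e2 !compA asrK compm1.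
Qed.

Lemma trivB_rlinear (U V : M) (i : hom U V) :
  rlinear (X := trivB U) (Y := trivB V) i.
Proof. by rewrite /rlinear /= runN. Qed.

(** By adjunction one lifts [Y] against [[V,Z] -> [U,Z] ×_[U,Z'] [V,Z']].  The
    pullback [P] is formed in modules, so the lift is linear, and the enrichment axiom of
    [M] makes this map a fibration, acyclic if [i] or [p] is a weak equivalence. *)
Lemma right_pushout_product (B C : Monoid M) (Y : Bimod B C) (U V : M) (i : hom U V)
  (D : Monoid M) (Z Z' : Bimod D C) (p : BimodMap Z Z')
  (a : hom (U ⊗ Y) Z) (b : hom (V ⊗ Y) Z') :
  right_proj Y -> cof m i -> fib m (bfun p) -> weq m i \/ weq m (bfun p) ->
  Rlinear a -> Rlinear b -> bfun p ∘ a = b ∘ (i ⊠ idm Y) ->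
  exists c : hom (V ⊗ Y) Z, [/\ Rlinear c, c ∘ (i ⊠ idm Y) = a & bfun p ∘ c = b].
Proof.
move=> pY ci fp wip /curry_rlinear al /curry_rlinear bl e.
have iU := idm_rlinear (trivB U); have iV := idm_rlinear (trivB V).
have ir := trivB_rlinear i.
pose pU := cot_map iU (bfunr p); pose pV := cot_map iV (bfunr p).
pose iZ := cot_map ir (idm_rlinear Z); pose iZ' := cot_map ir (idm_rlinear Z').
have [P [q [r pb]]] := pullback_bimod pU iZ'.
have pm := pullback_mono pb; have [_ pu] := pb.
have ab : bfun pU ∘ curry a = bfun iZ' ∘ curry b.
  apply: curry_uniq; rewrite !tmapR !(pre2 (imapE _ _)) !compA tmap1 !comp1m.
  by rewrite tmapC curryK (pre2 (curryK _)).
have ii : bfun pU ∘ bfun iZ = bfun iZ' ∘ bfun pV.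
  apply: curry_uniq; rewrite !tmapR !(pre2 (imapE _ _)) !compA tmap1 !comp1m.
  by rewrite tmapC (pre2 (imapE _ _)) imapE tmap1 !compm1 !comp1m compA.
have [w [[wa wb] _]] := pu _ _ _ ab.
have [u [[uq ur] _]] := pu _ _ _ ii.
have [fu wu] := mm_enr ci fp pb uq ur.
(* Linearity into [P] can be tested on its two projections. *)
have mono_r D' (T : Bimod D' C) (k : hom T P) : rlinear (X := T) (Y := cot (trivB U) Z)
    (bfun q ∘ k) -> rlinear (X := T) (Y := cot (trivB V) Z') (bfun r ∘ k) -> rlinear k.
  rewrite /rlinear => kq kr; apply: pm.
    by rewrite -!compA kq (bfunr q) compA tmapL.
  by rewrite -!compA kr (bfunr r) compA tmapL.
have wl : rlinear (X := Y) (Y := P) w by apply: mono_r; rewrite ?wa ?wb.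
have ul : rlinear (X := cot (trivB V) Z) (Y := P) u.
  by apply: mono_r; rewrite ?uq ?ur; exact: bfunr.
pose u' := @Build_BimodMap M _ _ (cot (trivB V) Z) P u (unit_llinear u) ul.
have [|h [hl hw]] := pY _ _ _ u' fu _ w wl; first by apply: wu; case: wip; auto.
exists (ev V Z ∘ (idm V ⊠ h)); split.
- apply/curry_rlinear; rewrite curry_ev.
  exact: hl.
- rewrite compA -tmapC -(curryK a) -wa -hw -compA.
  have -> : bfun q ∘ (bfun u' ∘ h) = bfun iZ ∘ h by rewrite -compA uq.
  rewrite tmapR (pre2 (imapE _ _)) comp1m.
  by rewrite compA.
- rewrite -(curryK b) -wb -hw.
  have -> : bfun r ∘ (bfun u' ∘ h) = bfun pV ∘ h by rewrite -compA ur.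
  by rewrite tmapR (pre2 (imapE _ _)) tmap1 compm1 compA.
Qed.

(** The other adjunction: one lifts [f] against [[V,N] -> [U,N]].  This is a fibration
    by the enrichment axiom for [N -> T] with [T] terminal, where the pullback is just
    [[U,N]] since maps into [[V,T]] are unique. *)
Lemma right_fibrant_extend (A B : Monoid M) (X X' : Bimod A B) (f : BimodMap X X')
  (U V : M) (i : hom U V) (D : Monoid M) (N : Bimod D B)
  (a : hom (U ⊗ X') N) (b : hom (V ⊗ X) N) :
  right_llp f -> cof m i -> inj_obj m (bcar N) ->
  Rlinear a -> Rlinear b -> a ∘ (idm U ⊠ bfun f) = b ∘ (i ⊠ idm X) ->
  exists c : hom (V ⊗ X') N,
    [/\ Rlinear c, c ∘ (i ⊠ idm X') = a & c ∘ (idm V ⊠ bfun f) = b].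
Proof.
move=> pf ci iN /curry_rlinear al /curry_rlinear bl e.
pose iZ := cot_map (trivB_rlinear i) (idm_rlinear N).
have fZ : fib m (bfun iZ).
  case: (has_terminal (model_limits m)) => T tT; case: (tT N) => t _.
  have tU W (x y : hom W T) : x = y.
    by case: (tT W) => h [_ hu]; rewrite -(hu x) // (hu y).
  have ft : fib m t by apply/(inj_fibrant m t tT).
  have tI W W' (x y : hom W (ihom W' T)) : x = y.
    by apply: curry_uniq; exact: tU.
  case: (tT (V ⊗ ihom U N)) => q0 _; pose q := curry q0.
  have pb : is_pullback (imap (idm U) t) (imap i (idm T)) (idm (ihom U N)) q.
    split=> [|W x y _]; first exact: tI.
    exists x; split=> [|z [<- _]]; last by rewrite comp1m.
    by split; [rewrite comp1m | exact: tI].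
  apply: (proj1 (mm_enr ci ft pb (u := bfun iZ) _ _)); last exact: tI.
  by rewrite comp1m.
have [|h [hl hf ih]] := pf _ _ _ iZ fZ (curry b) (curry a) bl al.
  apply: curry_uniq; rewrite !tmapR (pre2 (imapE _ _)) !compA tmapC !(pre2 (curryK _)).
  by rewrite e comp1m.
exists (ev V N ∘ (idm V ⊠ h)); split.
- by apply/curry_rlinear; rewrite curry_ev.
- rewrite compA -tmapC -(curryK a) -ih tmapR (pre2 (imapE _ _)) comp1m.
  by rewrite compA.
- by rewrite compA -tmapR hf curryK.
Qed.

End Lifting.

(** * Lifting properties of left modules *)

Section LeftLifting.
Variable M : MonoidalModelCategory.
Let m := mm_model M.

(** Stated in the mirror image, where the left action of [A] is a right action. *)
Definition left_proj (A B : Monoid M) (X : Bimod A B) : Prop :=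
  @right_proj (revM M) _ _ (revB X).

Definition left_llp (A B : Monoid M) (X X' : Bimod A B) (f : BimodMap X X') : Prop :=
  @right_llp (revM M) _ _ _ _ (revB_map f).

Definition to_unrev (A B : Monoid M) (X : Bimod A B) (Z : Bimod (revMon B) (revMon A))
    (v : BimodMap (revB X) Z) : BimodMap X (unrevB Z) :=
  @Build_BimodMap M A B X (unrevB Z) (bfun v) (bfunr v) (bfunl v).

Definition of_unrev (A B : Monoid M) (X : Bimod A B) (Z : Bimod (revMon B) (revMon A))
    (v : BimodMap X (unrevB Z)) : BimodMap (revB X) Z :=
  @Build_BimodMap (revM M) _ _ (revB X) Z (bfun v) (bfunr v) (bfunl v).

Lemma rev_proj (A B : Monoid M) (X : Bimod A B) :
  mod_proj X -> @mod_proj (revM M) _ _ (revB X).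
Proof.
move=> pX Y Z p fp wp v.
by case: (pX _ _ (unrevB_map p) fp wp (to_unrev v)) => h hE; exists (of_unrev h).
Qed.

Lemma rev_llp (A B : Monoid M) (X X' : Bimod A B) (f : BimodMap X X') :
  mod_llp f -> @mod_llp (revM M) _ _ _ _ (revB_map f).
Proof.
move=> pf Y Z p fp u v e.
by case: (pf _ _ (unrevB_map p) fp (to_unrev u) (to_unrev v) e) => h hE; exists (of_unrev h).
Qed.

Lemma proj_left_proj (A B : Monoid M) (X : Bimod A B) :
  semicofibrant (mcar B) -> mod_proj X -> left_proj X.
Proof.
by move=> sB pX; apply: proj_right_proj (rev_proj pX); exact: revM_semicofibrant.
Qed.

Lemma llp_left_llp (A B : Monoid M) (X X' : Bimod A B) (f : BimodMap X X') :
  semicofibrant (mcar B) -> mod_llp f -> left_llp f.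
Proof.
by move=> sB pX; apply: llp_right_llp (rev_llp pX); exact: revM_semicofibrant.
Qed.

Lemma left_proj_lift (A B D : Monoid M) (X : Bimod A B) (Y Z : Bimod A D)
  (p : BimodMap Y Z) (v : hom X Z) :
  left_proj X -> fib m (bfun p) -> weq m (bfun p) -> llinear v ->
  exists h : hom X Y, llinear h /\ bfun p ∘ h = v.
Proof.
move=> pX fp wp vl.
exact: (pX _ _ _ (revB_map p) fp wp v vl).
Qed.

Lemma proj_res_unitL (A B : Monoid M) (X : Bimod A B) :
  semicofibrant (mcar A) -> mod_proj X -> mod_proj (res_ob (unitMap A) (idMonoid B) X).
Proof.
move=> sA pX Y Z p fp wp v.
have vr : rlinear (X := X) (Y := Z) (bfun v).
  by move: (bfunr v); rewrite /= tmap1 compm1.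
have [h [hr ph]] := proj_right_proj sA pX fp wp vr.
have hr' : h ∘ ract (res_ob (unitMap A) (idMonoid B) X) = ract Y ∘ (h ⊠ idm B).
  by rewrite /= tmap1 compm1.
by exists (@Build_BimodMap M _ _ (res_ob (unitMap A) (idMonoid B) X) Y h
  (unit_llinear (X := res_ob (unitMap A) (idMonoid B) X) (Y := Y) h) hr').
Qed.

Lemma unit_rlinear (A B : Monoid M) (X : Bimod A (unitMonoid M))
  (Y : Bimod B (unitMonoid M)) (f : hom X Y) : rlinear f.
Proof. by rewrite /rlinear !unit_ract runN. Qed.

Lemma proj_res_unitR (A B : Monoid M) (X : Bimod A B) :
  semicofibrant (mcar B) -> mod_proj X -> mod_proj (res_ob (idMonoid A) (unitMap B) X).
Proof.
move=> sB pX Y Z p fp wp v.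
have vr : llinear (X := X) (Y := Z) (bfun v).
  by move: (bfunl v); rewrite /= tmap1 compm1.
have [h [hr ph]] := left_proj_lift (proj_left_proj sB pX) fp wp vr.
have hr' : h ∘ lact (res_ob (idMonoid A) (unitMap B) X) = lact Y ∘ (idm A ⊠ h).
  by rewrite /= tmap1 compm1.
by exists (@Build_BimodMap M _ _ (res_ob (idMonoid A) (unitMap B) X) Y h hr'
  (unit_rlinear (X := res_ob (idMonoid A) (unitMap B) X) (Y := Y) h)).
Qed.

Lemma rev_Rlinear (A B D : Monoid M) (X : Bimod A B) (Z : Bimod A D) (U : M)
  (f : hom (X ⊗ U) Z) :
  Alinear f <-> @Rlinear (revM M) _ _ _ (revB X) (revB Z) U f.
Proof.
rewrite /Alinear /Rlinear /=; split=> e.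
  by rewrite -compA e !compA aslK compm1.
by rewrite -[in RHS]compA -e !compA asrK compm1.
Qed.

(** The conclusion of [left_pushout_product], isolated as a property of [X] because on
    the mirrored side it comes from [right_pushout_product] and not from
    [left_proj], which would involve mirroring twice. *)
Definition left_pp (A B D : Monoid M) (X : Bimod A B) : Prop :=
  forall (U V : M) (i : hom U V) (Z Z' : Bimod A D) (p : BimodMap Z Z')
    (a : hom (X ⊗ U) Z) (b : hom (X ⊗ V) Z'),
  cof m i -> fib m (bfun p) -> weq m i \/ weq m (bfun p) ->
  Alinear a -> Alinear b -> bfun p ∘ a = b ∘ (idm X ⊠ i) ->
  exists c : hom (X ⊗ V) Z, [/\ Alinear c, c ∘ (idm X ⊠ i) = a & bfun p ∘ c = b].

Lemma left_pushout_product (A B D : Monoid M) (X : Bimod A B) :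
  left_proj X -> left_pp D X.
Proof.
move=> pX U V i Z Z' p a b ci fp wip /rev_Rlinear al /rev_Rlinear bl e.
have [c [/rev_Rlinear cl ca pc]] := @right_pushout_product (revM M) _ _ (revB X) U V i _
  _ _ (revB_map p) a b pX ci fp wip al bl e.
by exists c.
Qed.

Lemma left_fibrant_extend (A B : Monoid M) (X X' : Bimod A B) (f : BimodMap X X')
  (U V : M) (i : hom U V) (D : Monoid M) (N : Bimod A D)
  (a : hom (X' ⊗ U) N) (b : hom (X ⊗ V) N) :
  left_llp f -> cof m i -> inj_obj m (bcar N) ->
  Alinear a -> Alinear b -> a ∘ (bfun f ⊠ idm U) = b ∘ (idm X ⊠ i) ->
  exists c : hom (X' ⊗ V) N,
    [/\ Alinear c, c ∘ (idm X' ⊠ i) = a & c ∘ (bfun f ⊠ idm V) = b].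
Proof.
move=> pf ci iN /rev_Rlinear al /rev_Rlinear bl e.
have [c [/rev_Rlinear cl ca pc]] := @right_fibrant_extend (revM M) _ _ _ _ (revB_map f)
  U V i _ (revB N) a b pf ci iN al bl e.
by exists c.
Qed.

(** * Function objects *)

Lemma Alinear_pre (A B C : Monoid M) (L : Bimod A B) (N : Bimod A C) (X Y : M)
  (e : hom (L ⊗ Y) N) (u : hom X Y) : Alinear e -> Alinear (e ∘ (idm L ⊠ u)).
Proof.
move=> el; rewrite /Alinear compA -tmapC (pre22 el) !compA asrN3.
by rewrite tmapR_pre.
Qed.

Lemma homA_lifts (A B C : Monoid M) (L : Bimod A B) (N N' : Bimod A C)
  (g : BimodMap N N') (U V : M) (i : hom U V) :
  left_pp C L -> cof m i -> fib m (bfun g) -> weq m i \/ weq m (bfun g) ->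
  lifts i (homA_fun (bimod_id L) g).
Proof.
move=> pL ci fg wig u v e.
have ul := Alinear_pre u (@evA_lin _ _ _ _ L N).
have vl := Alinear_pre v (@evA_lin _ _ _ _ L N').
have [|c [cl ca gc]] := pL _ _ _ _ _ _ _ _ ci fg wig ul vl.
  rewrite [in RHS]compA -tmapR -e tmapR (pre2 (homA_funE (bimod_id L) g)).
  by rewrite /= tmap1 compm1 compA.
exists (curA cl); split; apply: curA_uniq; first by rewrite tmapR (pre2 (curAK _)).
by rewrite tmapR (pre2 (homA_funE _ _)) /= tmap1 compm1 compA curAK.
Qed.

Lemma homA_fib (A B C : Monoid M) (L : Bimod A B) (N N' : Bimod A C) (g : BimodMap N N') :
  left_pp C L -> fib m (bfun g) -> fib m (homA_fun (bimod_id L) g).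
Proof. by move=> pL fg; apply: rlp_fib => U V i ci wi; apply: homA_lifts => //; left. Qed.

Lemma homA_afib (A B C : Monoid M) (L : Bimod A B) (N N' : Bimod A C) (g : BimodMap N N') :
  left_pp C L -> fib m (bfun g) -> weq m (bfun g) -> weq m (homA_fun (bimod_id L) g).
Proof.
move=> pL fg wg; apply: (proj2 (rlp_afib _)) => U V i ci.
by apply: homA_lifts => //; right.
Qed.

(** An acyclic cofibration in the contravariant variable is sent to an acyclic
    fibration when the other variable is fibrant. *)
Lemma homA_acof (A B C : Monoid M) (L L' : Bimod A B) (f : BimodMap L' L) (N : Bimod A C) :
  left_llp f -> inj_obj m (bcar N) -> weq m (homA_fun f (bimod_id N)).
Proof.
move=> pf iN; apply: (proj2 (rlp_afib _)) => U V i ci u v e.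
have ul := Alinear_pre u (@evA_lin _ _ _ _ L N).
have vl := Alinear_pre v (@evA_lin _ _ _ _ L' N).
have [|c [cl ca gc]] := left_fibrant_extend pf ci iN ul vl.
  rewrite [in RHS]compA -tmapR -e tmapR (pre2 (homA_funE f (bimod_id N))) /=.
  by rewrite comp1m !compA tmapC.
exists (curA cl); split; apply: curA_uniq; first by rewrite tmapR (pre2 (curAK _)).
rewrite tmapR (pre2 (homA_funE _ _)) /= comp1m compA tmapC -compA curAK.
by [].
Qed.

(** * Balanced products *)

Section Trilinear.
Variables (A B C : Monoid M) (X : Bimod A B) (Y : Bimod B C) (Z : Bimod A C).

(** Maps linear in both outer variables and balanced over [B] are what [X ∧_B Y]
    represents.  Unlike [tenB], this notion is its own mirror image on the nose
    ([rev_trilinear]). *)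
Definition trilinear (k : hom (X ⊗ Y) Z) : Prop :=
  [/\ k ∘ ((lact X ⊠ idm Y) ∘ asl A X Y) = lact Z ∘ (idm A ⊠ k),
      k ∘ ((idm X ⊠ ract Y) ∘ asr X Y C) = ract Z ∘ (k ⊠ idm C) &
      k ∘ (ract X ⊠ idm Y) = k ∘ ((idm X ⊠ lact Y) ∘ asr X B Y)].

Lemma tenB_trilinear (k : BimodMap (tenB_bimod X Y) Z) :
  trilinear (bfun k ∘ qB X Y).
Proof.
split.
- by rewrite compA -tenB_lactE tmapR -[lact Z ∘ _]compA -bfunl compA.
- by rewrite compA -tenB_ractE tmapL -[ract Z ∘ _]compA -bfunr compA.
- by rewrite !compA (q_bal (qB_coeq X Y)).
Qed.

Lemma trilinear_desc (k : hom (X ⊗ Y) Z) : trilinear k ->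
  exists h : BimodMap (tenB_bimod X Y) Z, bfun h ∘ qB X Y = k.
Proof.
move=> [kl kr kb]; pose h := coeq_desc (qB_coeq X Y) kb.
have hq : h ∘ qB X Y = k by exact: coeq_descK.
have hl : h ∘ lact (tenB_bimod X Y) = lact Z ∘ (idm A ⊠ h).
  apply: (coeq_epi (coeq_tensl _ (qB_coeq X Y))).
  by rewrite !compA tenB_lactE (pre2 hq) kl -tmapR hq.
have hr : h ∘ ract (tenB_bimod X Y) = ract Z ∘ (h ⊠ idm C).
  apply: (coeq_epi (coeq_tensr _ (qB_coeq X Y))).
  by rewrite !compA tenB_ractE (pre2 hq) kr -tmapL hq.
by exists (@Build_BimodMap M A C (tenB_bimod X Y) Z h hl hr).
Qed.

Lemma trilinear_curry (k : hom (X ⊗ Y) Z) : trilinear k ->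
  exists h : BimodMap Y (homA_bimod X Z), evA X Z ∘ (idm X ⊠ bfun h) = k.
Proof.
move=> [kl kr kb].
have kA : Alinear k by rewrite /Alinear -[in RHS]compA -kl !compA asrK compm1.
have [h hE] : exists h, evA X Z ∘ (idm X ⊠ h) = k by exists (curA kA); exact: curAK.
have hl : h ∘ lact Y = lact (homA_bimod X Z) ∘ (idm B ⊠ h).
  apply: curA_uniq; move: hE (homA_lactE X Z) => /=; move: (homA_lact X Z) (evA X Z).
  move=> l e hE lE; rewrite !tmapR (pre2 hE) (pre22 lE) !compA.
  rewrite aslN3 (pre22 (tmapC _ _)) (pre2 hE) (pre22 kb) !compA aslK compm1.
  by [].
have hr : h ∘ ract Y = ract (homA_bimod X Z) ∘ (h ⊠ idm C).
  apply: curA_uniq; move: hE (homA_ractE X Z) => /=; move: (homA_ract X Z) (evA X Z).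
  move=> r e hE rE; rewrite !tmapR (pre2 hE) (pre22 rE) !compA.
  by rewrite aslN2 tmapL_pre hE -(compA (ract Z)) -kr !compA aslK compm1.
by exists (@Build_BimodMap M B C Y (homA_bimod X Z) h hl hr).
Qed.

Lemma uncurry_trilinear (h : BimodMap Y (homA_bimod X Z)) :
  trilinear (evA X Z ∘ (idm X ⊠ bfun h)).
Proof.
have := bfunl h; have := bfunr h; move: (bfun h) => /= k kr kl.
have eA := Alinear_pre k (@evA_lin _ _ _ _ X Z).
move: eA kl kr (homA_lactE X Z) (homA_ractE X Z).
move: (homA_lact X Z) (homA_ract X Z) (evA X Z) => l r e eA kl kr lE rE.
split.
- by rewrite -compA eA !compA aslK compm1.
- rewrite !compA tmapR_pre kr tmapR !compA (pre22 rE) !compA.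
  by rewrite -asrN2 (pre2 (asrK _ _ _)) comp1m tmapL.
- rewrite !compA tmapR_pre kl tmapR !compA (pre22 lE) !compA.
  by rewrite -asrN3 (pre2 (asrK _ _ _)) comp1m tmapC.
Qed.

End Trilinear.

Definition trilinear_llp (A B C : Monoid M) (X X' : Bimod A B) (Y Y' : Bimod B C)
    (f : BimodMap X X') (g : BimodMap Y Y') : Prop :=
  forall (Z Z' : Bimod A C) (p : BimodMap Z Z'), fib m (bfun p) ->
  forall (u : hom (X ⊗ Y) Z) (v : hom (X' ⊗ Y') Z'), trilinear u -> trilinear v ->
  bfun p ∘ u = v ∘ (bfun f ⊠ bfun g) ->
  exists h : hom (X' ⊗ Y') Z, [/\ trilinear h, h ∘ (bfun f ⊠ bfun g) = u & bfun p ∘ h = v].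

(** By adjunction one lifts [f] against [^A[X,Z] -> ^A[X,Z']], which is a
    fibration. *)
Lemma llp_tensR (A B C : Monoid M) (X : Bimod A B) (Y Y' : Bimod B C) (f : BimodMap Y Y') :
  left_pp C X -> mod_llp f -> trilinear_llp (bimod_id X) f.
Proof.
move=> pX pf Z Z' p fp u v /trilinear_curry[u' uE] /trilinear_curry[v' vE] e.
have [|h [hf ph]] := pf _ _ (homA_map (bimod_id X) p) (homA_fib pX fp) u' v'.
  apply: curA_uniq; rewrite !tmapR (pre2 (homA_funE _ _)) (pre2 vE) -e /=.
  by rewrite tmap1 compm1 compA uE.
exists (evA X Z ∘ (idm X ⊠ bfun h)); split; first exact: uncurry_trilinear.
  by rewrite compA -tmapR hf uE.
by rewrite -vE -ph tmapR (pre2 (homA_funE _ _)) /= tmap1 compm1 compA.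
Qed.

Lemma trilinear_llp_tenB (A B C : Monoid M) (X X' : Bimod A B) (Y Y' : Bimod B C)
  (f : BimodMap X X') (g : BimodMap Y Y') :
  trilinear_llp f g -> mod_llp (tenB_map f g).
Proof.
move=> fg Z Z' p fp u v e.
have [|k [kt ku pk]] := fg _ _ p fp _ _ (tenB_trilinear u) (tenB_trilinear v).
  by rewrite -compA e !compA; congr (_ ∘ _); exact: tenB_funE.
case: (trilinear_desc kt) => h hE; exists h; split; apply: qB_epi.
  by rewrite compA (tenB_funE f g) -ku -hE compA.
by rewrite compA hE.
Qed.

End LeftLifting.

Lemma rev_trilinear (M : MonoidalModelCategory) (A B C : Monoid M) (X : Bimod A B)
  (Y : Bimod B C) (Z : Bimod A C) (k : hom (X ⊗ Y) Z) :
  trilinear k <-> @trilinear (revM M) _ _ _ (revB Y) (revB X) (revB Z) k.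
Proof.
split=> -[kl kr kb]; split=> //=.
  by rewrite -[in RHS]compA kb !compA aslK compm1.
by move: kb => /= kb; rewrite -[in RHS]compA kb !compA asrK compm1.
Qed.

Lemma rev_Alinear (M : MonoidalModelCategory) (A B C : Monoid M) (Y : Bimod B C)
  (Z : Bimod (revMon C) (revMon A)) (U : M) (f : hom (U ⊗ Y) Z) :
  Rlinear (Z := unrevB Z) f <-> @Alinear (revM M) _ _ _ (revB Y) Z U f.
Proof.
rewrite /Alinear /Rlinear /=; split=> e.
  by rewrite -[in RHS]compA -e !compA aslK compm1.
by rewrite -compA e !compA asrK compm1.
Qed.

Lemma right_left_pp (M : MonoidalModelCategory) (A B C : Monoid M) (Y : Bimod B C) :
  right_proj Y -> @left_pp (revM M) _ _ (revMon A) (revB Y).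
Proof.
move=> pY U V i Z Z' p a b ci fp wip /rev_Alinear al /rev_Alinear bl e.
have [c [/rev_Alinear cl ca pc]] :=
  right_pushout_product (p := unrevB_map p) pY ci fp wip al bl e.
by exists c.
Qed.

(** The mirror image of [llp_tensR], with [Y] in the role of [X]. *)
Lemma llp_tensL (M : MonoidalModelCategory) (A B C : Monoid M) (X X' : Bimod A B)
  (Y : Bimod B C) (f : BimodMap X X') :
  right_proj Y -> mod_llp f -> trilinear_llp f (bimod_id Y).
Proof.
move=> pY pf Z Z' p fp u v /rev_trilinear ut /rev_trilinear vt e.
have [h [/rev_trilinear ht hf ph]] := @llp_tensR (revM M) _ _ _ (revB Y) _ _ (revB_map f)
  (right_left_pp pY) (rev_llp pf) (revB Z) (revB Z') (revB_map p) fp u v ut vt e.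
by exists h.
Qed.

(** * Model categories of modules *)

Section ModuleModels.
Variable M : MonoidalModelCategory.
Let m := mm_model M.

(** [[I,f]] is isomorphic to [f]. *)
Lemma unit_semicofibrant : semicofibrant (mcar (unitMonoid M)).
Proof.
have ret (Y Z : M) (f : hom Y Z) : is_retract (imap (idm munit) f) f.
  have eK (X : M) : curry (lun X) ∘ (ev munit X ∘ unlun _) = idm (ihom munit X).
    apply: curry_uniq; rewrite tmapR (pre2 (curryK _)) lunN compA lunK compm1.
    by rewrite tmap1 compm1.
  exists (ev munit Y ∘ unlun _), (curry (lun Y)), (ev munit Z ∘ unlun _), (curry (lun Z)).
  split=> //.
    by rewrite !compA unlunN (pre2 (imapE _ _)) tmap1 compm1 compA.
  apply: curry_uniq; rewrite !tmapR (pre2 (imapE _ _)) (pre2 (curryK _)) tmap1 compm1.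
  by rewrite compA curryK lunN.
split=> Y Z f ff; first exact: fib_retract (ret _ _ f) ff.
by move=> wf; split; [exact: fib_retract (ret _ _ f) ff | exact: weq_retract (ret _ _ f) wf].
Qed.

(** The laws hold because all maps to a terminal object agree. *)
Lemma terminal_bimod (A B : Monoid M) (T : M) : is_terminal T ->
  exists TB : Bimod A B, bcar TB = T /\ @is_terminal (bimodCat A B) TB.
Proof.
move=> tT; have tU X (f f' : hom X T) : f = f'.
  by case: (tT X) => h [_ hu]; rewrite -(hu f) // (hu f').
case: (tT (A ⊗ T)) (tT (T ⊗ B)) => l _ [r _].
pose TB := @Build_Bimod M A B T l r (tU _ _ _) (tU _ _ _) (tU _ _ _) (tU _ _ _) (tU _ _ _).
exists TB; split=> // X; case: (tT X) => f _.
exists (@Build_BimodMap M A B X TB f (tU _ _ _) (tU _ _ _)).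
by split=> // f' _; apply: bimodmap_ext; exact: tU.
Qed.

Section Created.
Variables (A B : Monoid M) (mAB : ModelStructure (bimodCat A B)).
Hypothesis mfib : forall X Y (f : @hom (bimodCat A B) X Y), fib mAB f <-> mod_fib f.
Hypothesis mweq : forall X Y (f : @hom (bimodCat A B) X Y), weq mAB f <-> mod_weq f.

(** Terminal bimodules are created in [M], and so fibrancy is too. *)
Lemma created_inj (X : Bimod A B) : inj_obj mAB X <-> inj_obj m (bcar X).
Proof.
case: (has_terminal (model_limits m)) => T tT.
case: (terminal_bimod A B tT) => TB [eT tTB]; rewrite -eT in tT.
case: (tTB X) => t _.
split=> iX.
  by apply/(inj_fibrant m (bfun t) tT); apply/mfib; apply/(inj_fibrant mAB t tTB).
by apply/(inj_fibrant mAB t tTB); apply/mfib; apply/(inj_fibrant m (bfun t) tT).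
Qed.

Lemma created_proj (X : Bimod A B) : @inj_obj _ (opModel mAB) X <-> mod_proj X.
Proof.
split=> pX Y Z p fp wp v.
  case: (pX Z Y p _ _ v); [exact/mfib | exact/mweq |].
  by move=> h /(f_equal (@bfun _ _ _ _ _)) hE; exists h.
case: (pX Z Y p _ _ v); [exact/mfib | exact/mweq |].
by move=> h hE; exists h; apply: bimodmap_ext.
Qed.

Lemma acof_llp (X Y : Bimod A B) (f : BimodMap X Y) :
  @cof _ mAB X Y f -> @weq _ mAB X Y f -> mod_llp f.
Proof.
move=> cf wf Z Z' p fp u v e.
case: (@acof_fib_lifts _ mAB X Y Z Z' f p cf wf _ u v); first exact/mfib.
  exact: bimodmap_ext.
by move=> h [<- <-]; exists h.
Qed.

Lemma llp_weq (X Y : Bimod A B) (f : BimodMap X Y) : mod_llp f -> weq m (bfun f).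
Proof.
move=> lf; apply/mweq; apply: (proj2 (llp_acof _)) => Z Z' p /mfib fp u v e.
have e' : bfun p ∘ bfun u = bfun v ∘ bfun f := f_equal (@bfun _ _ _ _ _) e.
by case: (lf _ _ p fp u v e') => h [h1 h2]; exists h; split; apply: bimodmap_ext.
Qed.

End Created.

Definition mod_fibrant (A B : Monoid M) (X : Bimod A B) : Prop := inj_obj m (bcar X).

Lemma class_ext (C : Category) (W W' : hom_class C) :
  (forall X Y (f : hom X Y), W X Y f <-> W' X Y f) -> W = W'.
Proof.
move=> e; apply: functional_extensionality_dep => X.
apply: functional_extensionality_dep => Y.
by apply: functional_extensionality => f; exact: propositional_extensionality.
Qed.

Lemma pred_ext (T : Type) (P Q : T -> Prop) : (forall X, P X <-> Q X) -> P = Q.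
Proof.
by move=> e; apply: functional_extensionality => X; exact: propositional_extensionality.
Qed.

Lemma fibrant_derivable (A B : Monoid M) : created_model A B ->
  exists app, right_derivable (@mod_weq M A B) (@mod_fibrant A B) app /\
  forall (E : Category) (F : Functor (bimodCat A B) E),
    (forall X Y (p : BimodMap X Y), mod_fibrant X -> mod_fibrant Y ->
       fib m (bfun p) -> weq m (bfun p) -> is_iso (@fmap _ _ F X Y p)) ->
    inverts_on (@mod_weq M A B) (@mod_fibrant A B) F.
Proof.
move=> [mAB [mfib mweq]].
have <- : @inj_obj _ mAB = @mod_fibrant A B by apply: pred_ext; exact: created_inj.
have <- : @weq _ mAB = @mod_weq M A B by apply: class_ext; exact: mweq.
exists (@acof _ mAB); split=> [|E F Fp]; first exact: model_derivable.
by apply: ken_brown => X Y p iX iY /mfib fp /mweq wp; exact: Fp.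
Qed.

Lemma cofibrant_derivable (A B : Monoid M) : created_model A B ->
  exists app, @right_derivable (opCat (bimodCat A B)) (op_class (@mod_weq M A B))
    (@mod_proj M A B) app /\
  forall (E : Category) (F : Functor (opCat (bimodCat A B)) E),
    (forall X Y (p : BimodMap Y X), mod_proj X -> mod_proj Y ->
       mod_llp p -> is_iso (@fmap _ _ F X Y p)) ->
    @inverts_on (opCat (bimodCat A B)) E (op_class (@mod_weq M A B)) (@mod_proj M A B) F.
Proof.
move=> [mAB [mfib mweq]].
have <- : @inj_obj _ (opModel mAB) = @mod_proj M A B by apply: pred_ext; exact: created_proj.
have <- : @weq _ mAB = @mod_weq M A B by apply: class_ext; exact: mweq.
exists (@acof _ (opModel mAB)); split=> [|E F Fp]; first exact: (model_derivable (opModel mAB)).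
apply: (ken_brown (m := opModel mAB)) => X Y p iX iY fp wp.
by apply: Fp => //; exact: acof_llp fp wp.
Qed.

Lemma created_llp_weq (A B : Monoid M) (X Y : Bimod A B) (f : BimodMap X Y) :
  created_model A B -> mod_llp f -> weq m (bfun f).
Proof. by move=> [mAB [mfib mweq]]; exact: (llp_weq mfib mweq). Qed.

Lemma loc_gamMod (A B : Monoid M) : localization (gamMod A B) (@mod_weq M A B).
Proof. exact: loc_gam. Qed.

Lemma mod_weq_id (A B : Monoid M) (X : bimodCat A B) : mod_weq (idm X).
Proof. exact: iso_weq (iso_idm _). Qed.

Lemma gamMod_iso (A B : Monoid M) (X Y : Bimod A B) (f : BimodMap X Y) :
  weq m (bfun f) -> is_iso (@fmap _ _ (gamMod A B) X Y f).
Proof. exact: (@gam_iso (bimodCat A B) (@mod_weq M A B) X Y f). Qed.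

Lemma HoResE (A A' B B' : Monoid M) (a : MonoidMap A' A) (b : MonoidMap B' B)
  (X Y : bimodCat A B) (f : hom X Y) :
  fmap (HoRes a b) (fmap (gamMod A B) f) = fmap (gamMod A' B') (fmap (resF a b) f).
Proof. exact: ho_liftE. Qed.

(** * Ext *)

Section Ext.
Variables (A B C : Monoid M).
Hypotheses (sB : semicofibrant (mcar B)).
Hypotheses (cAB : created_model A B) (cAC : created_model A C).

Definition ext_loc := prodF (opF (gamMod A B)) (gamMod A C).
Definition ext_weq := prod_class (op_class (@mod_weq M A B)) (@mod_weq M A C).
Definition ext_good : prodCat (opCat (bimodCat A B)) (bimodCat A C) -> Prop :=
  @pair_pred (opCat (bimodCat A B)) (bimodCat A C) (@mod_proj M A B) (@mod_fibrant A C).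

Lemma ext_localization : localization ext_loc ext_weq.
Proof.
apply: loc_prod; [exact/loc_op/loc_gamMod | exact: loc_gamMod | |];
by move=> X; exact: (@mod_weq_id _ _ X).
Qed.

Lemma ext_derivable : exists app, right_derivable ext_weq ext_good app.
Proof.
case: (cofibrant_derivable cAB) (fibrant_derivable cAC) => a1 [d1 _] [a2 [d2 _]].
by exists (prod_class a1 a2); exact: prod_derivable.
Qed.

(** Each variable is treated alone, by Ken Brown's lemma: acyclic cofibrations between
    cofibrant objects in the first, acyclic fibrations between fibrant objects in the
    second. *)
Lemma ext_inverts : inverts_on ext_weq ext_good (gamMod B C ∘F homF A B C).
Proof.
move=> [L N] [L' N'] [f g] [pL fN] [pL' fN'] [wf wg].
change (is_iso (fmap (gamMod B C ∘F homF A B C)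
  (@pmap (opCat (bimodCat A B)) (bimodCat A C) _ _ _ _ f g))).
rewrite fmap_pmap; apply: iso_comp.
  case: (cofibrant_derivable cAB) => app [_ /(_ _ (fixR (gamMod B C ∘F homF A B C) N')) kb].
  apply: kb wf => // X Y p pX pY lp.
  apply: (@gamMod_iso B C _ _ (homA_map p (bimod_id N'))).
  exact: (homA_acof (llp_left_llp sB lp) fN').
case: (fibrant_derivable cAC) => app [_ /(_ _ (fixL (gamMod B C ∘F homF A B C) L)) kb].
apply: kb wg => // X Y p fX fY fp wp.
have pp := left_pushout_product (D := C) (proj_left_proj sB pL).
apply: (@gamMod_iso B C _ _ (homA_map (bimod_id L) p)).
exact: (homA_afib pp fp wp).
Qed.

Variable E : ExtFunctor A B C.

Lemma ext_iso (L : Bimod A B) (N : Bimod A C) :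
  mod_proj L -> mod_fibrant N -> is_iso (rd_nat E (L, N)).
Proof.
move=> pL fN; case: ext_derivable => app dv.
exact: (derived_iso ext_localization dv E ext_inverts (X := (L, N))).
Qed.

End Ext.

(** The same maps are [A]-linear before and after the other actions are restricted. *)
Lemma hom_res_iso (A B B' C C' : Monoid M) (b : MonoidMap B' B) (c : MonoidMap C' C)
  (L : Bimod A B) (N : Bimod A C) : is_iso (bfun (hom_res_map (idMonoid A) b c L N)).
Proof.
have el : @Alinear M A B C L N _
    (evA (res_ob (idMonoid A) b L) (res_ob (idMonoid A) c N)).
  have := @evA_lin _ _ _ _ (res_ob (idMonoid A) b L) (res_ob (idMonoid A) c N).
  by rewrite /Alinear /= !tmap1 !compm1.
have hE := hom_res_funE (idMonoid A) b c L N; have kE := curAK el.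
exists (curA el); split; apply: curA_uniq; rewrite tmapR /=.
  by rewrite (pre2 kE) hE tmap1 compm1.
by rewrite (pre2 hE) kE tmap1 compm1.
Qed.

(** The transformation comes from the absoluteness of Ext.  It is invertible on good
    arguments, since these restrict to good arguments, hence everywhere. *)
Lemma ext_comparison (A B B' C C' : Monoid M) (b : MonoidMap B' B) (c : MonoidMap C' C)
  (E : ExtFunctor A B C) (E' : ExtFunctor A B' C') :
  semicofibrant (mcar B) -> semicofibrant (mcar B') ->
  created_model A B -> created_model A C -> created_model A B' -> created_model A C' ->
  (forall L : Bimod A B, mod_proj L -> mod_proj (res_ob (idMonoid A) b L)) ->
  exists t, unique (ext_compat (idMonoid A) b c E E') t /\ is_nat_iso t.
Proof.
move=> sB sB' cAB cAC cAB' cAC' resP.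
pose a := idMonoid A.
pose K := prodF (opF (HoRes a b)) (HoRes a c).
pose K0 := prodF (opF (resF a b)) (resF a c).
pose P := gamMod B C ∘F homF A B C.
pose xi (X : prodCat (opCat (bimodCat A B)) (bimodCat A C)) :
    hom ((HoRes b c ∘F P) X) ((E' ∘F K ∘F ext_loc A B C) X) :=
  rd_nat E' (K0 X) ∘ fmap (gamMod B' C') (hom_res a b c X).
have e1 X Y (f : hom X Y) : fmap (HoRes b c ∘F P) f =
    fmap (gamMod B' C') (fmap (resF b c ∘F homF A B C) f) := HoResE b c _.
(* On images of module maps, derived restriction is restriction of modules. *)
have e2 X Y (f : hom X Y) : fmap (E' ∘F K ∘F ext_loc A B C) f =
    fmap (E' ∘F ext_loc A B' C') (fmap K0 f).
  have e : (fmap (HoRes a b) (fmap (gamMod A B) f.1), fmap (HoRes a c) (fmap (gamMod A C) f.2)) =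
    (fmap (gamMod A B') (fmap (resF a b) f.1), fmap (gamMod A C') (fmap (resF a c) f.2)).
    by rewrite !HoResE.
  exact: (f_equal (@fmap _ _ E' (ext_loc A B' C' (K0 X)) (ext_loc A B' C' (K0 Y))) e).
have xiN X Y (f : hom X Y) :
    xi Y ∘ fmap (HoRes b c ∘F P) f = fmap (E' ∘F K ∘F ext_loc A B C) f ∘ xi X.
  rewrite e1 e2 /xi.
  have hN := f_equal (@fmap _ _ (gamMod B' C') _ _) (ntN (hom_res a b c) f).
  rewrite !fmapM in hN.
  have eN := ntN (rd_nat E') (fmap K0 f).
  by rewrite compA hN -compA eN compA.
have [app dv] := ext_derivable cAB cAC.
have gL := ext_localization A B C.
have ei X : ext_good X -> is_iso (rd_nat E X).
  exact: (derived_iso gL dv E (ext_inverts sB cAB cAC)).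
have [t [tE tu]] := derived_absolute gL dv (@Build_Nat _ _ (HoRes b c ∘F P)
  (E' ∘F K ∘F ext_loc A B C) xi xiN) ei.
exists t; split; first split.
- by move=> L N; exact: (tE (L, N)).
- by move=> s sE; apply: tu => -[L N]; exact: sE.
have ti : forall X, is_iso (t (ext_loc A B C X)).
  apply: (iso_on_good gL dv) => X gX.
  apply: (iso_cancel_r (fmap_iso (HoRes b c) (ei X gX))); rewrite (tE X).
  case: X gX => L N [pL fN]; apply: iso_comp.
    exact: (@ext_iso A B' C' sB' cAB' cAC' E' (res_ob a b L) (res_ob a c N) (resP L pL) fN).
  by apply: gamMod_iso; apply: iso_weq; exact: hom_res_iso.
by move=> [L N]; exact: (ti (L, N)).
Qed.

(** * Tor *)

Section Tor.
Variables (A B C : Monoid M).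
Hypotheses (sB : semicofibrant (mcar B)).
Hypotheses (cAB : created_model A B) (cBC : created_model B C) (cAC : created_model A C).

Definition tor_loc := prodF (gamMod A B) (gamMod B C).
Definition tor_weq := prod_class (@mod_weq M A B) (@mod_weq M B C).
Definition tor_good : prodCat (bimodCat A B) (bimodCat B C) -> Prop :=
  @pair_pred (bimodCat A B) (bimodCat B C) (@mod_proj M A B) (@mod_proj M B C).

Lemma tor_localization : localization tor_loc tor_weq.
Proof.
by apply: loc_prod; try exact: loc_gamMod; move=> X; exact: mod_weq_id.
Qed.

Lemma tor_derivable : exists app,
  @right_derivable (opCat (prodCat (bimodCat A B) (bimodCat B C)))
    (op_class tor_weq) tor_good app.
Proof.
case: (cofibrant_derivable cAB) (cofibrant_derivable cBC) => a1 [d1 _] [a2 [d2 _]].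
by exists (prod_class a1 a2); exact: op_prod_derivable d1 d2.
Qed.

(** Tensoring with a cofibrant module preserves acyclic cofibrations: by
    [llp_tensR] and [llp_tensL] the result lifts against all fibrations. *)
Lemma tor_inverts : inverts_on tor_weq tor_good (gamMod A C ∘F tenF A B C).
Proof.
move=> [X Y] [X' Y'] [f g] [pX pY] [pX' pY'] [wf wg].
change (is_iso (fmap (gamMod A C ∘F tenF A B C)
  (@pmap (bimodCat A B) (bimodCat B C) _ _ _ _ f g))).
rewrite fmap_pmap; apply: iso_comp.
  case: (cofibrant_derivable cAB).
  move=> app [_ /(_ _ (opF (fixR (gamMod A C ∘F tenF A B C) Y'))) kb].
  apply/(@iso_op (HoMod A C)); apply: kb wf => // Z Z' p pZ pZ' lp.
  apply/(@iso_op (HoMod A C)).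
  apply: (@gamMod_iso A C _ _ (tenB_map p (bimod_id Y'))).
  apply: (created_llp_weq cAC); apply: trilinear_llp_tenB.
  exact: (llp_tensL (proj_right_proj sB pY') lp).
case: (cofibrant_derivable cBC).
move=> app [_ /(_ _ (opF (fixL (gamMod A C ∘F tenF A B C) X))) kb].
apply/(@iso_op (HoMod A C)); apply: kb wg => // Z Z' p pZ pZ' lp.
apply/(@iso_op (HoMod A C)).
apply: (@gamMod_iso A C _ _ (tenB_map (bimod_id X) p)).
apply: (created_llp_weq cAC); apply: trilinear_llp_tenB.
exact: (llp_tensR (left_pushout_product (D := C) (proj_left_proj sB pX)) lp).
Qed.

Variable T : TorFunctor A B C.

Lemma tor_iso (X : Bimod A B) (Y : Bimod B C) :
  mod_proj X -> mod_proj Y -> is_iso (ld_nat T (X, Y)).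
Proof.
move=> pX pY; case: tor_derivable => app dv.
exact: (left_derived_iso tor_localization dv T tor_inverts (X := (X, Y))).
Qed.

End Tor.

(** Balancing over [B] is unaffected by restricting the outer actions. *)
Lemma ten_res_iso (A A' B C C' : Monoid M) (a : MonoidMap A' A) (c : MonoidMap C' C)
  (X : Bimod A B) (Y : Bimod B C) : is_iso (bfun (ten_res_map a (idMonoid B) c X Y)).
Proof.
pose X' := res_ob a (idMonoid B) X; pose Y' := res_ob (idMonoid B) c Y.
have qb : qB X' Y' ∘ ten_actl X Y = qB X' Y' ∘ ten_actr X Y.
  have := q_bal (qB_coeq X' Y').
  by rewrite /ten_actl /ten_actr /= !tmap1 !compm1.
have hE := ten_res_funE a (idMonoid B) c X Y; have kE := coeq_descK (qB_coeq X Y) qb.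
exists (coeq_desc (qB_coeq X Y) qb); split; apply: qB_epi => /=.
  by rewrite compA hE kE comp1m.
by rewrite compA kE hE comp1m.
Qed.

Lemma tor_comparison (A A' B C C' : Monoid M) (a : MonoidMap A' A) (c : MonoidMap C' C)
  (T' : TorFunctor A' B C') (T : TorFunctor A B C) :
  semicofibrant (mcar B) ->
  created_model A B -> created_model B C -> created_model A C ->
  created_model A' B -> created_model B C' -> created_model A' C' ->
  (forall X : Bimod A B, mod_proj X -> mod_proj (res_ob a (idMonoid B) X)) ->
  (forall Y : Bimod B C, mod_proj Y -> mod_proj (res_ob (idMonoid B) c Y)) ->
  exists t, unique (tor_compat a (idMonoid B) c T' T) t /\ is_nat_iso t.
Proof.
move=> sB cAB cBC cAC cAB' cBC' cAC' resX resY.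
pose b := idMonoid B.
pose K := prodF (HoRes a b) (HoRes b c).
pose K0 := prodF (resF a b) (resF b c).
pose P := gamMod A C ∘F tenF A B C.
pose xi (X : prodCat (bimodCat A B) (bimodCat B C)) :
    hom ((T' ∘F K ∘F tor_loc A B C) X) ((HoRes a c ∘F P) X) :=
  fmap (gamMod A' C') (ten_res a b c X) ∘ ld_nat T' (K0 X).
have e1 X Y (f : hom X Y) : fmap (HoRes a c ∘F P) f =
    fmap (gamMod A' C') (fmap (resF a c ∘F tenF A B C) f) := HoResE a c _.
have e2 X Y (f : hom X Y) : fmap (T' ∘F K ∘F tor_loc A B C) f =
    fmap (T' ∘F tor_loc A' B C') (fmap K0 f).
  have e : (fmap (HoRes a b) (fmap (gamMod A B) f.1), fmap (HoRes b c) (fmap (gamMod B C) f.2)) =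
    (fmap (gamMod A' B) (fmap (resF a b) f.1), fmap (gamMod B C') (fmap (resF b c) f.2)).
    by rewrite !HoResE.
  exact: (f_equal (@fmap _ _ T' (tor_loc A' B C' (K0 X)) (tor_loc A' B C' (K0 Y))) e).
have xiN X Y (f : hom X Y) :
    xi Y ∘ fmap (T' ∘F K ∘F tor_loc A B C) f = fmap (HoRes a c ∘F P) f ∘ xi X.
  rewrite e1 e2 /xi.
  have hN := f_equal (@fmap _ _ (gamMod A' C') _ _) (ntN (ten_res a b c) f).
  rewrite !fmapM in hN.
  have eN := ntN (ld_nat T') (fmap K0 f).
  by rewrite compA eN -compA hN compA.
have [app dv] := tor_derivable cAB cBC.
have gL := tor_localization A B C.
have inv := tor_inverts sB cAB cBC cAC.
have ei X : tor_good X -> is_iso (ld_nat T X).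
  exact: (left_derived_iso gL dv T inv).
have [t [tE tu]] := left_derived_absolute gL dv T inv (@Build_Nat _ _
  (T' ∘F K ∘F tor_loc A B C) (HoRes a c ∘F P) xi xiN).
exists t; split; first split.
- by move=> X Y; exact: (tE (X, Y)).
- by move=> s sE; apply: tu => -[X Y]; exact: sE.
have ti : forall X, is_iso (t (tor_loc A B C X)).
  apply: (left_iso_on_good gL dv) => X gX.
  apply: (iso_cancel_l (fmap_iso (HoRes a c) (ei X gX))); rewrite (tE X).
  case: X gX => X Y [pX pY]; apply: iso_comp.
    by apply: gamMod_iso; apply: iso_weq; exact: ten_res_iso.
  exact: (@tor_iso A' B C' sB cAB' cBC' cAC' T' (res_ob a b X) (res_ob b c Y)
    (resX X pX) (resY Y pY)).
by move=> [X Y]; exact: (ti (X, Y)).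
Qed.

End ModuleModels.

Theorem theorem1p11 (M : MonoidalModelCategory) (A B C : Monoid M)
    (hB : semicofibrant (mcar B)) :
  (created_model A B -> created_model A C -> created_model B C ->
   created_model A (unitMonoid M) ->
   forall (E : ExtFunctor A B C) (E' : ExtFunctor A (unitMonoid M) (unitMonoid M)),
   exists t, unique (ext_compat (idMonoid A) (unitMap B) (unitMap C) E E') t /\
     is_nat_iso t) /\
  (semicofibrant (mcar A) ->
   created_model (unitMonoid M) B -> created_model B C ->
   created_model (unitMonoid M) C -> created_model A B -> created_model A C ->
   forall (T' : TorFunctor (unitMonoid M) B C) (T : TorFunctor A B C),
   exists t, unique (tor_compat (unitMap A) (idMonoid B) (idMonoid C) T' T) t /\
     is_nat_iso t) /\
  (semicofibrant (mcar C) ->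
   created_model A B -> created_model B (unitMonoid M) ->
   created_model A (unitMonoid M) -> created_model B C -> created_model A C ->
   forall (T' : TorFunctor A B (unitMonoid M)) (T : TorFunctor A B C),
   exists t, unique (tor_compat (idMonoid A) (idMonoid B) (unitMap C) T' T) t /\
     is_nat_iso t).
Proof.
split; [|split].
- move=> cAB cAC _ cA E E'; apply: ext_comparison => //; first exact: unit_semicofibrant.
  by move=> L; exact: proj_res_unitR.
- move=> sA cB cBC cC cAB cAC T' T; apply: tor_comparison => //.
    by move=> X; exact: proj_res_unitL.
  by move=> Y; rewrite res_id.
- move=> sC cAB cB cA cBC cAC T' T; apply: tor_comparison => //.
    by move=> X; rewrite res_id.
  by move=> Y; exact: proj_res_unitR.
Qed.
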